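(* For every stack $\sigma$ and all discreet processes $P,Q$: if $P\approx_{\mathrm{wb}}^\sigma Q$ then $P\simeq_\sigma Q$.
   Context: Asynchronous $\pi$-calculus: processes $P ::= a\langle\tilde b\rangle \mid\ !a(\tilde b).P \mid P|Q \mid (\nu a)P \mid G$, $G ::= \mathbf 0 \mid a(\tilde b).P \mid \tau.P \mid [a=b]G \mid G+G'$, well-sorted; $\xrightarrow{\mu}$ is the standard early LTS of the asynchronous $\pi$-calculus (actions $\tau$, $a(\tilde b)$, $(\nu\tilde c)a\langle\tilde b\rangle$, subject $a$); $\Longrightarrow$ is the reflexive–transitive closure of $\xrightarrow\tau$; $\stackrel{\hat\mu}{\Longrightarrow}$ is $\Longrightarrow$ if $\mu=\tau$, else $\Longrightarrow\xrightarrow\mu\Longrightarrow$; $P\longrightarrow P'$ means $P\xrightarrow\tau P'$. Static contexts: $E=(\nu\tilde a)(R\mid[\cdot])$. Names: output-controlled ($x,y,z$), input-controlled ($u,v,w$), continuation ($p,q,r$); $a,b,c$ range over output- and input-controlled names. Outputs at output-controlled names carry tuples $\tilde a,p$ ending with exactly one continuation name; continuation names are transmitted only this way. Sequential typing (continuation names count as output-controlled): $\vdash_1 u(\tilde a).P$ if $\vdash_1P$; $\vdash_0 x(\tilde a).P$, $\vdash_0 !x(\tilde a).P$ if $\vdash_1P$; $\vdash_1x\langle\tilde a\rangle$; $\vdash_0u\langle\tilde a\rangle$; $\vdash_\eta(\nu a)P$ if $\vdash_\eta P$; $\vdash_0\mathbf0$; $\vdash_{\eta_1+\eta_2}P|Q$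 if $\vdash_{\eta_1}P,\vdash_{\eta_2}Q$, $\eta_1+\eta_2\le1$; $\vdash_\eta G_1+G_2$ if $\vdash_\eta G_1,G_2$; $\vdash_\eta\tau.P$ if $\vdash_\eta P$; $\vdash_0[a=b]G$ if $\vdash_0G$. Type-allowed $\eta\vdash P\xrightarrow{\mu}P'$: $\vdash_\eta P$, $P\xrightarrow{\mu}P'$, and $\eta=0$ or $\mu=\tau$ or ($\eta=1$ and $\mu$ an input at an input-controlled name or an output at an output-controlled name). $\eta\vdash P\Downarrow_a$ if $P\Longrightarrow P_0$ and $\eta\vdash P_0\xrightarrow{\mu}P_1$ for an output $\mu$ with subject $a$. Stacks: sequences of $p^{\mathrm O}$/$p^{\mathrm I}$ with alternating tags, ending with an output tag unless empty, each name at most once per tag, and if a name has both tags the input occurrence immediately follows the output one; clean if no name has both tags; $\mathrm{seq}(\sigma)=1$ if $\sigma$ starts with an output tag, else $0$; $|\sigma|$ the length. Interleaving: $\sigma_1\in\sigma_2\between\sigma_3$ iff $\sigma_1$ is a stack derivable by $\emptyset\in\emptyset\between\emptyset$, $t,\sigma_1\in\sigma_2\between t,\sigma_3$, $t,\sigma_1\in t,\sigma_2\between\sigma_3$ from $\sigma_1\in\sigma_2\between\sigma_3$. Typing $\vdash_\sigma P$: $\vdash_{p^{\mathrm O}}p\langle\tilde a\rangle$; $\vdash_{p^{\mathrm O}}x\langle\tilde a,p\rangle$; $\vdash_\emptyset u\langle\tilde a\rangle$; $\vdash_{q^{\mathrm I},p^{\mathrm O}}q(\tilde a).P$ if $\vdash_{p^{\mathrm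 O}}P$, $p\ne q$; $\vdash_\emptyset x(\tilde a,p).P$, $\vdash_\emptyset !x(\tilde a,p).P$ if $\vdash_{p^{\mathrm O}}P$; $\vdash_{p^{\mathrm O}}u(\tilde a).P$ if $\vdash_{p^{\mathrm O}}P$; $\vdash_\emptyset\mathbf0$; $\vdash_{\xi,\sigma'}(\nu p)P$ if $\vdash_{\xi,p^{\mathrm O},p^{\mathrm I},\sigma'}P$ with $\xi$ empty or ending with an input tag; $\vdash_\sigma(\nu p)P$ if $\vdash_\sigma P$, $p\notin\sigma$; $\vdash_\sigma(\nu a)P$ if $\vdash_\sigma P$; $\vdash_\emptyset[a=b]P$ if $\vdash_\emptyset P$; $\vdash_{\sigma''}P|Q$ if $\vdash_\sigma P,\vdash_{\sigma'}Q$, $\sigma''\in\sigma\between\sigma'$; $\vdash_\sigma\tau.P$, $\vdash_\sigma P+Q$ from $\vdash_\sigma P$ (and $\vdash_\sigma Q$) when $|\sigma|\le1$. A context $E$ is a $\sigma'/\sigma$ context if $\vdash_{\sigma'}E$ is derivable with the extra rule $\vdash_\sigma[\cdot]$. Typed transitions $\sigma\vdash P\xrightarrow{\mu}P'$: $\vdash_\sigma P$; $\mathrm{seq}(\sigma)\vdash P\xrightarrow{\mu}P'$; if a continuation name $p\in\mathrm{fn}(\mu)$ occurs in $\sigma$ then $\sigma=p^{\mathrm O},\sigma'$ or $p^{\mathrm I},\sigma'$, and if $p$ occurs in $\sigma'$ it is not the subject of $\mu$. $\langle\sigma;P\rangle\xrightarrow{\mu}\langle\sigma';P'\rangle$: $\sigma\vdash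 P\xrightarrow{\mu}P'$ and: if $\mu=(\nu\tilde b)p\langle\tilde a\rangle$ then $\sigma=p^{\mathrm O},\sigma'$; if $\mu=p(\tilde a)$ then $\sigma=p^{\mathrm I},\sigma'$; if $\mu=(\nu\tilde c,p)a\langle\tilde b,p\rangle$ then $\sigma'=p^{\mathrm I},\sigma$; if $\mu=(\nu\tilde c)a\langle\tilde b,p\rangle$ ($p$ free) then $\sigma=p^{\mathrm O},\sigma'$; if $\mu=a(\tilde b,p)$ then $\sigma'=p^{\mathrm O},\sigma$; if $\mu=\tau$ then $\sigma'=\sigma''$ when $\sigma=p^{\mathrm O},p^{\mathrm I},\sigma''$ and $p\notin\mathrm{fn}(P')$, else $\sigma'=\sigma$. Discreet transition: no continuation name in the object of $\mu$ is free in $\sigma$. Discreet process: no free continuation name appears in the object of an output, and in every subprocess $x(\tilde a,q).Q$, $q$ does not appear in the object of an output in $Q$. WB-bisimulation: set $\mathcal R$ of triples $(\sigma,P,Q)$ of discreet processes with $\vdash_\sigma P,Q$ such that whenever $(\sigma,P,Q)\in\mathcal R$ and $\langle\sigma;P\rangle\xrightarrow{\mu}\langle\sigma';P'\rangle$ is discreet, either (1) $Q\stackrel{\hat\mu}{\Longrightarrow}Q'$ with $(\sigma',P',Q')\in\mathcal R$; or (2) $\mu=x(\tilde a,p)$ and for some fresh $q$, $Q\mid(\nu q)(x\langle\tilde a,q\rangle\mid q(\tilde b).p\langle\tilde b\rangle)\Longrightarrow Q'$ with $(\sigma',P',Q')\in\mathcal R$; or (3) $\mu=u(\tilde a)$ and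 $Q|u\langle\tilde a\rangle\Longrightarrow Q'$ with $(\sigma',P',Q')\in\mathcal R$; and symmetrically. $P\approx_{\mathrm{wb}}^\sigma Q$ if $(\sigma,P,Q)$ is in some wb-bisimulation. Barbed equivalence: for clean $\sigma$, $\sigma\vdash P\Downarrow_a$ iff $\mathrm{seq}(\sigma)\vdash P\Downarrow_a$ (for any name $a$, including continuation names); $\dot\approx_\sigma$ is the largest symmetric relation on processes typed $\vdash_\sigma$ such that $P\dot\approx_\sigma Q$ implies: $P\longrightarrow P'$ gives $Q\Longrightarrow Q'$ with $P'\dot\approx_\sigma Q'$, and $\sigma\vdash P\Downarrow_a$ iff $\sigma\vdash Q\Downarrow_a$. $P\simeq_\sigma Q$ if $\vdash_\sigma P,Q$ and $E[P]\dot\approx_{\sigma'}E[Q]$ for every clean stack $\sigma'$ and every static $\sigma'/\sigma$ context $E$ ($\sigma$ itself need not be clean). *)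

(* Defs.v *)
From HB Require Import structures.
From mathcomp Require Import all_boot.
From Stdlib Require Export Relation_Operators.

Set Implicit Arguments.
Unset Strict Implicit.
Unset Printing Implicit Defensive.

Variant control := OutputControlled | InputControlled | Continuation.

Definition is_outc k := if k is OutputControlled then true else false.
Definition is_inc k := if k is InputControlled then true else false.
Definition is_cont k := if k is Continuation then true else false.

(* A sorting assigns to each sort of names its control discipline and the     *)
(* sorts of the tuples that names of this sort carry.                         *)
Record sorting := Sorting {
  sort :> eqType;
  ctl : sort -> control;
  obj : sort -> seq sort;
  objP : forall s, if is_outc (ctl s)
         then exists ss t, [/\ obj s = rcons ss t, is_cont (ctl t)
                             & all (fun r => ~~ is_cont (ctl r)) ss]
         else all (fun r => ~~ is_cont (ctl r)) (obj s) : Prop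
}.

Variant tag := TO | TI.

Definition bool_of_tag t := if t is TO then true else false.
Definition tag_of_bool (b : bool) := if b then TO else TI.
Lemma bool_of_tagK : cancel bool_of_tag tag_of_bool.
Proof. by case. Qed.
HB.instance Definition _ := Equality.copy tag (can_type bool_of_tagK).

Section Syntax.

Variable S : sorting.

Definition name := (S * nat)%type.

Definition outc (a : name) := is_outc (ctl a.1).
Definition inc (a : name) := is_inc (ctl a.1).
Definition cont (a : name) := is_cont (ctl a.1).

(* Locally nameless syntax: alpha-equivalent processes are equal.             *)
(* [Bound k j] is the j-th name bound by the k-th enclosing binder.           *)
Inductive var := Free of name | Bound of nat & nat.

Definition sum_of_var v : name + (nat * nat) :=
  match v with Free a => inl a | Bound k j => inr (k, j) end.
Definition var_of_sum v : var :=
  match v with inl a => Free a | inr (k, j) => Bound k j end.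
Lemma sum_of_varK : cancel sum_of_var var_of_sum.
Proof. by case. Qed.
HB.instance Definition _ := Equality.copy var (can_type sum_of_varK).

(* Input prefixes bind a whole tuple, whose sorts are recorded; [Nu] binds    *)
(* one name. That summands and matched processes are guarded is enforced by   *)
(* [wf] below.                                                                *)
Inductive proc :=
| Out of var & seq var
| Rep of var & seq S & proc
| Par of proc & proc
| Nu of S & proc
| Nil
| In of var & seq S & proc
| Tau of proc
| Match of var & var & proc
| Sum of proc & proc.

Definition is_guard P :=
  match P with Nil | In _ _ _ | Tau _ | Match _ _ _ | Sum _ _ => true
  | _ => false end.

(* [G] lists the sorts of the names bound by the enclosing binders.           *)
Definition vsort (G : seq (seq S)) (v : var) : option S :=
  match v with
  | Free a => Some a.1
  | Bound k j => onth (nth [::] G k) j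
  end.

Definition carries G (v : var) (ss : seq S) : bool :=
  if vsort G v is Some s then ss == obj s else false.

Fixpoint wf (G : seq (seq S)) (P : proc) : bool :=
  match P with
  | Out a bs =>
      if vsort G a is Some s then map (vsort G) bs == map Some (obj s)
      else false
  | Rep a ss P => carries G a ss && wf (ss :: G) P
  | Par P Q => wf G P && wf G Q
  | Nu s P => wf ([:: s] :: G) P
  | Nil => true
  | In a ss P => carries G a ss && wf (ss :: G) P
  | Tau P => wf G P
  | Match a b P => [&& isSome (vsort G a), isSome (vsort G b), is_guard P & wf G P]
  | Sum P Q => [&& is_guard P, is_guard Q, wf G P & wf G Q]
  end.

(* Well-sorted processes of the grammar, without dangling bound variables.    *)
Definition process (P : proc) : bool := wf [::] P.

Definition fnv (v : var) : seq name := if v is Free a then [:: a] else [::].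

Fixpoint fn (P : proc) : seq name :=
  match P with
  | Out a bs => fnv a ++ flatten (map fnv bs)
  | Rep a _ P | In a _ P => fnv a ++ fn P
  | Par P Q | Sum P Q => fn P ++ fn Q
  | Nu _ P | Tau P => fn P
  | Nil => [::]
  | Match a b P => fnv a ++ fnv b ++ fn P
  end.

Definition openv k (cs : seq name) (v : var) : var :=
  if v is Bound i j then
    if i == k then (if onth cs j is Some c then Free c else v) else v
  else v.

Fixpoint open_rec k (cs : seq name) (P : proc) : proc :=
  match P with
  | Out a bs => Out (openv k cs a) (map (openv k cs) bs)
  | Rep a ss P => Rep (openv k cs a) ss (open_rec k.+1 cs P)
  | Par P Q => Par (open_rec k cs P) (open_rec k cs Q)
  | Nu s P => Nu s (open_rec k.+1 cs P)
  | Nil => Nil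
  | In a ss P => In (openv k cs a) ss (open_rec k.+1 cs P)
  | Tau P => Tau (open_rec k cs P)
  | Match a b P => Match (openv k cs a) (openv k cs b) (open_rec k cs P)
  | Sum P Q => Sum (open_rec k cs P) (open_rec k cs Q)
  end.

(* Instantiates the outermost binder of a body with the names [cs].           *)
Definition open := open_rec 0.

Definition closev k (c : name) (v : var) : var :=
  if v is Free b then (if b == c then Bound k 0 else v) else v.

Fixpoint close_rec k (c : name) (P : proc) : proc :=
  match P with
  | Out a bs => Out (closev k c a) (map (closev k c) bs)
  | Rep a ss P => Rep (closev k c a) ss (close_rec k.+1 c P)
  | Par P Q => Par (close_rec k c P) (close_rec k c Q)
  | Nu s P => Nu s (close_rec k.+1 c P)
  | Nil => Nil
  | In a ss P => In (closev k c a) ss (close_rec k.+1 c P)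
  | Tau P => Tau (close_rec k c P)
  | Match a b P => Match (closev k c a) (closev k c b) (close_rec k c P)
  | Sum P Q => Sum (close_rec k c P) (close_rec k c Q)
  end.

(* The restriction (nu a)P, for a free name [a] of [P].                       *)
Definition nu (a : name) (P : proc) : proc := Nu a.1 (close_rec 0 a P).
Definition nus (cs : seq name) (P : proc) : proc := foldr nu P cs.

(* [bs] are names of sorts [ss], pairwise distinct and fresh for the body     *)
(* [P]: by alpha-conversion, [In a ss P] is a(bs).(open bs P), and            *)
(* [Nu a.1 P] is (nu a)(open [:: a] P) when [a] is fresh for [P].             *)
Definition fresh_names (bs : seq name) (ss : seq S) (P : proc) : bool :=
  [&& map fst bs == ss, uniq bs & all (fun b => b \notin fn P) bs].

Definition disjoint_names (s t : seq name) : bool := ~~ has (mem t) s.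

(* [AOut cs a bs] is (nu cs)a<bs>.                                            *)
Inductive action :=
| ATau
| AIn of name & seq name
| AOut of seq name & name & seq name.

Definition bn mu := if mu is AOut cs _ _ then cs else [::].
Definition subj mu :=
  match mu with ATau => None | AIn a _ | AOut _ a _ => Some a end.
Definition object mu :=
  match mu with ATau => [::] | AIn _ bs | AOut _ _ bs => bs end.
Definition act_names mu :=
  match mu with
  | ATau => [::] | AIn a bs => a :: bs | AOut cs a bs => cs ++ a :: bs
  end.
Definition act_fn mu := [seq a <- act_names mu | a \notin bn mu].

(* Early transitions. The bound names of an output form a set: they are       *)
(* listed in an arbitrary order, as [T_open] inserts the extruded name at any *)
(* position.                                                                  *)
Inductive trans : proc -> action -> proc -> Prop :=
| T_out a bs : trans (Out (Free a) (map Free bs)) (AOut [::] a bs) Nil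
| T_in a ss P bs : map fst bs = ss ->
    trans (In (Free a) ss P) (AIn a bs) (open bs P)
| T_rep a ss P bs : map fst bs = ss ->
    trans (Rep (Free a) ss P) (AIn a bs) (Par (open bs P) (Rep (Free a) ss P))
| T_tau P : trans (Tau P) ATau P
| T_match a P mu P' : trans P mu P' -> trans (Match (Free a) (Free a) P) mu P'
| T_sumL P Q mu P' : trans P mu P' -> trans (Sum P Q) mu P'
| T_sumR P Q mu Q' : trans Q mu Q' -> trans (Sum P Q) mu Q'
| T_parL P Q mu P' : trans P mu P' -> disjoint_names (bn mu) (fn Q) ->
    trans (Par P Q) mu (Par P' Q)
| T_parR P Q mu Q' : trans Q mu Q' -> disjoint_names (bn mu) (fn P) ->
    trans (Par P Q) mu (Par P Q')
| T_commL P Q cs a bs P' Q' :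
    trans P (AOut cs a bs) P' -> trans Q (AIn a bs) Q' ->
    disjoint_names cs (fn Q) ->
    trans (Par P Q) ATau (nus cs (Par P' Q'))
| T_commR P Q cs a bs P' Q' :
    trans P (AIn a bs) P' -> trans Q (AOut cs a bs) Q' ->
    disjoint_names cs (fn P) ->
    trans (Par P Q) ATau (nus cs (Par P' Q'))
| T_res a P mu P' : a \notin fn P -> trans (open [:: a] P) mu P' ->
    a \notin act_names mu ->
    trans (Nu a.1 P) mu (nu a P')
| T_open c P cs1 cs2 a bs P' : c \notin fn P ->
    trans (open [:: c] P) (AOut (cs1 ++ cs2) a bs) P' ->
    c != a -> c \in bs -> c \notin cs1 ++ cs2 ->
    trans (Nu c.1 P) (AOut (cs1 ++ c :: cs2) a bs) P'.

Definition red (P P' : proc) : Prop := trans P ATau P'.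
Definition wtau : proc -> proc -> Prop := clos_refl_trans proc red.

Definition weak (P : proc) (mu : action) (P' : proc) : Prop :=
  if mu is ATau then wtau P P'
  else exists P1 P2, [/\ wtau P P1, trans P1 mu P2 & wtau P2 P'].

Inductive seq_typ : nat -> proc -> Prop :=
| ST_inI u ss bs P : inc u -> fresh_names bs ss P ->
    seq_typ 1 (open bs P) -> seq_typ 1 (In (Free u) ss P)
| ST_inO x ss bs P : outc x || cont x -> fresh_names bs ss P ->
    seq_typ 1 (open bs P) -> seq_typ 0 (In (Free x) ss P)
| ST_repO x ss bs P : outc x || cont x -> fresh_names bs ss P ->
    seq_typ 1 (open bs P) -> seq_typ 0 (Rep (Free x) ss P)
| ST_outO x bs : outc x || cont x -> seq_typ 1 (Out (Free x) (map Free bs))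
| ST_outI u bs : inc u -> seq_typ 0 (Out (Free u) (map Free bs))
| ST_nu eta a P : a \notin fn P -> seq_typ eta (open [:: a] P) ->
    seq_typ eta (Nu a.1 P)
| ST_nil : seq_typ 0 Nil
| ST_par eta1 eta2 P Q : seq_typ eta1 P -> seq_typ eta2 Q ->
    eta1 + eta2 <= 1 -> seq_typ (eta1 + eta2) (Par P Q)
| ST_sum eta P Q : seq_typ eta P -> seq_typ eta Q -> seq_typ eta (Sum P Q)
| ST_tau eta P : seq_typ eta P -> seq_typ eta (Tau P)
| ST_match a b P : seq_typ 0 P -> seq_typ 0 (Match (Free a) (Free b) P).

Definition type_allowed (eta : nat) (P : proc) (mu : action) (P' : proc) :=
  [/\ seq_typ eta P, trans P mu P'
    & [\/ eta = 0, mu = ATau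
       | eta = 1 /\ match mu with
                    | ATau => False
                    | AIn a _ => inc a
                    | AOut _ a _ => outc a || cont a
                    end]].

Definition weak_barb (eta : nat) (P : proc) (a : name) : Prop :=
  exists P0 cs bs P1, wtau P P0 /\ type_allowed eta P0 (AOut cs a bs) P1.

(* The head of the sequence is the top of the stack.                          *)
Definition stack := seq (name * tag).

Definition names_of (sigma : stack) : seq name := map fst sigma.

Definition both_tags (sigma : stack) (p : name) : bool :=
  ((p, TO) \in sigma) && ((p, TI) \in sigma).

Definition is_stack (sigma : stack) : bool :=
  [&& all cont (names_of sigma),
      sorted (fun e f : name * tag => e.2 != f.2) sigma,
      last TO (map snd sigma) == TO,
      uniq sigma
    & all (fun p => both_tags sigma p ==>
                    (index (p, TI) sigma == (index (p, TO) sigma).+1))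
          (names_of sigma)].

Definition clean (sigma : stack) : bool :=
  all (fun p => ~~ both_tags sigma p) (names_of sigma).

Definition seqn (sigma : stack) : nat :=
  if sigma is (_, TO) :: _ then 1 else 0.

Inductive shuffle : stack -> stack -> stack -> Prop :=
| SH_nil : shuffle [::] [::] [::]
| SH_right t s1 s2 s3 : shuffle s1 s2 s3 -> shuffle (t :: s1) s2 (t :: s3)
| SH_left t s1 s2 s3 : shuffle s1 s2 s3 -> shuffle (t :: s1) (t :: s2) s3.

Definition interleaving (s1 s2 s3 : stack) : Prop :=
  is_stack s1 /\ shuffle s1 s2 s3.

(* [nu_stack a s s']: from |-_s P one infers |-_s' (nu a)P. Shared by the     *)
(* typing of processes and of contexts.                                       *)
Inductive nu_stack : name -> stack -> stack -> Prop :=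
| NU_used p xi s : cont p -> last TI (map snd xi) = TI ->
    nu_stack p (xi ++ (p, TO) :: (p, TI) :: s) (xi ++ s)
| NU_unused p s : cont p -> p \notin names_of s -> nu_stack p s s
| NU_plain a s : ~~ cont a -> nu_stack a s s.

Inductive typ : stack -> proc -> Prop :=
| TY_outp p bs : cont p -> typ [:: (p, TO)] (Out (Free p) (map Free bs))
| TY_outx x bs p : outc x -> cont p ->
    typ [:: (p, TO)] (Out (Free x) (map Free (rcons bs p)))
| TY_outu u bs : inc u -> typ [::] (Out (Free u) (map Free bs))
| TY_inp q p ss bs P : cont q -> cont p -> p != q -> fresh_names bs ss P ->
    typ [:: (p, TO)] (open bs P) ->
    typ [:: (q, TI); (p, TO)] (In (Free q) ss P)
| TY_inx x p ss bs P : outc x -> cont p -> fresh_names (rcons bs p) ss P ->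
    typ [:: (p, TO)] (open (rcons bs p) P) ->
    typ [::] (In (Free x) ss P)
| TY_repx x p ss bs P : outc x -> cont p -> fresh_names (rcons bs p) ss P ->
    typ [:: (p, TO)] (open (rcons bs p) P) ->
    typ [::] (Rep (Free x) ss P)
| TY_inu u p ss bs P : inc u -> cont p -> fresh_names bs ss P ->
    typ [:: (p, TO)] (open bs P) ->
    typ [:: (p, TO)] (In (Free u) ss P)
| TY_nil : typ [::] Nil
| TY_nu a s s' P : a \notin fn P -> typ s (open [:: a] P) ->
    nu_stack a s s' -> typ s' (Nu a.1 P)
| TY_match a b P : ~~ cont a -> ~~ cont b -> typ [::] P ->
    typ [::] (Match (Free a) (Free b) P)
| TY_par s s' s'' P Q : typ s P -> typ s' Q -> interleaving s'' s s' ->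
    typ s'' (Par P Q)
| TY_tau s P : typ s P -> size s <= 1 -> typ s (Tau P)
| TY_sum s P Q : typ s P -> typ s Q -> size s <= 1 -> typ s (Sum P Q).

Definition wtyped (sigma : stack) (P : proc) : Prop := process P /\ typ sigma P.

(* The static context (nu as)(R | [.]); [as] may capture names of the         *)
(* process put in the hole.                                                   *)
Record context := Context { ctx_names : seq name; ctx_proc : proc }.

Definition fill (E : context) (P : proc) : proc :=
  nus (ctx_names E) (Par (ctx_proc E) P).

Inductive ctx_typ (sigma : stack) : stack -> context -> Prop :=
| CT_par s s' R : process R -> typ s R -> interleaving s' s sigma ->
    ctx_typ sigma s' (Context [::] R)
| CT_nu a cs R s s' : ctx_typ sigma s (Context cs R) -> nu_stack a s s' ->
    ctx_typ sigma s' (Context (a :: cs) R).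

Definition typed_trans (sigma : stack) (P : proc) (mu : action) (P' : proc) :=
  [/\ typ sigma P, type_allowed (seqn sigma) P mu P'
    & forall p, cont p -> p \in act_fn mu -> p \in names_of sigma ->
        exists t sigma', sigma = (p, t) :: sigma' /\
          (p \in names_of sigma' -> subj mu <> Some p)].

(* [next_stack s mu P' s']: the stack [s] becomes [s'] after a transition     *)
(* labelled [mu] to [P']. Actions at input-controlled names carry no          *)
(* continuation name and leave the stack unchanged.                           *)
Inductive next_stack : stack -> action -> proc -> stack -> Prop :=
| NS_outp p cs bs P' s : cont p ->
    next_stack ((p, TO) :: s) (AOut cs p bs) P' s
| NS_inp p bs P' s : cont p ->
    next_stack ((p, TI) :: s) (AIn p bs) P' s
| NS_outx_bound x cs bs p P' s : outc x -> p \in cs ->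
    next_stack s (AOut cs x (rcons bs p)) P' ((p, TI) :: s)
| NS_outx_free x cs bs p P' s : outc x -> p \notin cs ->
    next_stack ((p, TO) :: s) (AOut cs x (rcons bs p)) P' s
| NS_inx x bs p P' s : outc x ->
    next_stack s (AIn x (rcons bs p)) P' ((p, TO) :: s)
| NS_outu u cs bs P' s : inc u -> next_stack s (AOut cs u bs) P' s
| NS_inu u bs P' s : inc u -> next_stack s (AIn u bs) P' s
| NS_tau_pop p P' s : p \notin fn P' ->
    next_stack ((p, TO) :: (p, TI) :: s) ATau P' s
| NS_tau P' s :
    (forall p s', s = (p, TO) :: (p, TI) :: s' -> p \in fn P') ->
    next_stack s ATau P' s.

Definition config_trans (sigma : stack) (P : proc) (mu : action)
    (sigma' : stack) (P' : proc) : Prop :=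
  typed_trans sigma P mu P' /\ next_stack sigma mu P' sigma'.

Definition discreet_action (sigma : stack) (mu : action) : Prop :=
  forall p, cont p -> p \in object mu -> p \notin names_of sigma.

Definition shiftv (v : var) : var :=
  if v is Bound k j then Bound k.+1 j else v.

(* [v] occurs in the object of an output of [P].                              *)
Fixpoint in_output_object (v : var) (P : proc) : bool :=
  match P with
  | Out _ bs => v \in bs
  | Rep _ _ P | In _ _ P | Nu _ P => in_output_object (shiftv v) P
  | Par P Q | Sum P Q => in_output_object v P || in_output_object v Q
  | Nil => false
  | Tau P | Match _ _ P => in_output_object v P
  end.

(* No continuation name bound by an input of sorts [ss] with body [P] occurs  *)
(* in the object of an output of [P].                                         *)
Definition discreet_body (ss : seq S) (P : proc) : bool :=
  all (fun j => if onth ss j is Some s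
                then is_cont (ctl s) ==> ~~ in_output_object (Bound 0 j) P
                else true)
      (iota 0 (size ss)).

Fixpoint discreet_inputs (P : proc) : bool :=
  match P with
  | Out _ _ | Nil => true
  | Rep _ ss P | In _ ss P => discreet_body ss P && discreet_inputs P
  | Par P Q | Sum P Q => discreet_inputs P && discreet_inputs Q
  | Nu _ P | Tau P | Match _ _ P => discreet_inputs P
  end.

Definition discreet (P : proc) : Prop :=
  (forall p, cont p -> ~~ in_output_object (Free p) P) /\ discreet_inputs P.

(* q(bs).p<bs>, for p and q of the same sort.                                 *)
Definition link (q p : name) : proc :=
  In (Free q) (obj q.1)
     (Out (Free p) [seq Bound 0 j | j <- iota 0 (size (obj q.1))]).

(* The answer of [Q] to a step of its partner, labelled [mu], after which     *)
(* the stack is [sigma']; [ok sigma' Q'] states that the derivatives are      *)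
(* again related.                                                             *)
Definition wb_answer (ok : proc -> Prop) (mu : action) (Q : proc) : Prop :=
  [\/ exists2 Q', weak Q mu Q' & ok Q',
      exists x bs p q Q',
        [/\ outc x, mu = AIn x (rcons bs p),
            q.1 = p.1 /\ q \notin (x :: rcons bs p) ++ fn Q,
            wtau (Par Q (nu q (Par (Out (Free x) (map Free (rcons bs q)))
                                   (link q p)))) Q'
          & ok Q']
    | exists u bs Q',
        [/\ inc u, mu = AIn u bs,
            wtau (Par Q (Out (Free u) (map Free bs))) Q' & ok Q']].

Definition wb_simulation (R : stack -> proc -> proc -> Prop) : Prop :=
  forall sigma P Q, R sigma P Q ->
  forall mu sigma' P', config_trans sigma P mu sigma' P' ->
    discreet_action sigma mu -> disjoint_names (bn mu) (fn Q) ->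
    wb_answer (R sigma' P') mu Q.

Definition wb_bisimulation (R : stack -> proc -> proc -> Prop) : Prop :=
  [/\ forall sigma P Q, R sigma P Q ->
        [/\ discreet P, discreet Q, wtyped sigma P & wtyped sigma Q],
      wb_simulation R
    & wb_simulation (fun sigma Q P => R sigma P Q)].

Definition wb_bisimilar (sigma : stack) (P Q : proc) : Prop :=
  exists2 R, wb_bisimulation R & R sigma P Q.

Definition barbed_bisimulation (sigma : stack) (R : proc -> proc -> Prop) :=
  [/\ forall P Q, R P Q -> wtyped sigma P /\ wtyped sigma Q,
      forall P Q, R P Q -> R Q P,
      forall P Q, R P Q -> forall P', red P P' ->
        exists2 Q', wtau Q Q' & R P' Q'
    & forall P Q, R P Q -> forall a,
        weak_barb (seqn sigma) P a <-> weak_barb (seqn sigma) Q a].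

Definition barbed_bisimilar (sigma : stack) (P Q : proc) : Prop :=
  exists2 R, barbed_bisimulation sigma R & R P Q.

Definition barbed_equivalent (sigma : stack) (P Q : proc) : Prop :=
  [/\ wtyped sigma P, wtyped sigma Q
    & forall (sigma' : stack) (E : context),
        is_stack sigma' -> clean sigma' -> ctx_typ sigma sigma' E ->
        barbed_bisimilar sigma' (fill E P) (fill E Q)].

End Syntax.

(* Main.v *)
(* The relation to close is the one between (nu cs)(R | P) and (nu cs)(R | Q) with P and Q
   wb-bisimilar. Two things prevent it from being a barbed bisimulation. First, R may send to P
   a continuation p that is free in the stack, and such inputs of P are not discreet. But an
   output x<a,p> is barbed bisimilar, in every well-typed process, to (nu q)(x<a,q> | q(b).p<b>):
   by typing q is used linearly, so the forwarder only delays one communication. Hence all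
   outputs of R can be delayed beforehand, which makes R discreet, and discreetness is preserved
   by the transitions of R. Second, clauses (2) and (3) of the bisimulation game answer an input
   of P by putting the message, possibly delayed, next to Q. Since outputs are asynchronous,
   extracting the message from R does not change the process up to structural congruence, and
   the delay is again harmless, so these answers are steps up to barbed bisimilarity.

   The law for delays is proved on flat normal forms: the threads of the undelayed process are
   those of the delayed one under the substitution that forwards names along the forwarders. *)
From HB Require Import structures.
From mathcomp Require Import all_boot.
From mathcomp Require Import zify.
From Stdlib Require Import Relation_Operators Classical.
Require Import Defs.

Set Implicit Arguments.
Unset Strict Implicit.
Unset Printing Implicit Defensive.

(** Two facts make the delays harmless. By linearity of typing, each tagged continuation is owned by
    one thread of a normal form. The private name of a forwarder thus has one sender and one
    receiver, and firing the forwarder commits to nothing. A forwarder may point to the private name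
    of another one, so the substitution [theta] follows whole chains, and an output reaches its real
    subject after finitely many internal steps. [theta] is not injective, but it moves only
    continuation names, and typing keeps these out of matches. The inner stacks change along the
    game, whereas barbed bisimilarity is indexed by one outer stack. What reconciles the two is
    cleanness: a pair of tags consumed by a reduction cannot be visible in a clean stack, so a
    restriction of the context has bound it and the outer stack stays the same. Transitions are
    early and choose their bound names arbitrarily. Normal forms are therefore shown unique up to a
    bijection that fixes the free names, and a derivative is described for every fresh choice of the
    names that it restricts. *)

Ltac bool_atoms :=
  repeat (let b := fresh "b" in set b := (_ \in _); clearbody b);
  repeat (let b := fresh "b" in set b := (_ == _); clearbody b).
Ltac bool_cases :=
  repeat match goal with b : bool |- _ => destruct b; simpl end;
  unfold is_true; intros;
  repeat match goal with
  | |- true = true => reflexivity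
  | H : false = true |- _ => discriminate H
  | H : true = true -> _ |- _ => specialize (H (erefl true))
  end.
(** Inclusions between concatenated lists become propositional once the membership and equality
    tests are generalized to booleans. *)
Ltac memb := rewrite /= ?(mem_cat, inE); bool_atoms; bool_cases.

(** * Renaming of free names *)

Section Renaming.

Variable S : sorting.
Implicit Types (P Q : proc S) (f g : name S -> name S) (a b c : name S)
  (v : var S) (G : seq (seq S)) (bs cs : seq (name S)) (ss : seq S).

(** Lists of threads are compared by [perm_eq], which requires processes to form an [eqType]. *)
Definition proc_eq_dec P Q : decidable (P = Q).
Proof.
have vdec (v w : var S) : decidable (v = w) by exact: eq_comparable.
have vsdec (v w : seq (var S)) : decidable (v = w) by exact: eq_comparable.
have sdec (v w : S) : decidable (v = w) by exact: eq_comparable.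
have ssdec (v w : seq S) : decidable (v = w) by exact: eq_comparable.
rewrite /decidable in vdec vsdec sdec ssdec *.
decide equality.
Defined.

HB.instance Definition _ := hasDecEq.Build (proc S) (compareP proc_eq_dec).

Definition renv f v := if v is Free a then Free (f a) else v.

(** Bound names are indices, so no capture can occur and [f] may be arbitrary. Bijections serve for
    alpha-conversion, non-injective maps for instantiating binders and for following forwarders. *)
Fixpoint ren f P : proc S :=
  match P with
  | Out a bs => Out (renv f a) (map (renv f) bs)
  | Rep a ss P => Rep (renv f a) ss (ren f P)
  | Par P Q => Par (ren f P) (ren f Q)
  | Nu s P => Nu s (ren f P)
  | Nil => Nil S
  | In a ss P => In (renv f a) ss (ren f P)
  | Tau P => Tau (ren f P)
  | Match a b P => Match (renv f a) (renv f b) (ren f P)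
  | Sum P Q => Sum (ren f P) (ren f Q)
  end.

Definition sort_pres f := forall a, (f a).1 = a.1.

Lemma eq_renv f g v : {in fnv v, f =1 g} -> renv f v = renv g v.
Proof. by case: v => //= a H; rewrite H ?inE. Qed.

Lemma eq_renvs f g vs :
  {in flatten (map (@fnv S) vs), f =1 g} -> map (renv f) vs = map (renv g) vs.
Proof.
elim: vs => //= v vs IH H; rewrite (@eq_renv f g v) ?IH // => a ha;
  by apply: H; rewrite mem_cat ha ?orbT.
Qed.

Lemma in_catl f g (s t : seq (name S)) : {in s ++ t, f =1 g} -> {in s, f =1 g}.
Proof. by move=> H a ha; apply: H; rewrite mem_cat ha. Qed.

Lemma in_catr f g (s t : seq (name S)) : {in s ++ t, f =1 g} -> {in t, f =1 g}.
Proof. by move=> H a ha; apply: H; rewrite mem_cat ha orbT. Qed.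

Lemma eq_ren f g P : {in fn P, f =1 g} -> ren f P = ren g P.
Proof.
elim: P => //=.
- by move=> v vs H; rewrite (eq_renv (in_catl H)) (eq_renvs (in_catr H)).
- by move=> v ss P IH H; rewrite (eq_renv (in_catl H)) (IH (in_catr H)).
- by move=> P IHP Q IHQ H; rewrite (IHP (in_catl H)) (IHQ (in_catr H)).
- by move=> s P IH /IH ->.
- by move=> v ss P IH H; rewrite (eq_renv (in_catl H)) (IH (in_catr H)).
- by move=> P IH /IH ->.
- move=> v w P IH H; rewrite (eq_renv (in_catl H)).
  by rewrite (eq_renv (in_catl (in_catr H))) (IH (in_catr (in_catr H))).
- by move=> P IHP Q IHQ H; rewrite (IHP (in_catl H)) (IHQ (in_catr H)).
Qed.

Lemma renv_id v : renv id v = v. Proof. by case: v. Qed.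

Lemma renE_id P : ren id P = P.
Proof.
by elim: P => //= *; rewrite ?renv_id ?(eq_map renv_id) ?map_id; congruence.
Qed.

Lemma ren_id f P : {in fn P, f =1 id} -> ren f P = P.
Proof. by move/eq_ren->; exact: renE_id. Qed.

Lemma renv_comp f g v : renv f (renv g v) = renv (f \o g) v.
Proof. by case: v. Qed.

Lemma ren_comp f g P : ren f (ren g P) = ren (f \o g) P.
Proof.
elim: P => //= *; rewrite ?renv_comp -?map_comp ?(eq_map (renv_comp f g)) //;
  congruence.
Qed.

Lemma fnv_ren f v : fnv (renv f v) = map f (fnv v). Proof. by case: v. Qed.

Lemma fnvs_ren f vs :
  flatten (map (@fnv S) (map (renv f) vs)) = map f (flatten (map (@fnv S) vs)).
Proof. by elim: vs => //= v vs ->; rewrite fnv_ren map_cat. Qed.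

Lemma fn_ren f P : fn (ren f P) = map f (fn P).
Proof.
elim: P => //=; try by move=> *; rewrite !map_cat; congruence.
- by move=> v vs; rewrite fnv_ren fnvs_ren map_cat.
- by move=> v ss P IH; rewrite fnv_ren IH map_cat.
- by move=> v ss P IH; rewrite fnv_ren IH map_cat.
- by move=> v w P ->; rewrite !fnv_ren !map_cat.
Qed.

Lemma onth_map (T1 T2 : Type) (h : T1 -> T2) s i :
  onth (map h s) i = omap h (onth s i).
Proof. by elim: s i => [|x s IH] [|i] //=. Qed.

Lemma renv_open f k cs v :
  renv f (openv k cs v) = openv k (map f cs) (renv f v).
Proof.
case: v => //= i j; case: (i == k) => //.
by rewrite onth_map; case: (onth cs j).
Qed.

Lemma ren_open f k cs P :
  ren f (open_rec k cs P) = open_rec k (map f cs) (ren f P).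
Proof.
elim: P k => //= *; rewrite ?renv_open -?map_comp; try congruence.
by congr Out; apply: eq_map => w /=; rewrite renv_open.
Qed.

Lemma renv_close f k c v : injective f ->
  renv f (closev k c v) = closev k (f c) (renv f v).
Proof. by move=> fI; case: v => //= b; rewrite (inj_eq fI); case: eqP. Qed.

(** Closing binds exactly the occurrences of [c]; another name that [f] identifies with [c] would be
    bound on one side of the equation only. *)
Lemma ren_close f k c P : injective f ->
  ren f (close_rec k c P) = close_rec k (f c) (ren f P).
Proof.
move=> fI; elim: P k => //= *; rewrite ?renv_close -?map_comp //; try congruence.
by congr Out; apply: eq_map => w /=; rewrite renv_close.
Qed.

Lemma ren_nu f a P : injective f -> sort_pres f -> ren f (nu a P) = nu (f a) (ren f P).
Proof. by move=> fI fS; rewrite /nu /= ren_close // fS. Qed.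

Lemma nus_cons c cs P : nus (c :: cs) P = nu c (nus cs P).
Proof. by []. Qed.

Lemma ren_nus f cs P : injective f -> sort_pres f ->
  ren f (nus cs P) = nus (map f cs) (ren f P).
Proof. by move=> fI fS; elim: cs => // c cs IH; rewrite nus_cons ren_nu // IH. Qed.

Lemma fnv_close k c v : fnv (closev k c v) = filter (predC1 c) (fnv v).
Proof. by case: v => //= b; case: (b == c). Qed.

Lemma fnvs_close k c vs :
  flatten (map (@fnv S) (map (closev k c) vs)) =
  filter (predC1 c) (flatten (map (@fnv S) vs)).
Proof. by elim: vs => //= v vs ->; rewrite fnv_close filter_cat. Qed.

Lemma fn_close k c P : fn (close_rec k c P) = filter (predC1 c) (fn P).
Proof.
elim: P k => //=.
- by move=> v vs k; rewrite fnv_close fnvs_close filter_cat.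
- by move=> v ss P IH k; rewrite fnv_close IH filter_cat.
- by move=> P IHP Q IHQ k; rewrite IHP IHQ filter_cat.
- by move=> v ss P IH k; rewrite fnv_close IH filter_cat.
- by move=> v w P IH k; rewrite !fnv_close IH !filter_cat.
- by move=> P IHP Q IHQ k; rewrite IHP IHQ filter_cat.
Qed.

Lemma fn_nu a P : fn (nu a P) = filter (predC1 a) (fn P).
Proof. exact: fn_close. Qed.

Lemma mem_fn_nus x cs P : (x \in fn (nus cs P)) = (x \in fn P) && (x \notin cs).
Proof.
elim: cs => [|c cs IH]; first by rewrite andbT.
by rewrite nus_cons fn_nu mem_filter /= IH inE negb_or; case: eqP; rewrite ?andbF.
Qed.

Lemma mem_onth (T : eqType) (s : seq T) i x : onth s i = Some x -> x \in s.
Proof.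
elim: s i => [|y s IH] [|i] //=; first by case=> ->; rewrite inE eqxx.
by move/IH; rewrite inE => ->; rewrite orbT.
Qed.

Lemma fnv_open a k cs v : a \in fnv (openv k cs v) -> a \in fnv v \/ a \in cs.
Proof.
case: v => /= [b|i j]; first by left.
case: eqP => // _; case E: (onth cs j) => [c|] //.
by rewrite inE => /eqP ->; right; apply: mem_onth E.
Qed.

Lemma fnvs_open a k cs vs :
  a \in flatten (map (@fnv S) (map (openv k cs) vs)) ->
  a \in flatten (map (@fnv S) vs) \/ a \in cs.
Proof.
elim: vs => //= v vs IH; rewrite !mem_cat => /orP [/fnv_open|/IH] [] ->;
  rewrite ?orbT; first [by left | by right].
Qed.

Lemma fn_open a k cs P : a \in fn (open_rec k cs P) -> a \in fn P \/ a \in cs.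
Proof.
elim: P k => //=.
- move=> v vs k; rewrite !mem_cat => /orP [/fnv_open|/fnvs_open] [] ->;
    rewrite ?orbT; first [by left | by right].
- move=> v ss P IH k; rewrite !mem_cat => /orP [/fnv_open|/IH] [] ->;
    rewrite ?orbT; first [by left | by right].
- move=> P IHP Q IHQ k; rewrite !mem_cat => /orP [/IHP|/IHQ] [] ->;
    rewrite ?orbT; first [by left | by right].
- by move=> s P IH k H; apply: IH H.
- move=> v ss P IH k; rewrite !mem_cat => /orP [/fnv_open|/IH] [] ->;
    rewrite ?orbT; first [by left | by right].
- move=> v w P IH k; rewrite !mem_cat.
  by move=> /orP [/fnv_open|/orP [/fnv_open|/IH]] [] ->; rewrite ?orbT; first [by left | by right].
- move=> P IHP Q IHQ k; rewrite !mem_cat => /orP [/IHP|/IHQ] [] ->;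
    rewrite ?orbT; first [by left | by right].
Qed.

Lemma mem_fn_open1 a k c P :
  a \in fn (open_rec k [:: c] P) -> (a \in fn P) || (a == c).
Proof. by case/fn_open => [->|] //; rewrite inE => ->; rewrite orbT. Qed.

Lemma sub_fnv_open k cs v : {subset fnv v <= fnv (openv k cs v)}.
Proof. by case: v => [a|i j] x. Qed.

Lemma sub_fnvs_open k cs vs :
  {subset flatten (map (@fnv S) vs) <=
   flatten (map (@fnv S) (map (openv k cs) vs))}.
Proof.
elim: vs => //= v vs IH a; rewrite !mem_cat.
by case/orP => [/(sub_fnv_open k cs)->|/IH->]; rewrite ?orbT.
Qed.

Lemma sub_fn_open k cs P : {subset fn P <= fn (open_rec k cs P)}.
Proof.
elim: P k => //=.
- move=> v vs k a; rewrite !mem_cat.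
  by case/orP => [/(sub_fnv_open k cs)->|/(sub_fnvs_open k cs)->]; rewrite ?orbT.
- move=> v ss P IH k a; rewrite !mem_cat.
  by case/orP => [/(sub_fnv_open k cs)->|/(IH k.+1)->]; rewrite ?orbT.
- move=> P IHP Q IHQ k a; rewrite !mem_cat.
  by case/orP => [/(IHP k)->|/(IHQ k)->]; rewrite ?orbT.
- move=> v ss P IH k a; rewrite !mem_cat.
  by case/orP => [/(sub_fnv_open k cs)->|/(IH k.+1)->]; rewrite ?orbT.
- move=> v w P IH k a; rewrite !mem_cat.
  by case/or3P => [/(sub_fnv_open k cs)->|/(sub_fnv_open k cs)->|/(IH k)->];
    rewrite ?orbT.
- move=> P IHP Q IHQ k a; rewrite !mem_cat.
  by case/orP => [/(IHP k)->|/(IHQ k)->]; rewrite ?orbT.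
Qed.

Lemma closev_openv k c v : c \notin fnv v -> closev k c (openv k [:: c] v) = v.
Proof.
case: v => /= [b|i [|j]]; first by rewrite inE eq_sym; case: eqP.
- by move=> _; case: eqP => [->|] //=; rewrite eqxx.
- by move=> _; case: j => [|j]; case: eqP.
Qed.

Lemma closevs_openvs k c vs : c \notin flatten (map (@fnv S) vs) ->
  map (closev k c) (map (openv k [:: c]) vs) = vs.
Proof.
by elim: vs => //= v vs IH; rewrite mem_cat negb_or
  => /andP [/closev_openv-> /IH->].
Qed.

Lemma close_open k c P : c \notin fn P -> close_rec k c (open_rec k [:: c] P) = P.
Proof.
elim: P k => //=.
- by move=> v vs k; rewrite mem_cat negb_or => /andP [/closev_openv-> /closevs_openvs->].
- by move=> v ss P IH k; rewrite mem_cat negb_or => /andP [/closev_openv-> /IH->].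
- by move=> P IHP Q IHQ k; rewrite mem_cat negb_or => /andP [/IHP-> /IHQ->].
- by move=> s P IH k /IH->.
- by move=> v ss P IH k; rewrite mem_cat negb_or => /andP [/closev_openv-> /IH->].
- by move=> P IH k /IH->.
- move=> v w P IH k; rewrite !mem_cat !negb_or.
  by case/and3P => /closev_openv-> /closev_openv-> /IH->.
- by move=> P IHP Q IHQ k; rewrite mem_cat negb_or => /andP [/IHP-> /IHQ->].
Qed.

Lemma nu_open c P : c \notin fn P -> nu c (open [:: c] P) = Nu c.1 P.
Proof. by move=> H; rewrite /nu close_open. Qed.

(** Local closure at level [k]. A dangling index of level [k] could be instantiated together with
    the closed name, so opening is known to undo closing on locally closed processes. *)
Definition lcv k v := if v is Bound i _ then i < k else true.

Fixpoint lc k P : bool :=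
  match P with
  | Out a bs => lcv k a && all (lcv k) bs
  | Rep a _ P | In a _ P => lcv k a && lc k.+1 P
  | Par P Q | Sum P Q => lc k P && lc k Q
  | Nu _ P => lc k.+1 P
  | Nil => true
  | Tau P => lc k P
  | Match a b P => [&& lcv k a, lcv k b & lc k P]
  end.

Lemma openv_closev k c v : lcv k v -> openv k [:: c] (closev k c v) = v.
Proof.
case: v => /= [b|i j]; first by case: eqP => [->|] //=; rewrite eqxx.
by case: eqP => // ->; rewrite ltnn.
Qed.

Lemma open_close k c P : lc k P -> open_rec k [:: c] (close_rec k c P) = P.
Proof.
elim: P k => //=.
- move=> v vs k /andP [/openv_closev-> H]; congr Out.
  by elim: vs H => //= w vs IH /andP [/openv_closev-> /IH->].
- by move=> v ss P IH k /andP [/openv_closev-> /IH->].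
- by move=> P IHP Q IHQ k /andP [/IHP-> /IHQ->].
- by move=> s P IH k /IH->.
- by move=> v ss P IH k /andP [/openv_closev-> /IH->].
- by move=> P IH k /IH->.
- by move=> v w P IH k /and3P [/openv_closev-> /openv_closev-> /IH->].
- by move=> P IHP Q IHQ k /andP [/IHP-> /IHQ->].
Qed.

Lemma onth_nil (T : Type) i : onth ([::] : seq T) i = None.
Proof. by case: i. Qed.

Lemma vsort_lcv G v : vsort G v -> lcv (size G) v.
Proof.
case: v => //= i j; case: ltnP => // H.
by rewrite nth_default // onth_nil.
Qed.

Lemma map_vsort_lcv G vs (ts : seq S) :
  map (vsort G) vs = map Some ts -> all (lcv (size G)) vs.
Proof.
elim: vs ts => //= v vs IH [|t ts] //= [E /IH->].
by rewrite vsort_lcv ?E.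
Qed.

Lemma wf_lc G P : wf G P -> lc (size G) P.
Proof.
elim: P G => //=.
- move=> v vs G; case E: (vsort G v) => [s|] // /eqP /map_vsort_lcv ->.
  by rewrite vsort_lcv // E.
- move=> v ss P IH G /andP [H /IH->]; move: H; rewrite /carries.
  by case E: (vsort G v) => [s|] // _; rewrite vsort_lcv // E.
- by move=> P IHP Q IHQ G /andP [/IHP-> /IHQ->].
- by move=> s P IH G /IH.
- move=> v ss P IH G /andP [H /IH->]; move: H; rewrite /carries.
  by case E: (vsort G v) => [s|] // _; rewrite vsort_lcv // E.
- move=> v w P IH G /and4P [/vsort_lcv-> /vsort_lcv-> _ /IH->] //.
- by move=> P IHP Q IHQ G /and4P [_ _ /IHP-> /IHQ->].
Qed.

(** The binder being opened is the outermost one: its index is [size G] and its sorts are the last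
    entry of the environment, hence [rcons]. *)
Lemma vsort_open G bs v :
  vsort G (openv (size G) bs v) = vsort (rcons G (map fst bs)) v.
Proof.
case: v => //= i j; rewrite nth_rcons; case: (eqVneq i (size G)) => [->|ne].
- rewrite ltnn onth_map; case: (onth bs j) => //=.
  by rewrite nth_default // onth_nil.
- rewrite /=; case: ltnP => // H.
  by rewrite nth_default.
Qed.

Lemma carries_open G bs v ss :
  carries G (openv (size G) bs v) ss = carries (rcons G (map fst bs)) v ss.
Proof. by rewrite /carries vsort_open. Qed.

Lemma is_guard_open k bs P : is_guard (open_rec k bs P) = is_guard P.
Proof. by case: P. Qed.

Lemma wf_open_rec G bs P :
  wf G (open_rec (size G) bs P) = wf (rcons G (map fst bs)) P.
Proof.
elim: P G => //=.
- move=> v vs G; rewrite vsort_open; case: (vsort _ v) => // s.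
  by rewrite -map_comp; congr (_ == _); apply: eq_map => w /=; rewrite vsort_open.
- by move=> v ss P IH G; rewrite carries_open (IH (ss :: G)).
- by move=> P IHP Q IHQ G; rewrite IHP IHQ.
- by move=> v ss P IH G; rewrite carries_open (IH (ss :: G)).
- by move=> v w P IH G; rewrite !vsort_open is_guard_open IH.
- by move=> P IHP Q IHQ G; rewrite !is_guard_open IHP IHQ.
Qed.

Lemma process_open bs P : process (open bs P) = wf [:: map fst bs] P.
Proof. exact: (wf_open_rec [::]). Qed.

Lemma process_open1 a P : process (open [:: a] P) = wf [:: [:: a.1]] P.
Proof. exact: process_open. Qed.

Lemma process_Nu a P : process (Nu a.1 P) = process (open [:: a] P).
Proof. by rewrite process_open1. Qed.

Lemma process_lc P : process P -> lc 0 P.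
Proof. exact: wf_lc. Qed.

Lemma process_nu a P : process P -> process (nu a P).
Proof.
move=> H; rewrite /process /= -(process_open1 a).
by rewrite /open open_close // process_lc.
Qed.

Lemma process_nus cs P : process P -> process (nus cs P).
Proof. by move=> H; elim: cs => // c cs; apply: process_nu. Qed.

Lemma open_nu a P : process P -> open [:: a] (close_rec 0 a P) = P.
Proof. by move=> /process_lc H; rewrite /open open_close. Qed.

Lemma vsort_ren f G v : sort_pres f -> vsort G (renv f v) = vsort G v.
Proof. by move=> fS; case: v => //= a; rewrite fS. Qed.

Lemma wf_ren f G P : sort_pres f -> wf G (ren f P) = wf G P.
Proof.
have guard_ren Q : is_guard (ren f Q) = is_guard Q by case: Q.
move=> fS; elim: P G => //= *; rewrite /carries ?vsort_ren //; try congruence.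
- case: (vsort _ _) => // s; rewrite -map_comp; congr (_ == _).
  by apply: eq_map => w /=; rewrite vsort_ren.
Qed.

Lemma process_ren f P : sort_pres f -> process (ren f P) = process P.
Proof. exact: wf_ren. Qed.

Lemma snd_le_max a (L : seq (name S)) : a \in L -> a.2 <= \max_(b <- L) b.2.
Proof.
by move=> aL; apply: (@leq_bigmax_seq _ L xpredT (fun b : name S => b.2) a).
Qed.

Lemma fresh_name (s : S) (L : seq (name S)) : exists a : name S, a.1 = s /\ a \notin L.
Proof.
exists (s, (\max_(b <- L) b.2).+1); split=> //.
by apply/negP => /snd_le_max; rewrite ltnn.
Qed.

Lemma fresh_tuple ss (L : seq (name S)) : exists bs : seq (name S),
  [/\ map fst bs = ss, uniq bs & forall b, b \in bs -> b \notin L].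
Proof.
elim: ss L => [|s ss IH] L; first by exists [::].
have [a [<- aL]] := fresh_name s L.
have [bs [<- U H]] := IH (a :: L).
exists (a :: bs); split=> //=.
- by rewrite U andbT; apply/negP => /H; rewrite inE eqxx.
- move=> b; rewrite inE => /orP [/eqP->|/H] //.
  by rewrite inE negb_or => /andP [].
Qed.

Definition swap a b c := if c == a then b else if c == b then a else c.

Lemma swapK a b : involutive (swap a b).
Proof.
move=> c; rewrite /swap; case: (eqVneq c a) => [->|ca].
  by rewrite eqxx; case: eqP.
by case: (eqVneq c b) => [->|cb]; rewrite ?eqxx // (negPf ca) (negPf cb).
Qed.

Lemma swap_inj a b : injective (swap a b).
Proof. exact: inv_inj (swapK a b). Qed.

Lemma swap_sort a b : a.1 = b.1 -> sort_pres (swap a b).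
Proof. by move=> E c; rewrite /swap; case: eqP => [->|_] //; case: eqP => [->|]. Qed.

Lemma swapL a b : swap a b a = b. Proof. by rewrite /swap eqxx. Qed.
Lemma swapR a b : swap a b b = a.
Proof. by rewrite /swap eqxx; case: eqP. Qed.
Lemma swap_out a b c : c != a -> c != b -> swap a b c = c.
Proof. by rewrite /swap => /negPf-> /negPf->. Qed.

Definition renaming f g := [/\ cancel f g, cancel g f & sort_pres f].

Lemma renaming_inj f g : renaming f g -> injective f.
Proof. by case=> /can_inj. Qed.

Lemma renaming_sort f g : renaming f g -> sort_pres f.
Proof. by case. Qed.

Lemma renaming_inv f g : renaming f g -> renaming g f.
Proof. by move=> [fK gK fS]; split=> // a; rewrite -(fS (g a)) gK. Qed.

Lemma renaming_swap a b : a.1 = b.1 -> renaming (swap a b) (swap a b).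
Proof. by move=> E; split; [exact: swapK | exact: swapK | exact: swap_sort]. Qed.

Lemma renaming_comp f f' g g' :
  renaming f f' -> renaming g g' -> renaming (f \o g) (g' \o f').
Proof.
move=> [fK fK' fS] [gK gK' gS]; split.
- exact: can_comp.
- exact: can_comp.
- by move=> a /=; rewrite fS.
Qed.

(** Turns a finite injection of names into a bijection of all names, to which the renaming lemmas on
    closing and on transitions apply. *)
Lemma extend_renaming g (l : seq (name S)) :
  sort_pres g -> {in l &, injective g} ->
  exists f f', renaming f f' /\ {in l, f =1 g}.
Proof.
move=> gS; elim: l => [|a l IH] gI; first by exists id, id.
have [al|al] := boolP (a \in l).
  have [|f [f' [fR fg]]] := IH; first by apply: sub_in2 gI => x; rewrite inE orbC => ->.
  by exists f, f'; split=> // x; rewrite inE => /predU1P [->|]; apply: fg.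
have [|f [f' [fR fg]]] := IH.
  by apply: sub_in2 gI => x; rewrite inE orbC => ->.
have fS := renaming_sort fR.
(* The transposition corrects the value at [a] only: by injectivity of [f] and of [g], neither [f a]
   nor [g a] is the value of [f] at a name of [l]. *)
exists (swap (f a) (g a) \o f), (f' \o swap (f a) (g a)); split.
  by apply: renaming_comp fR; apply: renaming_swap; rewrite fS gS.
move=> x; rewrite inE /= => /predU1P [->|xl]; first by rewrite swapL.
rewrite swap_out (fg _ xl) //.
  rewrite -(fg _ xl); apply: contraNneq al => /(renaming_inj fR) <- //.
by apply: contraNneq al => /gI <-; rewrite ?inE ?eqxx ?xl ?orbT.
Qed.

(** With [K] containing the free names of a process, the bound names [cs] of one of its transitions
    can be moved away from [L] without changing the process. *)
Lemma fresh_renaming cs (K L : seq (name S)) :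
  uniq cs -> {in cs, forall c, c \notin K} ->
  exists f f', [/\ renaming f f', {in K, f =1 id}
              & {in cs, forall c, f c \notin L}].
Proof.
move=> U cK; have [ds [Eds Uds dL]] := fresh_tuple (map fst cs) (K ++ L).
have sz : size cs = size ds by rewrite -(size_map fst cs) -Eds size_map.
pose g a := if a \in cs then nth a ds (index a cs) else a.
have gcs c : c \in cs -> g c \in ds.
  by move=> cc; rewrite /g cc mem_nth // -sz index_mem.
have gS : sort_pres g.
  move=> a; rewrite /g; case: ifP => // ac.
  have i_lt : index a cs < size cs by rewrite index_mem.
  rewrite -(nth_map a a.1 fst) -?sz // Eds (nth_map a) // nth_index //.
have gK a : a \in K -> g a = a.
  by rewrite /g; case: ifP => // /cK /negPf->.
have gI : {in K ++ cs &, injective g}.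
  have mixed a b : a \in K -> b \in cs -> g a = g b -> a = b.
    move=> aK bc E; have := dL _ (gcs _ bc).
    by rewrite -E gK // mem_cat aK.
  move=> a b; rewrite !mem_cat => /orP [aK|ac] /orP [bK|bc] E.
  - by rewrite -(gK a) // E gK.
  - exact: mixed.
  - by apply/esym/mixed.
  - move: E; rewrite /g ac bc (set_nth_default b) -?sz ?index_mem // => /eqP.
    rewrite nth_uniq -?sz ?index_mem // => /eqP E.
    by rewrite -(nth_index a ac) E (set_nth_default b) ?index_mem // nth_index.
have [f [f' [fR fg]]] := extend_renaming gS gI.
exists f, f'; split=> // a H.
- by rewrite fg ?mem_cat ?H // gK.
- rewrite fg ?mem_cat ?H ?orbT //.
  by have := dL _ (gcs _ H); rewrite mem_cat negb_or => /andP [].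
Qed.

Definition ren_act f (mu : action S) : action S :=
  match mu with
  | ATau => ATau S
  | AIn a bs => AIn (f a) (map f bs)
  | AOut cs a bs => AOut (map f cs) (f a) (map f bs)
  end.

Lemma act_names_ren f mu : act_names (ren_act f mu) = map f (act_names mu).
Proof. by case: mu => //= *; rewrite map_cat. Qed.

Lemma bn_ren f mu : bn (ren_act f mu) = map f (bn mu).
Proof. by case: mu. Qed.

Lemma disjointP (s t : seq (name S)) :
  reflect (forall x, x \in s -> x \notin t) (disjoint_names s t).
Proof.
apply: (iffP hasPn) => H x; last exact: H.
by move/H.
Qed.

Lemma disjoint_ren f (s t : seq (name S)) : injective f ->
  disjoint_names s t -> disjoint_names (map f s) (map f t).
Proof.
move=> fI /disjointP H; apply/disjointP => _ /mapP [x xs ->].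
by rewrite mem_map // H.
Qed.

Lemma map_sort f bs : sort_pres f -> map fst (map f bs) = map fst bs.
Proof. by move=> fS; rewrite -map_comp; apply: eq_map => a /=; rewrite fS. Qed.

(** Injectivity keeps names apart, as the side conditions of parallel composition, restriction and
    extrusion demand. *)
Lemma trans_ren f P mu P' : injective f -> sort_pres f ->
  trans P mu P' -> trans (ren f P) (ren_act f mu) (ren f P').
Proof.
move=> fI fS; elim=> {P mu P'} /=.
- move=> a bs; rewrite -map_comp (_ : map _ bs = map (@Free S) (map f bs)).
    exact: T_out.
  by rewrite -map_comp.
- by move=> a ss P bs E; rewrite /open ren_open; apply: T_in; rewrite map_sort.
- by move=> a ss P bs E; rewrite /open ren_open; apply: T_rep; rewrite map_sort.
- by move=> P; apply: T_tau.
- by move=> a P mu P' _ IH; apply: T_match.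
- by move=> P Q mu P' _ IH; apply: T_sumL.
- by move=> P Q mu P' _ IH; apply: T_sumR.
- move=> P Q mu P' _ IH H; apply: T_parL => //.
  by rewrite bn_ren fn_ren disjoint_ren.
- move=> P Q mu P' _ IH H; apply: T_parR => //.
  by rewrite bn_ren fn_ren disjoint_ren.
- move=> P Q cs a bs P' Q' _ IH1 _ IH2 H; rewrite ren_nus //=.
  by apply: T_commL IH1 IH2 _; rewrite fn_ren disjoint_ren.
- move=> P Q cs a bs P' Q' _ IH1 _ IH2 H; rewrite ren_nus //=.
  by apply: T_commR IH1 IH2 _; rewrite fn_ren disjoint_ren.
- move=> a P mu P' aP _ IH amu; rewrite -(fS a) ren_close //.
  apply: T_res; rewrite ?fn_ren ?act_names_ren ?mem_map //.
  by move: IH; rewrite /open ren_open.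
- move=> c P cs1 cs2 a bs P' cP _ IH ca cb cc; rewrite -(fS c) map_cat /=.
  apply: T_open; rewrite ?fn_ren ?(inj_eq fI) -?map_cat ?mem_map //.
  by move: IH; rewrite /open ren_open map_cat.
Qed.

Lemma nus_alpha f cs P : injective f -> sort_pres f ->
  {in fn (nus cs P), f =1 id} -> nus (map f cs) (ren f P) = nus cs P.
Proof. by move=> fI fS /ren_id E; rewrite -ren_nus // E. Qed.

Lemma fnv_free_map (bs : seq (name S)) :
  flatten (map (@fnv S) (map (@Free S) bs)) = bs.
Proof. by elim: bs => //= b bs ->. Qed.

(** A sum or a match adds free names that an output of its component could extrude, which would
    break the freshness clause of [act_spec]. Guardedness rules this out. *)
Lemma guard_no_output P cs a bs P' : trans P (AOut cs a bs) P' ->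
  process P -> is_guard P -> False.
Proof.
move E: (AOut cs a bs) => mu H; elim: H E => {P mu P'} //=.
- by move=> b P mu P' _ IH E /and4P [_ _ H1 H2] _; apply: IH.
- by move=> P Q mu P' _ IH E /and4P [H1 _ H2 _] _; apply: IH.
- by move=> P Q mu P' _ IH E /and4P [_ H1 _ H2] _; apply: IH.
Qed.

Definition is_out (mu : action S) := if mu is AOut _ _ _ then true else false.

(** Early rules leave the received names unconstrained, whereas the bound names of an output are
    distinct, fresh for the source and part of the object. *)
Definition act_spec P (mu : action S) : Prop :=
  match mu with
  | ATau => True
  | AIn a _ => a \in fn P
  | AOut cs a bs => [/\ a \in fn P, {subset bs <= fn P ++ cs}, uniq cs,
                       {subset cs <= bs} & {in cs, forall c, c \notin fn P}]
  end.

Lemma trans_fn P mu P' : trans P mu P' -> process P ->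
  {subset fn P' <= fn P ++ act_names mu} /\ act_spec P mu.
Proof.
elim=> {P mu P'}.
- move=> a bs _; split=> //; rewrite /= fnv_free_map !inE eqxx; split=> //.
  by move=> b; rewrite cats0 inE orbC => ->.
- move=> a ss P bs E _; rewrite /= inE eqxx; split=> // b.
  by case/fn_open; rewrite !inE !mem_cat !inE => ->; rewrite ?orbT.
- move=> a ss P bs E _; rewrite /= inE eqxx; split=> // b; rewrite mem_cat.
  by case/orP => [/fn_open []|]; memb.
- by move=> P _; split=> // b; rewrite mem_cat => ->.
- move=> a P mu P' H IH /and4P [_ _ G W]; have [H1 H2] := IH W.
  split; first by move=> b /H1; rewrite /= !(inE, mem_cat) => /orP [] ->; rewrite ?orbT.
  case: mu H H2 {IH H1} => // [b bs _|cs b bs /guard_no_output] /=; last by case.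
  by rewrite !inE => ->; rewrite !orbT.
- move=> P Q mu P' H IH /and4P [G _ W _]; have [H1 H2] := IH W.
  split; first by move=> b /H1; rewrite /= !mem_cat => /orP [] ->; rewrite ?orbT.
  case: mu H H2 {IH H1} => // [b bs _|cs b bs /guard_no_output] /=; last by case.
  by rewrite mem_cat => ->.
- move=> P Q mu P' H IH /and4P [_ G _ W]; have [H1 H2] := IH W.
  split; first by move=> b /H1; rewrite /= !mem_cat => /orP [] ->; rewrite ?orbT.
  case: mu H H2 {IH H1} => // [b bs _|cs b bs /guard_no_output] /=; last by case.
  by rewrite mem_cat orbC => ->.
- move=> P Q mu P' _ IH /disjointP D /andP [WP WQ]; have [H1 H2] := IH WP.
  split; first by move=> b; rewrite /= !mem_cat => /orP [/H1|->]; rewrite ?mem_cat;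
    [case/orP => ->|]; rewrite ?orbT.
  case: mu D H2 {IH H1} => //= [b bs _|cs b bs D [K1 K2 K3 K4 K5]].
    by rewrite mem_cat => ->.
  split=> //; first by rewrite mem_cat K1.
    by move=> x /K2; rewrite !mem_cat => /orP [] ->; rewrite ?orbT.
  by move=> c cc; rewrite mem_cat negb_or K5 // D.
- move=> P Q mu P' _ IH /disjointP D /andP [WP WQ]; have [H1 H2] := IH WQ.
  split; first by move=> b; rewrite /= !mem_cat => /orP [->|/H1]; rewrite ?mem_cat //;
    case/orP => ->; rewrite ?orbT.
  case: mu D H2 {IH H1} => //= [b bs _|cs b bs D [K1 K2 K3 K4 K5]].
    by rewrite mem_cat => ->; rewrite orbT.
  split=> //; first by rewrite mem_cat K1 orbT.
    by move=> x /K2; rewrite !mem_cat => /orP [] ->; rewrite ?orbT.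
  by move=> c cc; rewrite mem_cat negb_or K5 // D.
- move=> P Q cs a bs P' Q' _ IH1 _ IH2 D /andP [WP WQ]; split=> // b.
  have [H1 [K1 K2 _ _ _]] := IH1 WP; have [H2 K3] := IH2 WQ.
  rewrite mem_fn_nus /= !mem_cat => /andP [/orP [/H1|/H2]].
    rewrite /= !mem_cat inE => /or4P [->|->|/eqP->|/K2] //; rewrite ?K1 //.
    by rewrite mem_cat => /orP [->|->].
  rewrite /= !mem_cat inE => /or3P [->|/eqP->|/K2]; rewrite ?orbT ?K1 //.
  by rewrite mem_cat => /orP [->|->].
- move=> P Q cs a bs P' Q' _ IH1 _ IH2 D /andP [WP WQ]; split=> // b.
  have [H1 [K1 K2 _ _ _]] := IH2 WQ; have [H2 K3] := IH1 WP.
  rewrite mem_fn_nus /= !mem_cat => /andP [/orP [/H2|/H1]].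
    rewrite /= !mem_cat inE => /or3P [->|/eqP->|/K2]; rewrite ?orbT ?K1 ?orbT //.
    by rewrite mem_cat => /orP [->|->]; rewrite ?orbT.
  rewrite /= !mem_cat inE => /or4P [->|->|/eqP->|/K2]; rewrite ?orbT ?K1 ?orbT //.
  by rewrite mem_cat => /orP [->|->]; rewrite ?orbT.
- move=> a P mu P' aP _ IH amu ; rewrite process_Nu => W.
  have [H1 H2] := IH W; split.
    move=> b; rewrite fn_nu mem_filter /= => /andP [/negPf ba /H1].
    by rewrite !mem_cat => /orP [/fn_open []|->]; rewrite ?orbT // ?inE ?ba // => ->.
  case: mu amu H2 {IH H1} => //= [b bs|cs b bs].
    rewrite inE negb_or => /andP [ab _] /fn_open [] //.
    by rewrite inE eq_sym (negPf ab).
  rewrite mem_cat inE !negb_or => /and3P [acs ab abs] [K1 K2 K3 K4 K5].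
  split=> //.
  + by case/fn_open: K1; rewrite // inE eq_sym (negPf ab).
  + move=> x xb; have := K2 _ xb; rewrite !mem_cat => /orP [/fn_open []|->];
      rewrite ?orbT // ?inE; first by move->.
    by move/eqP => E; rewrite E (negPf abs) in xb.
  + by move=> c /K5; apply: contra; apply: sub_fn_open.
- move=> c P cs1 cs2 a bs P' cP _ IH ca cb cc ; rewrite process_Nu => W.
  have [H1 [K1 K2 K3 K4 K5]] := IH W; split.
    move=> b /H1 bQ; have := @mem_fn_open1 b 0 c P; move: bQ; memb.
  split=> //.
  + by case/fn_open: K1; rewrite // inE eq_sym (negPf ca).
  + move=> x /K2 xQ; have := @mem_fn_open1 x 0 c P; move: xQ; memb.
  + rewrite (perm_uniq (_ : perm_eq _ (c :: cs1 ++ cs2))) /= ?cc //.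
    by rewrite -cat1s perm_catCA.
  + move=> x; rewrite mem_cat inE => /or3P [x1|/eqP->|x2] //;
      by apply: K4; rewrite mem_cat ?x1 ?x2 ?orbT.
  + have sub x : x \notin fn (open [:: c] P) -> x \notin fn P.
      by apply: contra => /(sub_fn_open 0 [:: c]).
    move=> x xc; have [->|xNc] := eqVneq x c; first exact: cP.
    apply: sub; apply: K5; move: xc; rewrite !(mem_cat, inE) (negPf xNc).
    by [].
Qed.

End Renaming.

(** * Stacks *)

Section Stacks.

Variable S : sorting.
Implicit Types (s t u xi : stack S) (p q a : name S) (e : name S * tag).

(* A recursive form of [is_stack]: [next_tag s] is the tag of the top of [s],
   the empty stack counting as an input because stacks end with an output. *)
Definition next_tag s : tag := if s is e :: _ then e.2 else TI.

Fixpoint stk s : bool :=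
  if s is e :: s' then
    [&& cont e.1, e \notin s', next_tag s' != e.2,
        (if e.2 is TO then ((e.1, TI) \in s') ==> (ohead s' == Some (e.1, TI))
         else (e.1, TO) \notin s')
      & stk s']
  else true.

Lemma seqnE s : seqn s = (next_tag s == TO).
Proof. by case: s => [|[p []]]. Qed.

Definition adjacent_tags s := forall p, (p, TO) \in s -> (p, TI) \in s ->
  index (p, TI) s = (index (p, TO) s).+1.

Lemma adjacentP s : reflect (adjacent_tags s)
  (all (fun p => both_tags s p ==> (index (p, TI) s == (index (p, TO) s).+1))
       (names_of s)).
Proof.
apply: (iffP allP) => [H p pO pI|H p _].
- have ps : p \in names_of s by apply/mapP; exists (p, TO).
  by have := H _ ps; rewrite /both_tags pO pI => /eqP.
- by apply/implyP => /andP [pO pI]; apply/eqP/H.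
Qed.

(** Indices shift uniformly under a new top, so only the name of the pushed entry has to be
    examined. *)
Lemma adjacent_cons e s : e \notin s ->
  adjacent_tags (e :: s) <->
  (if e.2 is TO then (e.1, TI) \in s -> ohead s = Some (e.1, TI)
   else (e.1, TO) \notin s) /\ adjacent_tags s.
Proof.
move=> es; split=> [H|[H1 H2] p].
- split.
  + case: e es H => p [] /= es H.
      move=> pI; have := H p; rewrite !inE eqxx pI orbT /= => /(_ isT isT).
      rewrite eqxx; case: s pI {es H} => //= f s _.
      by rewrite xpair_eqE andbF; case: eqP => // ->.
    apply/negP => pO; have := H p; rewrite !inE eqxx pO orbT /= => /(_ isT isT).
    by rewrite eqxx xpair_eqE andbF.
  + move=> p pO pI; have := H p; rewrite !inE pO pI !orbT /= => /(_ isT isT).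
    case: eqP => [E|_]; first by rewrite E pI in es.
    by case: eqP => [E|_ []] //; rewrite E pO in es.
- rewrite !inE /= => /predU1P [E|pO] /predU1P [E'|pI].
  + by rewrite -E in E'.
  + move: H1; rewrite -E eqxx xpair_eqE andbF /= => /(_ pI).
    by case: (s) => //= f s' [->]; rewrite eqxx.
  + by move: H1; rewrite -E' /= pO.
  + case: eqP => [E|_]; first by rewrite E pI in es.
    case: eqP => [E|_]; first by rewrite E pO in es.
    by rewrite H2.
Qed.

Lemma is_stackE s : is_stack s = stk s.
Proof.
have tag_eq (t : tag) : (t == TO) = (TI != t) by case: t.
elim: s => [|e s IH] //; rewrite /= -IH /is_stack.
rewrite (_ : names_of (e :: s) = e.1 :: names_of s) // [all (@cont S) (_ :: _)]/=.
case ce : (cont e.1); rewrite //= ?andbF //.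
case es : (e \in s) => /=; first by rewrite ?andbF.
have sortE : path (fun e f : name S * tag => e.2 != f.2) e s
    && (last e.2 [seq i.2 | i <- s] == TO) =
  (next_tag s != e.2) &&
    (sorted (fun e f : name S * tag => e.2 != f.2) s
      && (last TO [seq i.2 | i <- s] == TO)).
  case: s {IH es} => [|f s] /=; first by rewrite tag_eq andbT.
  by rewrite eq_sym -andbA.
set A := (both_tags _ _ ==> _) && all _ _.
set B := all (fun p => both_tags s p ==> _) _.
have AE : A = (if e.2 is TO then ((e.1, TI) \in s) ==> (ohead s == Some (e.1, TI))
         else (e.1, TO) \notin s) && B.
  have -> : A = all (fun p => both_tags (e :: s) p ==>
    (index (p, TI) (e :: s) == (index (p, TO) (e :: s)).+1)) (names_of (e :: s)) by [].
  apply/(sameP (adjacentP _))/(iffP andP).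
  - case=> H1 /adjacentP H2; apply/adjacent_cons; rewrite ?es //; split=> //.
    by case: e.2 H1 => // /implyP H1 /H1 /eqP.
  - move/adjacent_cons; rewrite es => /(_ isT) [H1 /adjacentP H2]; split=> //.
    by case: e.2 H1 => // H1; apply/implyP => /H1 ->.
rewrite AE; clearbody B; case: (all (@cont S) _) => /=; last by rewrite !andbF.
move: sortE; set a1 := path _ _ _; set a2 := last _ _ == _; set a3 := _ != _.
set a4 := sorted _ _; set a5 := last _ _ == _; clearbody a1 a2 a3 a4 a5 => sortE.
by rewrite (andbA a1) sortE {sortE}; case: a3; case: a4; case: a5; case: uniq;
  rewrite /= ?andbF ?andbT.
Qed.

Lemma stk_uniq s : stk s -> uniq s.
Proof. by elim: s => //= e s IH /and5P [_ -> _ _ /IH]. Qed.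

Lemma stk_behead e s : stk (e :: s) -> stk s.
Proof. by case/and5P. Qed.

Lemma stk_cont s e : stk s -> e \in s -> cont e.1.
Proof.
elim: s => //= f s IH /and5P [cf _ _ _ /IH H].
by rewrite inE => /predU1P [->|/H].
Qed.

Lemma names_cont s p : stk s -> p \in names_of s -> cont p.
Proof. by move=> H /mapP [e /(stk_cont H) ce ->]. Qed.

Lemma mem_names p (t : tag) s : (p, t) \in s -> p \in names_of s.
Proof. by move=> H; apply/mapP; exists (p, t). Qed.

Lemma names_tag p s : p \in names_of s -> (p, TO) \in s \/ (p, TI) \in s.
Proof. by case/mapP => [[q []] H ->]; [left|right]. Qed.

Lemma shuffle_perm s t u : shuffle s t u -> perm_eq s (t ++ u).
Proof.
elim=> {s t u} [|e s t u _ IH|e s t u _ IH] //.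
- by rewrite perm_sym perm_catC /= perm_cons perm_catC perm_sym.
- by rewrite /= perm_cons.
Qed.

Lemma shuffle_mem s t u : shuffle s t u -> s =i t ++ u.
Proof. by move=> /shuffle_perm /perm_mem. Qed.

Lemma shuffle_sym s t u : shuffle s t u -> shuffle s u t.
Proof. by elim=> *; constructor. Qed.

Definition tag_count (x : tag) s := count (fun e => e.2 == x) s.

(** Tags alternate and the last one is an output, so outputs and inputs balance unless the top is an
    output. *)
Lemma stk_tag_count s : stk s -> tag_count TO s = tag_count TI s + seqn s.
Proof.
elim: s => //= e s IH /and5P [_ _ H _ /IH E]; case: e H => p x /=.
rewrite seqnE in E; rewrite /tag_count /= in E *; move: E.
by case: (next_tag s); case: x => //= -> _; rewrite ?addn0 ?addn1.
Qed.

(** Tag counts are additive under interleaving. Consequently at most one component has an output on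
    top. *)
Lemma seqn_shuffle s t u : shuffle s t u -> stk s -> stk t -> stk u ->
  seqn s = seqn t + seqn u.
Proof.
move=> /shuffle_perm /permP E /stk_tag_count Hs /stk_tag_count Ht /stk_tag_count Hu.
have cE x : tag_count x s = tag_count x t + tag_count x u.
  by rewrite /tag_count -count_cat E.
by have := cE TO; have := cE TI; lia.
Qed.

Lemma seqn_le1 s : seqn s <= 1.
Proof. by case: s => [|[p []]]. Qed.

Lemma shuffle_consE e s t u : shuffle (e :: s) t u ->
  (exists2 t', t = e :: t' & shuffle s t' u) \/
  (exists2 u', u = e :: u' & shuffle s t u').
Proof.
move E: (e :: s) => s0 H; case: H E => // f s1 t1 u1 H [-> ->].
  by right; exists u1.
by left; exists t1.
Qed.

(** By additivity of [seqn] the whole stack starts with an output and [u] does not, so the top can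
    only come from the other component. *)
Lemma shuffle_headO s p t u : shuffle s ((p, TO) :: t) u ->
  stk s -> stk ((p, TO) :: t) -> stk u ->
  exists2 s', s = (p, TO) :: s' & shuffle s' t u.
Proof.
move=> H Hs Ht Hu; have /= E := seqn_shuffle H Hs Ht Hu.
case: s H Hs E => [|e s] H Hs E.
  by have := shuffle_mem H (p, TO); rewrite mem_cat inE eqxx.
case: (shuffle_consE H) => [[t' [<- <-] H']|[u' Eu _]]; first by exists s.
by move: E; rewrite Eu (seqnE (_ :: s)) seqnE /=; case: (_ == _).
Qed.

(** A stack has no repetitions, so the component containing the top entry is the one that provides
    it. *)
Lemma shuffle_headI s p t u : shuffle ((p, TI) :: s) t u ->
  stk ((p, TI) :: s) -> (p, TI) \in t ->
  exists2 t', t = (p, TI) :: t' & shuffle s t' u.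
Proof.
move=> H Hs pt; case: (shuffle_consE H) => [[t' -> H']|[u' _ H']].
  by exists t'.
by move: Hs => /stk_uniq /andP [/negP []]; rewrite (shuffle_mem H') mem_cat pt.
Qed.

(** The two tags of a name must be consecutive in a stack, so a communication at [p] takes place at
    the very top of the interleaving. *)
Lemma shuffle_comm s p t u : shuffle s ((p, TO) :: t) u ->
  stk s -> stk ((p, TO) :: t) -> stk u -> (p, TI) \in u ->
  exists s' u', [/\ s = (p, TO) :: (p, TI) :: s', u = (p, TI) :: u' & shuffle s' t u'].
Proof.
move=> H Hs Ht Hu pu; have [s1 E1 H1] := shuffle_headO H Hs Ht Hu.
subst s; have ps1 : (p, TI) \in s1 by rewrite (shuffle_mem H1) mem_cat pu orbT.
have /and5P [_ _ _ /implyP /(_ ps1) hd Hs1] := Hs.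
case: s1 hd H1 {ps1 H Hs} Hs1 => //= f s1 /eqP [->] H1 Hs1.
have [u' Eu H2] := shuffle_headI (shuffle_sym H1) Hs1 pu.
by exists s1, u'; split=> //; apply: shuffle_sym.
Qed.

Lemma shuffle_pop s p t u : shuffle s ((p, TO) :: (p, TI) :: t) u ->
  stk s -> stk ((p, TO) :: (p, TI) :: t) -> stk u ->
  exists2 s', s = (p, TO) :: (p, TI) :: s' & shuffle s' t u.
Proof.
move=> H Hs Ht Hu; have [s1 E1 H1] := shuffle_headO H Hs Ht Hu; subst s.
have ps1 : (p, TI) \in s1 by rewrite (shuffle_mem H1) mem_cat inE eqxx.
have /and5P [_ _ _ /implyP /(_ ps1) hd Hs1] := Hs.
case: s1 hd H1 {ps1 H Hs} Hs1 => //= f s1 /eqP [->] H1 Hs1.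
have [|t' [->] H2] := shuffle_headI H1 Hs1; first by rewrite inE eqxx.
by exists s1.
Qed.

Lemma push_outputP s p : stk s -> cont p -> seqn s = 0 -> (p, TO) \notin s ->
  ((p, TI) \in s -> ohead s = Some (p, TI)) -> stk ((p, TO) :: s).
Proof.
rewrite seqnE /= => -> -> H -> H1; rewrite andbT /=; apply/andP; split.
  by move: H; case: eqP.
by apply/implyP => /H1 ->.
Qed.

(** If [(p, TI)] occurs in [t], it is on top of the interleaving [s], and hence on top of [t]. *)
Lemma stk_pushO_shuffle s p t u : shuffle s t u -> stk ((p, TO) :: s) ->
  stk t -> stk u -> stk ((p, TO) :: t).
Proof.
move=> H /and5P [cp ps nt hd Hs] Ht Hu; have := seqn_shuffle H Hs Ht Hu.
have -> : seqn s = 0 by rewrite seqnE; move: nt; case: (next_tag s).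
move=> E; apply: push_outputP => //; first by lia.
  by apply: contra ps; rewrite (shuffle_mem H) mem_cat => ->.
move=> pt; have ps' : (p, TI) \in s by rewrite (shuffle_mem H) mem_cat pt.
move: hd => /= /implyP /(_ ps'); case: s H Hs {ps nt ps'} => //= f s H Hs /eqP [Ef].
by subst f; have [t' -> _] := shuffle_headI H Hs pt.
Qed.

Lemma stk_pushI s p : stk s -> cont p -> seqn s = 1 -> p \notin names_of s ->
  stk ((p, TI) :: s).
Proof.
rewrite seqnE => Hs cp sq ps /=; rewrite cp Hs !andbT.
rewrite !(contra (@mem_names p _ s)) // andbT /=.
by move: sq; case: eqP => // ->.
Qed.

Lemma stk_push_pair s p : stk s -> cont p -> seqn s = 1 -> p \notin names_of s ->
  stk ((p, TO) :: (p, TI) :: s).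
Proof.
move=> Hs cp sq ps; have H := stk_pushI Hs cp sq ps.
apply: push_outputP => //=; rewrite inE negb_or xpair_eqE andbF /=.
exact: contra (@mem_names p TO s) ps.
Qed.

Lemma head_tag_cat xi s t : next_tag s = next_tag t ->
  next_tag (xi ++ s) = next_tag (xi ++ t).
Proof. by case: xi. Qed.

(** Below the removed pair the tags resume with an output; as [xi] is empty or ends with an input,
    alternation survives the removal. *)
Lemma nu_used_stk p xi s : stk (xi ++ (p, TO) :: (p, TI) :: s) ->
  last TI (map snd xi) = TI ->
  [/\ stk (xi ++ s), p \notin names_of (xi ++ s)
    & seqn (xi ++ (p, TO) :: (p, TI) :: s) = seqn (xi ++ s)].
Proof.
move=> H L; have nt : next_tag s = TO.
  elim: xi {L} H => [|e xi IH]; last by move/stk_behead.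
  by move=> /stk_behead /and5P [_ _]; case: (next_tag s).
split; last by rewrite !seqnE (@head_tag_cat xi _ s) // nt.
- elim: xi H L => [|e xi IH]; first by move=> /stk_behead /stk_behead.
  move=> /=.
  case/and5P => ce; rewrite mem_cat !inE !negb_or => /and4P [e1 _ _ e2] ne hd H L.
  rewrite ce mem_cat negb_or e1 e2 /= IH //; last by case: (xi) L.
  rewrite andbT -(@head_tag_cat xi ((p, TO) :: (p, TI) :: s)) // ne /=.
  have sub x : x \in xi ++ s -> x \in xi ++ (p, TO) :: (p, TI) :: s.
    by rewrite !(inE, mem_cat) => /orP [] ->; rewrite ?orbT.
  case: e {ce e1 e2 ne} L hd => q [] /= L hd; last by apply: contra hd; apply: sub.
  apply/implyP => /sub X; move: hd; rewrite X /=.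
  by case: xi {IH H sub X} L.
- have /stk_uniq := H; rewrite -[_ :: _ :: s]/([:: (p, TO); (p, TI)] ++ s).
  rewrite (perm_uniq (permEl (perm_catCA _ _ _))) /= inE negb_or.
  case/and3P => /andP [_ A] B _.
  by apply/negP => /names_tag []; [apply/negP | apply/negP].
Qed.

Lemma nu_stack_stk a s s' : nu_stack a s s' -> stk s ->
  [/\ stk s', a \notin names_of s' & seqn s = seqn s'].
Proof.
case=> [p xi u _ L|p u _ pu|b u ca] H; first exact: nu_used_stk.
  by split.
by split=> //; apply/negP => /(names_cont H); rewrite (negPf ca).
Qed.

Lemma nu_stack_sub a s s' e : nu_stack a s s' -> e \in s' -> e \in s.
Proof.
case=> // p xi u _ _; rewrite !mem_cat !inE.
by case/orP => ->; rewrite ?orbT.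
Qed.

Lemma nu_stack_mem a s s' e : nu_stack a s s' -> e \in s -> e.1 != a -> e \in s'.
Proof.
case=> // p xi u _ _; rewrite !mem_cat !inE => /or4P [->|/eqP->|/eqP->|->] //=;
  rewrite ?eqxx ?orbT //.
Qed.

Lemma nu_stack_pop a p s s' : nu_stack a ((p, TO) :: (p, TI) :: s) s' ->
  stk ((p, TO) :: (p, TI) :: s) ->
  (a = p /\ s' = s) \/
  exists2 t, s' = (p, TO) :: (p, TI) :: t & nu_stack a s t.
Proof.
move E: (_ :: _) => s0 H Hs; case: H E Hs => {a s0 s'}.
- move=> q xi u cq L; case: xi L => [|e xi] /=; first by move=> _ [-> _ ->]; left.
  case: xi => [|f xi] /=; first by move=> H [E _]; rewrite -E in H.
  move=> L [<- Ef ->] _; rewrite -{f}Ef /= in L *; right; exists (xi ++ u) => //.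
  by constructor.
- move=> q u cq qu E _; right; exists s; first by rewrite E.
  by constructor=> //; apply: contra qu; rewrite -E /= !inE => ->; rewrite !orbT.
- by move=> b u cb E _; right; exists s; [rewrite E | constructor].
Qed.

Lemma nu_stack_popO a p s s' : nu_stack a ((p, TO) :: s) s' -> a != p ->
  exists2 t, s' = (p, TO) :: t & nu_stack a s t.
Proof.
move E: (_ :: _) => s0 H ap; case: H E ap => {a s0 s'}.
- move=> q xi u cq L; case: xi L => [|e xi] /=; first by move=> _ [->]; rewrite eqxx.
  case: xi => [|f xi] /=; first by move=> H [E _]; rewrite -E in H.
  move=> L [<- ->] _; exists (f :: xi ++ u) => //.
  exact: (@NU_used _ _ (f :: xi)).
- move=> q u cq qu E _; exists s; first by rewrite E.
  by constructor=> //; apply: contra qu; rewrite -E /= !inE => ->; rewrite !orbT.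
- by move=> b u cb E _; exists s; [rewrite E | constructor].
Qed.

Lemma nu_stack_popI a p s s' : nu_stack a s ((p, TI) :: s') -> stk s ->
  exists2 t, s = (p, TI) :: t & nu_stack a t s'.
Proof.
move E: (_ :: _) => s0 H; case: H E => {a s s0}.
- move=> q xi u cq L; case: xi L => [|e xi].
    by rewrite ![[::] ++ _]/= => _ <- /stk_behead /and5P [].
  rewrite /=.
  move=> L [<- ->] _; exists (xi ++ (q, TO) :: (q, TI) :: u) => //.
  by constructor=> //; case: (xi) L.
- move=> q u cq qu E _; exists s'; first by rewrite E.
  by constructor=> //; apply: contra qu; rewrite -E /= !inE => ->; rewrite !orbT.
- by move=> b u cb E _; exists s'; [rewrite E | constructor].
Qed.

Lemma nu_stack_pushI a p s s' : nu_stack a s s' -> a != p ->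
  nu_stack a ((p, TI) :: s) ((p, TI) :: s').
Proof.
case=> {a s s'}.
- move=> q xi u cq L _; apply: (@NU_used _ _ ((p, TI) :: xi)) => //=.
- by move=> q u cq qu qp; constructor; rewrite //= inE negb_or qp.
- by move=> b u cb _; constructor.
Qed.

Lemma nu_stack_pushO a p s s' : nu_stack a s s' -> a != p -> stk s ->
  stk ((p, TO) :: s') ->
  stk ((p, TO) :: s) /\ nu_stack a ((p, TO) :: s) ((p, TO) :: s').
Proof.
move=> H ap Hs Hp; have [Hs' as' sq] := nu_stack_stk H Hs.
have /and5P [/= cp ps nt hd _] := Hp.
have sq' : seqn s' = 0 by rewrite seqnE; move: nt; case: (next_tag s').
have up (t : tag) : (p, t) \in s -> (p, t) \in s'.
  by move=> pt; apply: nu_stack_mem H pt _; rewrite eq_sym.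
split.
  apply: push_outputP => //; first by rewrite sq.
    by apply: contra ps; apply: up.
  move=> pI; move: hd; rewrite (up _ pI) /=.
  case: s' H {Hp Hs' as' sq sq' ps nt up} => //= e s' H /eqP [E]; subst e.
  by have [t ->] := nu_stack_popI H Hs.
case: H ap Hs Hp sq sq' {Hs' as' ps nt hd up} => {a s s'}.
- move=> q xi u cq L pq Hs Hp sq sq'.
  apply: (@NU_used _ _ ((p, TO) :: xi)) => //=.
  (* An empty [xi] is impossible: the hidden pair would put an output on top, where another output
     is to be pushed. *)
  by case: xi L Hs {Hp} sq sq' => [|e xi] //= _ _ <-.
- by move=> q u cq qu qp *; constructor; rewrite //= inE negb_or qp.
- by move=> b u cb *; constructor.
Qed.

(** The situation of scope extrusion: once [(c, TO)] has been sent away, [(c, TI)] is left directly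
    on top of [s'], which [seqn s' = 1] permits. *)
Lemma nu_stack_open c s s' : nu_stack c ((c, TO) :: s) s' ->
  stk ((c, TO) :: s) -> s = (c, TI) :: s' /\ seqn s' = 1.
Proof.
move E: (_ :: _) => s0 H Hs; have [_ _ sq] := nu_stack_stk H Hs.
case: H E Hs sq => {c s0 s'}.
- move=> q xi u cq L; case: xi L => [|e xi] /=; first by move=> _ [->] _ <-.
  move=> L [<- _] /and3P [_]; by rewrite mem_cat inE eqxx orbT.
- by move=> q u cq qu E; rewrite -E /= inE eqxx in qu.
- move=> b u cb E Hs; have := @stk_cont _ (b, TO) Hs.
  by rewrite -E inE eqxx /= (negPf cb) => /(_ isT).
Qed.

End Stacks.

(** * Evolution of stacks along transitions *)

Section StackSteps.

Variable S : sorting.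
Implicit Types (s t u : stack S) (p q a c : name S) (bs cs : seq (name S)).

Lemma cont_outc a : cont a -> outc a = false.
Proof. by rewrite /cont /outc; case: ctl. Qed.
Lemma cont_inc a : cont a -> inc a = false.
Proof. by rewrite /cont /inc; case: ctl. Qed.
Lemma outc_cont a : outc a -> cont a = false.
Proof. by rewrite /cont /outc; case: ctl. Qed.
Lemma outc_inc a : outc a -> inc a = false.
Proof. by rewrite /inc /outc; case: ctl. Qed.
Lemma inc_cont a : inc a -> cont a = false.
Proof. by rewrite /cont /inc; case: ctl. Qed.
Lemma inc_outc a : inc a -> outc a = false.
Proof. by rewrite /outc /inc; case: ctl. Qed.

Lemma controlP a : [\/ cont a, inc a | outc a].
Proof.
by rewrite /cont /inc /outc; case: ctl; [constructor 3|constructor 2|constructor 1].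
Qed.

Lemma cont_sort a b : a.1 = b.1 -> cont a = cont b.
Proof. by rewrite /cont => ->. Qed.
Lemma outc_sort a b : a.1 = b.1 -> outc a = outc b.
Proof. by rewrite /outc => ->. Qed.
Lemma inc_sort a b : a.1 = b.1 -> inc a = inc b.
Proof. by rewrite /inc => ->. Qed.

Lemma carried_plain a bs : map fst bs = obj a.1 -> ~~ outc a ->
  {in bs, forall b, ~~ cont b}.
Proof.
move=> E; rewrite /outc => na b bb; have := objP a.1; rewrite (negPf na) => /allP; apply.
by rewrite -E map_f.
Qed.

Lemma carried_outc a bs : map fst bs = obj a.1 -> outc a ->
  exists bs' p, [/\ bs = rcons bs' p, cont p & {in bs', forall b, ~~ cont b}].
Proof.
move=> E; rewrite /outc => ca; have := objP a.1; rewrite ca -E => -[ss [t [Es ct /allP H]]].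
case/lastP: bs Es {E} => [|bs p]; first by case: ss {H}.
rewrite map_rcons => /rcons_inj [E1 E2]; exists bs, p; split=> //.
  by rewrite /cont E2.
by move=> b bb; apply: H; rewrite -E1 map_f.
Qed.

Lemma carried_cont a bs p : map fst bs = obj a.1 -> p \in bs -> cont p ->
  outc a /\ p = last a bs.
Proof.
move=> E pb cp; case oa : (outc a); last first.
  by have := carried_plain E (negbT oa) pb; rewrite cp.
split=> //; have [bs' [q [Eb cq H]]] := carried_outc E oa.
move: pb; rewrite Eb mem_rcons inE last_rcons => /predU1P [|/H] //.
by rewrite cp.
Qed.

Lemma carried_last a bs : map fst bs = obj a.1 -> outc a -> cont (last a bs).
Proof.
by move=> E oa; have [bs' [p [-> cp _]]] := carried_outc E oa; rewrite last_rcons.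
Qed.

(** A variant of [next_stack] suited to induction on transitions. By the sorting, the only
    continuation of a tuple sent at an output-controlled [a] is its last name, so [last a bs]
    denotes it. The condition [seqn s = 1] lets an input tag be pushed. *)
Inductive out_step s cs a bs : stack S -> Prop :=
| OS_cont s1 : cont a -> s = (a, TO) :: s1 -> out_step s cs a bs s1
| OS_inc : inc a -> out_step s cs a bs s
| OS_bound : outc a -> last a bs \in cs -> seqn s = 1 ->
    out_step s cs a bs ((last a bs, TI) :: s)
| OS_free s1 : outc a -> last a bs \notin cs -> s = (last a bs, TO) :: s1 ->
    out_step s cs a bs s1.

Inductive in_step s a bs : stack S -> Prop :=
| IS_cont s1 : cont a -> s = (a, TI) :: s1 -> in_step s a bs s1
| IS_inc : inc a -> in_step s a bs s
| IS_outc : outc a -> in_step s a bs ((last a bs, TO) :: s).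

Fixpoint nus_stack cs s s' : Prop :=
  if cs is c :: cs then exists2 t, nus_stack cs s t & nu_stack c t s' else s = s'.

Lemma nus_stack_cat cs ds s t u :
  nus_stack ds s t -> nus_stack cs t u -> nus_stack (cs ++ ds) s u.
Proof.
by elim: cs u => [|c cs IH] u /=; [move=> H <- | move=> H [v Hv Hc]; exists v => //; apply: IH].
Qed.

Lemma nus_stack_plain cs s : {in cs, forall c, ~~ cont c} -> nus_stack cs s s.
Proof.
elim: cs => //= c cs IH H; exists s.
  by apply: IH => d dc; apply: H; rewrite inE dc orbT.
by constructor; apply: H; rewrite inE eqxx.
Qed.

Lemma nus_stack_pair cs p s : cont p -> p \in cs -> p \notin names_of s ->
  {in cs, forall c, c != p -> ~~ cont c} -> uniq cs ->
  nus_stack cs ((p, TO) :: (p, TI) :: s) s.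
Proof.
move=> cp; elim: cs => //= c cs IH pc ps H /andP [cc U].
have [E|cNp] := eqVneq c p.
  exists ((p, TO) :: (p, TI) :: s); last by rewrite E; apply: (@NU_used _ p [::]).
  apply: nus_stack_plain => d dc; apply: H; first by rewrite inE dc orbT.
  by apply: contraNneq cc => Ed; rewrite E -Ed.
exists s; last by constructor; apply: H => //; rewrite inE eqxx.
apply: IH => // [|d dc]; first by move: pc; rewrite inE eq_sym (negPf cNp).
by apply: H; rewrite inE dc orbT.
Qed.

Lemma nus_stack_stk cs s s' : nus_stack cs s s' -> stk s -> stk s' /\ seqn s = seqn s'.
Proof.
elim: cs s' => [|c cs IH] s' /=; first by move=> <-.
by case=> t H Hc Hs; have [Ht ->] := IH _ H Hs; have [-> _ ->] := nu_stack_stk Hc Ht.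
Qed.

(** If one of the restrictions binds [p], it becomes vacuous on the popped stack, which is why the
    same [cs] still lead to [s']. *)
Lemma nus_stack_pop cs s p s' : nus_stack cs ((p, TO) :: (p, TI) :: s) s' ->
  stk ((p, TO) :: (p, TI) :: s) ->
  nus_stack cs s s' \/ exists2 t, s' = (p, TO) :: (p, TI) :: t & nus_stack cs s t.
Proof.
elim: cs s' => [|c cs IH] s' /=; first by move=> <-; right; exists s.
move=> [t H Hc] Hs.
have Ht := (nus_stack_stk H Hs).1.
case: (IH _ H Hs) => [H'|[t' E H']]; first by left; exists t.
subst t; case: (nu_stack_pop Hc Ht) => [[E ->]|[v -> Hv]]; last by right; exists v => //; exists t'.
left; exists t' => //; subst c; have [_ ps _] := nu_stack_stk Hc Ht.
have cp := @stk_cont _ _ (p, TO) Ht (mem_head _ _).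
apply: NU_unused => //.
by have [_ + _] := @nu_used_stk _ p [::] t' Ht erefl.
Qed.

Lemma last_in a bs : last a bs \in a :: bs. Proof. exact: mem_last. Qed.

(** A continuation output acts on the top of its component, and by additivity of [seqn] this is also
    the top of the whole stack. *)
Lemma out_step_par s t u cs a bs s1 : shuffle u s t -> stk u -> stk s -> stk t ->
  map fst bs = obj a.1 -> {in cs, forall c, c \notin names_of u} ->
  out_step s cs a bs s1 ->
  exists2 u1, out_step u cs a bs u1 & shuffle u1 s1 t /\ stk u1.
Proof.
move=> H Hu Hs Ht Ebs cu; case=> [s2 ca E|ia|oa lc sq|s2 oa lc E].
- subst s; have [u1 Eu H1] := shuffle_headO H Hu Hs Ht.
  by exists u1; [constructor 1 | split=> //; apply: stk_behead (_ : stk ((a, TO) :: _)); rewrite -Eu].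
- by exists u; [constructor 2 | split].
- exists ((last a bs, TI) :: u); first constructor 3 => //.
    by have := seqn_shuffle H Hu Hs Ht; have := seqn_le1 u; lia.
  split; first exact: SH_left.
  apply: stk_pushI => //; first exact: carried_last.
    by have := seqn_shuffle H Hu Hs Ht; have := seqn_le1 u; lia.
  exact: cu.
- subst s; have [u1 Eu H1] := shuffle_headO H Hu Hs Ht.
  exists u1; first exact: OS_free.
  by split=> //; apply: stk_behead (_ : stk ((last a bs, TO) :: _)); rewrite -Eu.
Qed.

(** Here the step of the whole stack is given and that of the component is derived, since whether a
    received continuation may be pushed depends on the whole stack. *)
Lemma in_step_par s t u a bs u1 : shuffle u s t -> stk u -> stk s -> stk t ->
  (cont a -> (a, TI) \in s) -> in_step u a bs u1 -> stk u1 ->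
  exists2 s1, in_step s a bs s1 & shuffle u1 s1 t /\ stk s1.
Proof.
move=> H Hu Hs Ht Ha; case=> [u2 ca E|ia|oa] Hu1.
- subst u; have [s1 E H1] := shuffle_headI H Hu (Ha ca).
  by exists s1; [constructor 1 | split=> //; apply: stk_behead (_ : stk ((a, TI) :: _)); rewrite -E].
- by exists s; [constructor 2|].
- exists ((last a bs, TO) :: s); first by constructor 3.
  by split; [apply: SH_left | apply: (stk_pushO_shuffle H)].
Qed.

Lemma out_step_res c s0 s cs a bs s1 : nu_stack c s0 s -> stk s0 ->
  c \notin cs ++ a :: bs -> out_step s0 cs a bs s1 ->
  exists2 u, out_step s cs a bs u & nu_stack c s1 u.
Proof.
rewrite mem_cat negb_or => H Hs /andP [ccs cabs].
have cl : c != last a bs by apply: contraNneq cabs => ->; exact: last_in.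
have ca : c != a by move: cabs; rewrite inE negb_or => /andP [].
case=> [s2 ka E|ia|oa lc sq|s2 oa lc E].
- by subst s0; have [t -> H1] := nu_stack_popO H ca; exists t => //; constructor 1.
- by exists s => //; constructor 2.
- have [_ _ sq'] := nu_stack_stk H Hs.
  exists ((last a bs, TI) :: s); first by constructor 3; rewrite -?sq'.
  exact: nu_stack_pushI.
- by subst s0; have [t -> H1] := nu_stack_popO H cl; exists t => //; apply: OS_free.
Qed.

Lemma in_step_res c s0 s a bs u : nu_stack c s0 s -> stk s0 ->
  c \notin a :: bs -> in_step s a bs u -> stk u ->
  exists2 s1, in_step s0 a bs s1 & nu_stack c s1 u /\ stk s1.
Proof.
move=> H Hs cabs.
have cl : c != last a bs by apply: contraNneq cabs => ->; exact: last_in.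
case=> [s2 ka E|ia|oa] Hu.
- subst s; have [t E H1] := nu_stack_popI H Hs; subst s0.
  exists t; first by constructor 1.
  by split=> //; apply: stk_behead Hs.
- by exists s0 => //; constructor 2.
- have [H1 H2] := nu_stack_pushO H cl Hs Hu.
  by exists ((last a bs, TO) :: s0); first by constructor 3.
Qed.

(** Four cases: a continuation subject consumes the pair on top; an input-controlled subject changes
    nothing; an extruded continuation creates a pair that its restriction removes at once; a free
    one moves from the stack of the sender to that of the receiver. *)
Lemma comm_stack u s t cs a bs s1 : shuffle u s t -> stk u -> stk s -> stk t ->
  out_step s cs a bs s1 -> (cont a -> (a, TI) \in t) -> map fst bs = obj a.1 ->
  uniq cs -> {subset cs <= bs} -> {in cs, forall c, c \notin names_of u} ->
  exists t1 v v', [/\ in_step t a bs t1, stk t1 /\ stk v, shuffle v s1 t1,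
    nus_stack cs v v' & v' = u \/ exists p, u = (p, TO) :: (p, TI) :: v'].
Proof.
move=> H Hu Hs Ht Hout Hin Ebs U sub fr.
have plain : (forall p, p \in cs -> cont p -> False) -> forall v, nus_stack cs v v.
  by move=> X v; apply: nus_stack_plain => c cc; apply/negP => /(X _ cc).
case: Hout => [s2 ca E|ia|oa lc sq|s2 oa lc E].
- subst s; have [u' [t' [Eu Et H']]] := shuffle_comm H Hu Hs Ht (Hin ca).
  subst u t; exists t', u', u'; split=> //; first by constructor 1.
  + by split; [exact: stk_behead Ht | exact: stk_behead (stk_behead Hu)].
  + apply: plain => p /sub pb /(carried_cont Ebs pb) [].
    by rewrite cont_outc.
  + by right; exists a.
- exists t, u, u; split=> //; [by constructor 2 | | by left].
  by apply: plain => p /sub pb /(carried_cont Ebs pb) []; rewrite inc_outc.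
- set p := last a bs in lc *; have cp : cont p by apply: carried_last.
  have pu : p \notin names_of u by apply: fr.
  have squ : seqn u = 1 by have := seqn_shuffle H Hu Hs Ht; have := seqn_le1 u; lia.
  have Hu2 := stk_push_pair Hu cp squ pu.
  have Hv : shuffle ((p, TO) :: (p, TI) :: u) ((p, TI) :: s) ((p, TO) :: t).
    by apply: SH_right; apply: SH_left.
  exists ((p, TO) :: t), ((p, TO) :: (p, TI) :: u), u; split=> //; last by left.
  + by constructor 3.
  + split=> //; apply: push_outputP => //.
    * by have := seqn_shuffle H Hu Hs Ht; rewrite squ sq; lia.
    * apply: contra pu => X; apply: (@mem_names _ p TO).
      by rewrite (shuffle_mem H) mem_cat X orbT.
    * move=> X; case/negP: pu; apply: (@mem_names _ p TI).
      by rewrite (shuffle_mem H) mem_cat X orbT.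
  + apply: nus_stack_pair => // c cc cNp; apply/negP => kc.
    by have [_ Ec] := carried_cont Ebs (sub _ cc) kc; rewrite Ec eqxx in cNp.
- subst s; have [u' Eu H'] := shuffle_headO H Hu Hs Ht; subst u.
  set p := last a bs in lc *.
  exists ((p, TO) :: t), ((p, TO) :: u'), ((p, TO) :: u'); split=> //.
  + by constructor 3.
  + split=> //; apply: (stk_pushO_shuffle (shuffle_sym H')) => //.
    exact: stk_behead Hs.
  + exact: SH_right.
  + apply: plain => q qc kq; have [_ Eq] := carried_cont Ebs (sub _ qc) kq.
    by rewrite Eq (negPf lc) in qc.
  + by left.
Qed.

End StackSteps.

(** * Typing and subject reduction *)

Section Typing.

Variable S : sorting.
Implicit Types (s t u : stack S) (p q a b c : name S) (ds bs cs : seq (name S))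
  (P Q : proc S) (f : name S -> name S).

Definition map_stack f s : stack S := [seq (f e.1, e.2) | e <- s].

Lemma names_map_stack f s : names_of (map_stack f s) = map f (names_of s).
Proof. by rewrite /names_of /map_stack -!map_comp. Qed.

Lemma mem_map_stack f s p (x : tag) : {in p :: names_of s &, injective f} ->
  ((f p, x) \in map_stack f s) = ((p, x) \in s).
Proof.
move=> fI; apply/mapP/idP => [[[q y] qs [E1 E2]]|H].
  by rewrite (fI p q) ?E2 ?inE ?eqxx ?(mem_names qs) ?orbT.
by exists (p, x).
Qed.

Lemma next_tag_map f s : next_tag (map_stack f s) = next_tag s.
Proof. by case: s. Qed.

Lemma stk_map f s : sort_pres f -> {in names_of s &, injective f} ->
  stk s -> stk (map_stack f s).
Proof.
move=> fS; elim: s => //= [[p x]] s IH fI /and5P [cp ps nt hd Hs] /=.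
have fI' : {in p :: names_of s &, injective f} by [].
have fIs : {in names_of s &, injective f}.
  by move=> a b Ha Hb; apply: fI; rewrite inE ?Ha ?Hb orbT.
rewrite (cont_sort (fS p)) cp mem_map_stack // ps next_tag_map nt IH //.
rewrite andbT /= !mem_map_stack //.
case: x {fI ps nt cp fI'} hd => // /implyP hd; apply/implyP => /hd /=.
by case: s {IH fIs hd Hs} => //= e s /eqP [->].
Qed.

Lemma shuffle_map f s t u : shuffle s t u ->
  shuffle (map_stack f s) (map_stack f t) (map_stack f u).
Proof. by elim=> *; constructor. Qed.

Lemma nu_stack_map f a s s' : sort_pres f -> {in a :: names_of s &, injective f} ->
  nu_stack a s s' -> nu_stack (f a) (map_stack f s) (map_stack f s').
Proof.
move=> fS fI H; case: H fI => {a s s'}.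
- move=> p xi s cp L _; rewrite /map_stack !map_cat /=.
  apply: NU_used; first by rewrite (cont_sort (fS p)).
  by rewrite -map_comp.
- move=> p s cp ps fI; apply: NU_unused; first by rewrite (cont_sort (fS p)).
  rewrite names_map_stack; apply/mapP => [[q qs E]].
  have Epq : p = q by apply: fI; rewrite ?inE ?eqxx ?qs ?orbT.
  by rewrite -Epq (negPf ps) in qs.
- by move=> a s ca _; apply: NU_plain; rewrite (cont_sort (fS a)).
Qed.

(** Replaces the names [ds] that open a binder by [bs] and acts as [f] elsewhere, so that a single
    substitution renames a body and changes its instantiation. *)
Definition inst f ds bs a := if a \in ds then nth a bs (index a ds) else f a.

Lemma inst_out f ds bs a : a \notin ds -> inst f ds bs a = f a.
Proof. by rewrite /inst => /negPf->. Qed.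

Lemma inst_map f ds bs : uniq ds -> size ds = size bs -> map (inst f ds bs) ds = bs.
Proof.
move=> U sz; case: ds bs U sz => [|a0 ds] bs U sz; first by case: bs sz.
apply: (@eq_from_nth _ a0); rewrite size_map // => i lt_i.
rewrite (nth_map a0) // /inst mem_nth // index_uniq //.
by apply: set_nth_default; rewrite -sz.
Qed.

Lemma inst_sort f ds bs : sort_pres f -> map fst ds = map fst bs ->
  sort_pres (inst f ds bs).
Proof.
move=> fS E a; rewrite /inst; case: ifP => // aA.
have sz : size ds = size bs by rewrite -(size_map fst ds) E size_map.
have lt_i : index a ds < size bs by rewrite -sz index_mem.
by rewrite -(nth_map a a.1 fst) // -E (nth_map a) ?sz // nth_index.
Qed.

Lemma ren_inst f ds bs P : uniq ds -> map fst ds = map fst bs ->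
  {in ds, forall a, a \notin fn P} ->
  ren (inst f ds bs) (open ds P) = open bs (ren f P).
Proof.
move=> U E fr; rewrite /open ren_open inst_map //; last first.
  by rewrite -(size_map fst ds) E size_map.
congr open_rec; apply: eq_ren => a aP; apply: inst_out.
by apply/negP => /fr; rewrite aP.
Qed.

Lemma fresh_namesP bs ss P : fresh_names bs ss P ->
  [/\ map fst bs = ss, uniq bs & {in bs, forall b, b \notin fn P}].
Proof. by case/and3P => /eqP -> -> /allP. Qed.

Lemma fresh_namesI bs ss P : map fst bs = ss -> uniq bs ->
  {in bs, forall b, b \notin fn P} -> fresh_names bs ss P.
Proof. by move=> E U /allP H; rewrite /fresh_names E eqxx U. Qed.

Lemma process_In a ss P : process (In (Free a) ss P) = (ss == obj a.1) && wf [:: ss] P.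
Proof. by []. Qed.

Lemma process_Rep a ss P : process (Rep (Free a) ss P) = (ss == obj a.1) && wf [:: ss] P.
Proof. by []. Qed.

Lemma process_Out a bs : process (Out (Free a) (map (@Free S) bs)) = (map fst bs == obj a.1).
Proof.
rewrite /process /= (_ : map _ _ = map Some (map fst bs)) -?map_comp //.
by rewrite map_comp (inj_eq (inj_map Some_inj)).
Qed.

Lemma process_open_body bs ss P : map fst bs = ss -> wf [:: ss] P -> process (open bs P).
Proof. by move=> <-; rewrite process_open. Qed.

Lemma map_Free_ren f bs : map (renv f) (map (@Free S) bs) = map (@Free S) (map f bs).
Proof. by rewrite -!map_comp. Qed.

Lemma typ_stk s P : typ s P -> stk s.
Proof.
elim=> {s P} //=.
- by move=> p _ ->.
- by move=> x _ p _ ->.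
- move=> q p ss bs P -> -> pq _ _ _; rewrite !inE !xpair_eqE /= andbF /=.
  by rewrite eqxx !andbT eq_sym.
- by move=> a s s' P _ _ IH /nu_stack_stk /(_ IH) [].
- by move=> s s' s'' P Q _ _ _ _ [H _]; rewrite -is_stackE.
Qed.

(** Injectivity is required on the names of the stack only; the other names matter to typing through
    their sorts. Hence received names may coincide with each other and with names already known. *)
Lemma typ_subst s P : typ s P -> process P -> forall f, sort_pres f ->
  {in names_of s &, injective f} -> typ (map_stack f s) (ren f P).
Proof.
have inj1 (f : name S -> name S) p : {in names_of [:: (p, TO)] &, injective f}.
  by move=> a b; rewrite !inE => /eqP -> /eqP ->.
elim=> {s P}.
- move=> p bs cp _ f fS _; rewrite /= map_Free_ren.
  by apply: TY_outp; rewrite (cont_sort (fS p)).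
- move=> x bs p ox cp _ f fS _; rewrite /= map_Free_ren map_rcons.
  by apply: TY_outx; rewrite ?(cont_sort (fS p)) ?(outc_sort (fS x)).
- move=> u bs iu _ f fS _; rewrite /= map_Free_ren.
  by apply: TY_outu; rewrite (inc_sort (fS u)).
- move=> q p ss bs P cq cp pq /fresh_namesP [E U fr] _ IH.
  rewrite process_In => /andP [/eqP Ess W] f fS fI.
  have [bs' [E' U' fr']] := fresh_tuple (map fst bs) (fn (ren f P)).
  have pNbs : p \notin bs.
    apply/negP => pb; have [|oq _] := @carried_cont _ q bs p _ pb cp; first by rewrite E.
    by rewrite (cont_outc cq) in oq.
  apply: (@TY_inp _ (f q) (f p) ss bs').
  + by rewrite (cont_sort (fS q)).
  + by rewrite (cont_sort (fS p)).
  + by apply: contra pq => /eqP /fI ->; rewrite ?inE ?eqxx ?orbT.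
  + by apply: fresh_namesI; rewrite ?E'.
  + have := IH (process_open_body E W) (inst f bs bs') (inst_sort fS (esym E')) (inj1 _ _).
    by rewrite ren_inst // /map_stack /= inst_out.
- move=> x p ss bs P ox cp /fresh_namesP [E U fr] _ IH.
  rewrite process_In => /andP [/eqP Ess W] f fS fI.
  have [bs' [E' U' fr']] := fresh_tuple (map fst (rcons bs p)) (fn (ren f P)).
  have sz : size (rcons bs p) = size bs' by rewrite -(size_map fst bs') E' size_map.
  pose g := inst f (rcons bs p) bs'.
  have gS : sort_pres g by apply: inst_sort.
  have Ebs' : rcons (map g bs) (g p) = bs' by rewrite -map_rcons inst_map.
  have H : typ [:: (g p, TO)] (open bs' (ren f P)).
    by rewrite -(ren_inst f U (esym E') fr); exact: IH (process_open_body E W) g gS (inj1 _ _).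
  apply: (@TY_inx _ (f x) (g p) ss (map g bs)) => //.
  + by rewrite (outc_sort (fS x)).
  + by rewrite (cont_sort (gS p)).
  + by apply: fresh_namesI; rewrite Ebs' ?E'.
  + by rewrite Ebs'.
- move=> x p ss bs P ox cp /fresh_namesP [E U fr] _ IH.
  rewrite process_Rep => /andP [/eqP Ess W] f fS fI.
  have [bs' [E' U' fr']] := fresh_tuple (map fst (rcons bs p)) (fn (ren f P)).
  have sz : size (rcons bs p) = size bs' by rewrite -(size_map fst bs') E' size_map.
  pose g := inst f (rcons bs p) bs'.
  have gS : sort_pres g by apply: inst_sort.
  have Ebs' : rcons (map g bs) (g p) = bs' by rewrite -map_rcons inst_map.
  have H : typ [:: (g p, TO)] (open bs' (ren f P)).
    by rewrite -(ren_inst f U (esym E') fr); exact: IH (process_open_body E W) g gS (inj1 _ _).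
  apply: (@TY_repx _ (f x) (g p) ss (map g bs)) => //.
  + by rewrite (outc_sort (fS x)).
  + by rewrite (cont_sort (gS p)).
  + by apply: fresh_namesI; rewrite Ebs' ?E'.
  + by rewrite Ebs'.
- move=> u p ss bs P iu cp /fresh_namesP [E U fr] _ IH.
  rewrite process_In => /andP [/eqP Ess W] f fS fI.
  have [bs' [E' U' fr']] := fresh_tuple (map fst bs) (fn (ren f P)).
  have pNbs : p \notin bs.
    apply/negP => pb; have [|ou _] := @carried_cont _ u bs p _ pb cp; first by rewrite E.
    by rewrite (inc_outc iu) in ou.
  apply: (@TY_inu _ (f u) (f p) ss bs').
  + by rewrite (inc_sort (fS u)).
  + by rewrite (cont_sort (fS p)).
  + by apply: fresh_namesI; rewrite ?E'.
  + have := IH (process_open_body E W) (inst f bs bs') (inst_sort fS (esym E')) (inj1 _ _).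
    by rewrite ren_inst // /map_stack /= inst_out.
- by move=> *; apply: TY_nil.
- move=> a s s' P aP T IH Hnu; rewrite process_Nu => W f fS fI.
  (* The restriction is reopened with a [b] outside the image of the stack, so that the extended
     substitution stays injective on the stack of the body. *)
  have [b [Eb fr]] := fresh_name a.1 (fn (ren f P) ++ map f (names_of s)).
  move: fr; rewrite mem_cat negb_or => /andP [bP bs].
  pose g := inst f [:: a] [:: b].
  have gS : sort_pres g by apply: inst_sort => //=; rewrite Eb.
  have ga : g a = b by rewrite /g /inst inE eqxx /= eqxx.
  have gN c : c != a -> g c = f c by move=> ca; apply: inst_out; rewrite inE.
  have gI : {in a :: names_of s &, injective g}.
    have inS c : c \in names_of s -> c != a -> c \in names_of s'.
      move=> /mapP [e es ->] ea; apply/mapP; exists e => //.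
      exact: nu_stack_mem Hnu es ea.
    have sep c : c \in names_of s -> c != a -> g c != b.
      by move=> cs ca; rewrite gN //; apply: contraNneq bs => <-; rewrite map_f.
    move=> c d; rewrite !inE.
    have [->|ca] := eqVneq c a; have [->|da] := eqVneq d a => //= Hc Hd.
    + by rewrite ga => E; have := sep _ Hd da; rewrite E eqxx.
    + by rewrite ga => E; have := sep _ Hc ca; rewrite E eqxx.
    + by rewrite !gN //; apply: fI; apply: inS.
  have Es' : map_stack g s' = map_stack f s'.
    apply/eq_in_map => e es; rewrite gN //; apply: contraTneq es => Ea.
    have [_ X _] := nu_stack_stk Hnu (typ_stk T).
    by apply/negP => /(map_f fst); rewrite Ea (negPf X).
  rewrite /= -Eb; apply: (@TY_nu _ b (map_stack g s)) => //.
    have aP1 : {in [:: a], forall a', a' \notin fn P}.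
      by move=> a'; rewrite inE => /eqP ->.
    rewrite -(@ren_inst f [:: a] [:: b] P) //=; last by rewrite Eb.
    by apply: IH => // x y Hx Hy; apply: gI; rewrite inE ?Hx ?Hy orbT.
  by rewrite -Es' -ga; apply: nu_stack_map.
- move=> a b P ca cb _ IH /and4P [_ _ _ W] f fS fI; apply: TY_match.
  + by rewrite (cont_sort (fS a)).
  + by rewrite (cont_sort (fS b)).
  + exact: IH.
- move=> s s' s'' P Q _ IHP _ IHQ [Hs H] /andP [WP WQ] f fS fI.
  have sub x : (x \in names_of s) || (x \in names_of s') -> x \in names_of s''.
    by case/orP => /mapP [e es ->]; apply: map_f; rewrite (shuffle_mem H) mem_cat es ?orbT.
  apply: (@TY_par _ (map_stack f s) (map_stack f s')).
  + by apply: IHP => // x y Hx Hy; apply: fI; apply: sub; rewrite ?Hx ?Hy.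
  + by apply: IHQ => // x y Hx Hy; apply: fI; apply: sub; rewrite ?Hx ?Hy orbT.
  + by split; [rewrite is_stackE stk_map -?is_stackE | apply: shuffle_map].
- by move=> s P _ IH sz W f fS fI; apply: TY_tau; [apply: IH | rewrite size_map].
- move=> s P Q _ IHP _ IHQ sz /and4P [_ _ WP WQ] f fS fI.
  by apply: TY_sum; rewrite ?size_map //; [apply: IHP | apply: IHQ].
Qed.

Lemma map_stack_id f s : {in names_of s, f =1 id} -> map_stack f s = s.
Proof.
move=> H; rewrite /map_stack -[RHS]map_id; apply/eq_in_map => [[p x] ps] /=.
by rewrite H // (mem_names ps).
Qed.

Definition output_names (P : proc S) p := in_output_object (Free p) P.

Lemma output_object_open p k cs P :
  output_names P p -> output_names (open_rec k cs P) p.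
Proof.
rewrite /output_names; elim: P k => //=.
- by move=> v vs k H; apply: (map_f (openv k cs)) H.
- by move=> v ss P IH k; apply: IH.
- by move=> P IHP Q IHQ k /orP [/(IHP k)|/(IHQ k)] ->; rewrite ?orbT.
- by move=> s P IH k; apply: IH.
- by move=> v ss P IH k; apply: IH.
- by move=> P IHP Q IHQ k /orP [/(IHP k)|/(IHQ k)] ->; rewrite ?orbT.
Qed.

Lemma output_object_fn p P : output_names P p -> p \in fn P.
Proof.
rewrite /output_names; elim: P => //=.
- move=> v vs H; rewrite mem_cat orbC; apply/orP; left.
  by apply/flattenP; exists [:: p]; rewrite ?inE //; apply/mapP; exists (Free p).
- by move=> v ss P IH H; rewrite mem_cat IH ?orbT.
- by move=> P IHP Q IHQ /orP [/IHP|/IHQ] H; rewrite mem_cat H ?orbT.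
- by move=> v ss P IH H; rewrite mem_cat IH ?orbT.
- by move=> v w P IH H; rewrite !mem_cat IH ?orbT.
- by move=> P IHP Q IHQ /orP [/IHP|/IHQ] H; rewrite mem_cat H ?orbT.
Qed.

Lemma mem_map_Free p bs : (Free p \in map (@Free S) bs) = (p \in bs).
Proof. by rewrite mem_map // => a b []. Qed.

Lemma fn_Out a bs : fn (Out (Free a) (map (@Free S) bs)) = a :: bs.
Proof. by rewrite /= fnv_free_map. Qed.

Lemma fn_open_fresh r bs P : r \notin bs -> (r \in fn (open bs P)) = (r \in fn P).
Proof.
move=> rb; apply/idP/idP => [/fn_open [] // H|]; last exact: sub_fn_open.
by rewrite H in rb.
Qed.

Lemma cont_neq a b : cont a -> ~~ cont b -> (a == b) = false.
Proof. by move=> ca cb; apply/eqP => E; rewrite E (negPf cb) in ca. Qed.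

(** Bodies of inputs at output-controlled names own nothing but the received continuation, so
    replication cannot duplicate a free one. *)
Lemma typ_names s P : typ s P -> process P -> forall p, cont p ->
  (p \in fn P) = (p \in names_of s) /\ (output_names P p -> (p, TO) \in s).
Proof.
elim=> {s P}.
- move=> p bs cp; rewrite process_Out => /eqP E r cr; split.
    rewrite fn_Out !inE; case rb: (r \in bs); rewrite ?orbF //.
    by have [op _] := carried_cont E rb cr; rewrite (cont_outc cp) in op.
  rewrite /output_names /= mem_map_Free => rb.
  by have [op _] := carried_cont E rb cr; rewrite (cont_outc cp) in op.
- move=> x bs p ox cp; rewrite process_Out => /eqP E r cr.
  have rE : (r \in rcons bs p) = (r == p).
    apply/idP/eqP => [rb|->]; last by rewrite mem_rcons mem_head.
    by have [_ ->] := carried_cont E rb cr; rewrite last_rcons.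
  split; first by rewrite fn_Out !inE rE (@cont_neq r x) ?(outc_cont ox).
  by rewrite /output_names /= mem_map_Free rE => /eqP ->; rewrite inE.
- move=> u bs iu; rewrite process_Out => /eqP E r cr.
  have rE : (r \in bs) = false.
    by apply/negP => rb; have [ou _] := carried_cont E rb cr; rewrite (inc_outc iu) in ou.
  split; first by rewrite fn_Out inE rE (@cont_neq r u) ?(inc_cont iu).
  by rewrite /output_names /= mem_map_Free rE.
- move=> q p ss bs P cq cp pq /fresh_namesP [E U fr] _ IH.
  rewrite process_In => /andP [/eqP Ess W] r cr.
  have [IH1 IH2] := IH (process_open_body E W) r cr.
  have rb : r \notin bs.
    apply/negP => rb; have [|oq _] := @carried_cont _ q bs r _ rb cr; first by rewrite E.
    by rewrite (cont_outc cq) in oq.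
  split; first by rewrite /= inE -(fn_open_fresh P rb) IH1 !inE.
  by move=> /(@output_object_open r 0 bs P) /IH2; rewrite !inE => ->; rewrite orbT.
- move=> x p ss bs P ox cp /fresh_namesP [E U fr] _ IH.
  rewrite process_In => /andP [/eqP Ess W] r cr.
  have [IH1 IH2] := IH (process_open_body E W) r cr.
  have rP : r \notin fn P.
    apply/negP => rP; have := sub_fn_open 0 (rcons bs p) rP.
    rewrite IH1 inE => /eqP /= rp; have := fr p; rewrite mem_rcons mem_head -rp rP.
    by move/(_ isT).
  split; first by rewrite /= inE (negPf rP) (@cont_neq r x) ?(outc_cont ox).
  by move=> /(@output_object_fn r P); rewrite (negPf rP).
- move=> x p ss bs P ox cp /fresh_namesP [E U fr] _ IH.
  rewrite process_Rep => /andP [/eqP Ess W] r cr.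
  have [IH1 IH2] := IH (process_open_body E W) r cr.
  have rP : r \notin fn P.
    apply/negP => rP; have := sub_fn_open 0 (rcons bs p) rP.
    rewrite IH1 inE => /eqP /= rp; have := fr p; rewrite mem_rcons mem_head -rp rP.
    by move/(_ isT).
  split; first by rewrite /= inE (negPf rP) (@cont_neq r x) ?(outc_cont ox).
  by move=> /(@output_object_fn r P); rewrite (negPf rP).
- move=> u p ss bs P iu cp /fresh_namesP [E U fr] _ IH.
  rewrite process_In => /andP [/eqP Ess W] r cr.
  have [IH1 IH2] := IH (process_open_body E W) r cr.
  have rb : r \notin bs.
    apply/negP => rb; have [|ou _] := @carried_cont _ u bs r _ rb cr; first by rewrite E.
    by rewrite (inc_outc iu) in ou.
  split; first by rewrite /= inE -(fn_open_fresh P rb) IH1 !inE (@cont_neq r u) ?(inc_cont iu).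
  by move=> /(@output_object_open r 0 bs P) /IH2.
- by [].
- move=> a s s' P aP T IH Hnu; rewrite process_Nu => W r cr.
  have [IH1 IH2] := IH W r cr; have [_ as' _] := nu_stack_stk Hnu (typ_stk T).
  have [ra|ra] := eqVneq r a.
    split; first by rewrite ra /= (negPf aP) (negPf as').
    by move=> /(@output_object_fn r P); rewrite ra (negPf aP).
  split.
    rewrite /= -(fn_open_fresh (bs := [:: a])) ?inE // IH1.
    apply/idP/idP => /mapP [e es E]; rewrite E; apply: map_f.
      by apply: (nu_stack_mem Hnu es); rewrite -E.
    exact: nu_stack_sub Hnu es.
  move=> /(@output_object_open r 0 [:: a] P) /IH2 H.
  exact: nu_stack_mem Hnu H ra.
- move=> a b P ca cb _ IH /and4P [_ _ _ W] r cr; have [IH1 IH2] := IH W r cr.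
  by split; first by rewrite /= !inE IH1 !(@cont_neq r).
- move=> s s' s'' P Q _ IHP _ IHQ [Hs H] /andP [WP WQ] r cr.
  have [IH1 IH2] := IHP WP r cr; have [IH3 IH4] := IHQ WQ r cr; split.
    rewrite /= mem_cat IH1 IH3; apply/orP/idP => [[]|].
    + by case/mapP => e es ->; apply: map_f; rewrite (shuffle_mem H) mem_cat es.
    + by case/mapP => e es ->; apply: map_f; rewrite (shuffle_mem H) mem_cat es orbT.
    + case/mapP => e; rewrite (shuffle_mem H) mem_cat => /orP [es|es] ->;
        [left|right]; exact: map_f.
  by rewrite (shuffle_mem H) mem_cat => /orP [/IH2|/IH4] ->; rewrite ?orbT.
- by move=> s P _ IH _ W; apply: IH.
- move=> s P Q _ IHP _ IHQ _ /and4P [_ _ WP WQ] r cr.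
  have [IH1 IH2] := IHP WP r cr; have [IH3 IH4] := IHQ WQ r cr; split.
    by rewrite /= mem_cat IH1 IH3 orbb.
  by case/orP => [/IH2|/IH4].
Qed.

Lemma typ_fn s P p : typ s P -> process P -> cont p ->
  (p \in fn P) = (p \in names_of s).
Proof. by move=> T W cp; case: (typ_names T W cp). Qed.

Lemma typ_notin s P p : typ s P -> process P -> p \notin fn P -> p \notin names_of s.
Proof.
move=> T W pP; apply/negP => ps; case/negP: pP.
by rewrite (typ_fn T W (names_cont (typ_stk T) ps)).
Qed.

Lemma typ_seq s P : typ s P -> seq_typ (seqn s) P.
Proof.
elim=> {s P} /=.
- by move=> p bs cp; apply: ST_outO; rewrite cp orbT.
- by move=> x bs p ox cp; apply: ST_outO; rewrite ox.
- by move=> u bs iu; apply: ST_outI.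
- by move=> q p ss bs P cq cp pq fr _ IH; apply: ST_inO fr IH; rewrite cq orbT.
- by move=> x p ss bs P ox cp fr _ IH; apply: ST_inO fr IH; rewrite ox.
- by move=> x p ss bs P ox cp fr _ IH; apply: ST_repO fr IH; rewrite ox.
- by move=> u p ss bs P iu cp fr _ IH; apply: ST_inI fr IH.
- exact: ST_nil.
- move=> a s s' P aP T IH Hnu; have [_ _ <-] := nu_stack_stk Hnu (typ_stk T).
  exact: ST_nu aP IH.
- by move=> a b P _ _ _ IH; apply: ST_match.
- move=> s s' s'' P Q TP IHP TQ IHQ [Hs H]; rewrite is_stackE in Hs.
  have E := seqn_shuffle H Hs (typ_stk TP) (typ_stk TQ).
  by rewrite E; apply: ST_par; rewrite // -E seqn_le1.
- by move=> s P _ IH _; apply: ST_tau.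
- by move=> s P Q _ IHP _ IHQ _; apply: ST_sum.
Qed.

(** The derivation opened the restriction with some [b]. Renaming [b] to the given [a] is sound
    because [a] is fresh for the body and hence absent from its stack. *)
Lemma typ_Nu_inv s a P : typ s (Nu a.1 P) -> process (Nu a.1 P) -> a \notin fn P ->
  exists2 s0, typ s0 (open [:: a] P) & nu_stack a s0 s.
Proof.
move E: (Nu _ _) => R T; case: T E => // b s0 s' P' bP T Hnu [Eab EP]; subst P'.
rewrite process_Nu => W aP.
have [ab|ab] := eqVneq a b; first by exists s0; rewrite ab.
pose f := inst id [:: b] [:: a].
have fS : sort_pres f by apply: inst_sort => //=; rewrite Eab.
have fb : f b = a by rewrite /f /inst inE eqxx /= eqxx.
have fN c : c != b -> f c = c by move=> cb; apply: inst_out; rewrite inE.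
have as0 : a \notin names_of s0.
  by apply: (typ_notin T W); rewrite fn_open_fresh // inE.
have fI : {in b :: names_of s0 &, injective f}.
  have sep c : c \in names_of s0 -> c != b -> f c != a.
    by move=> cs cb; rewrite fN //; apply: contraNneq as0 => <-.
  move=> c d; rewrite !inE.
  have [->|cb] := eqVneq c b; have [->|db] := eqVneq d b => //= Hc Hd.
  + by rewrite fb => E; have := sep _ Hd db; rewrite -E eqxx.
  + by rewrite fb => E; have := sep _ Hc cb; rewrite E eqxx.
  + by rewrite !fN.
exists (map_stack f s0).
  have bP1 : {in [:: b], forall b', b' \notin fn P}.
    by move=> b'; rewrite inE => /eqP ->.
  have := typ_subst T W fS; rewrite /f ren_inst //=; last by rewrite Eab.
  rewrite (@ren_id _ id) //; apply => x y Hx Hy; apply: fI; rewrite inE ?Hx ?Hy orbT //.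
have -> : s' = map_stack f s'.
  rewrite map_stack_id // => c cs; apply: fN; apply: contraTneq cs => ->.
  by case: (nu_stack_stk Hnu (typ_stk T)).
by rewrite -fb; apply: nu_stack_map.
Qed.

Lemma typ_nu a s s' P : typ s P -> process P -> nu_stack a s s' -> typ s' (nu a P).
Proof.
move=> T W H; apply: (TY_nu _ _ H); first by rewrite fn_close mem_filter /= eqxx.
by rewrite open_nu.
Qed.

Lemma typ_nus cs s s' P : typ s P -> process P -> nus_stack cs s s' -> typ s' (nus cs P).
Proof.
move=> T W; elim: cs s' => [s' <-|c cs IH s' [t H Hc]] //.
by rewrite nus_cons; apply: typ_nu Hc; [apply: IH | apply: process_nus].
Qed.

End Typing.

(** * Subject reduction *)

Section SubjectReduction.

Variable S : sorting.
Implicit Types (s t u : stack S) (p q a b c : name S) (bs cs : seq (name S))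
  (P Q : proc S) (mu : action S).

Lemma Free_inj : injective (@Free S). Proof. by move=> a b []. Qed.

Definition act_sorted mu : Prop :=
  match mu with
  | ATau => True
  | AIn a bs | AOut _ a bs => map fst bs = obj a.1
  end.

Lemma trans_process P mu P' : trans P mu P' -> process P ->
  process P' /\ act_sorted mu.
Proof.
elim=> {P mu P'}.
- by move=> a bs; rewrite process_Out => /eqP.
- move=> a ss P bs E; rewrite process_In => /andP [/eqP Ess W].
  by split; [apply: process_open_body W | rewrite /= E].
- move=> a ss P bs E H; have := H; rewrite process_Rep => /andP [/eqP Ess W].
  split; last by rewrite /= E.
  by apply/andP; split; [exact: process_open_body W | exact: H].
- by [].
- by move=> a P mu P' _ IH /and4P [_ _ _ /IH].
- by move=> P Q mu P' _ IH /and4P [_ _ /IH].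
- by move=> P Q mu P' _ IH /and4P [_ _ _ /IH].
- by move=> P Q mu P' _ IH _ /andP [/IH [H1 H2] H3]; split=> //; apply/andP.
- by move=> P Q mu P' _ IH _ /andP [H3 /IH [H1 H2]]; split=> //; apply/andP.
- move=> P Q cs a bs P' Q' _ IH1 _ IH2 _ /andP [/IH1 [H1 _] /IH2 [H2 _]].
  by split=> //; apply/process_nus/andP.
- move=> P Q cs a bs P' Q' _ IH1 _ IH2 _ /andP [/IH1 [H1 _] /IH2 [H2 _]].
  by split=> //; apply/process_nus/andP.
- by move=> a P mu P' aP _ IH _; rewrite process_Nu => /IH [/(process_nu a) H1 H2].
- by move=> c P cs1 cs2 a bs P' cP _ IH _ _ _; rewrite process_Nu => /IH.
Qed.

Lemma in_step_fun s a bs s1 s2 : in_step s a bs s1 -> in_step s a bs s2 -> s1 = s2.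
Proof.
case=> [t1 ca E|ia|oa]; case=> [t2 ca' E'|ia'|oa'] //.
- by move: E'; rewrite E => -[].
- by rewrite (cont_inc ca) in ia'.
- by rewrite (cont_outc ca) in oa'.
- by rewrite (cont_inc ca') in ia.
- by rewrite (inc_outc ia) in oa'.
- by rewrite (cont_outc ca') in oa.
- by rewrite (inc_outc ia') in oa.
Qed.

(** As transitions are early, inversion has to hold for any received tuple, possibly with
    repetitions, and not just for the fresh names of the derivation. *)
Lemma typ_In_inv s a ss P bs : typ s (In (Free a) ss P) ->
  process (In (Free a) ss P) -> map fst bs = ss ->
  (cont a -> (a, TI) \in s) /\
  exists2 s1, in_step s a bs s1 & typ s1 (open bs P).
Proof.
move E: (In _ _ _) => R T W; rewrite -E process_In in W; move: W.
have swapn bs0 bs1 : fresh_names bs0 ss P -> map fst bs1 = ss -> wf [:: ss] P ->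
    forall p, typ [:: (p, TO)] (open bs0 P) ->
    typ [:: (inst id bs0 bs1 p, TO)] (open bs1 P).
  move=> /fresh_namesP [E0 U0 fr0] E1 W p T0.
  have E01 : map fst bs0 = map fst bs1 by rewrite E0.
  rewrite -(@ren_id _ id P) // -(ren_inst id U0 E01 fr0).
  apply: (typ_subst T0 (process_open_body E0 W) (inst_sort _ E01)) => //.
  by move=> x y; rewrite !inE => /eqP -> /eqP ->.
case: T E => // {s R}.
- move=> q p ss0 bs0 P0 cq cp pq fr T [Ea Es EP] /andP [/eqP Ess W] Eb.
  subst q ss0 P0; split; first by rewrite inE eqxx.
  exists [:: (p, TO)]; first exact: IS_cont.
  have := swapn _ _ fr Eb W _ T; rewrite inst_out //; apply/negP => pb.
  have [E0 _ _] := fresh_namesP fr.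
  have [|oq _] := @carried_cont _ a bs0 p _ pb cp; first by rewrite E0.
  by rewrite (cont_outc cq) in oq.
- move=> x p ss0 bs0 P0 ox cp fr T [Ea Es EP] /andP [/eqP Ess W] Eb.
  subst x ss0 P0; split; first by move=> ca; rewrite (cont_outc ca) in ox.
  exists [:: (last a bs, TO)]; first exact: IS_outc.
  have [E0 U0 _] := fresh_namesP fr.
  have sz : size (rcons bs0 p) = size bs by rewrite -(size_map fst bs) Eb -E0 size_map.
  have := inst_map id U0 sz; rewrite map_rcons => Ebs.
  have -> : last a bs = inst id (rcons bs0 p) bs p by rewrite -{1}Ebs last_rcons.
  exact: swapn.
- move=> x p ss0 bs0 P0 ix cp fr T [Ea Es EP] /andP [/eqP Ess W] Eb.
  subst x ss0 P0; split; first by move=> ca; rewrite (cont_inc ca) in ix.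
  exists [:: (p, TO)]; first exact: IS_inc.
  have := swapn _ _ fr Eb W _ T; rewrite inst_out //; apply/negP => pb.
  have [E0 _ _] := fresh_namesP fr.
  have [|oq _] := @carried_cont _ a bs0 p _ pb cp; first by rewrite E0.
  by rewrite (inc_outc ix) in oq.
Qed.

Lemma typ_Rep_inv s a ss P bs : typ s (Rep (Free a) ss P) ->
  process (Rep (Free a) ss P) -> map fst bs = ss ->
  [/\ s = [::], outc a & typ [:: (last a bs, TO)] (open bs P)].
Proof.
move E: (Rep _ _ _) => R T W; rewrite -E process_Rep in W; move: W.
case: T E => // {s R}.
move=> x p ss0 bs0 P0 ox cp fr T [Ea Es EP] /andP [/eqP Ess W] Eb.
subst x ss0 P0; split=> //; have [E0 U0 fr0] := fresh_namesP fr.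
have E01 : map fst (rcons bs0 p) = map fst bs by rewrite E0.
have sz : size (rcons bs0 p) = size bs by rewrite -(size_map fst bs) Eb -E0 size_map.
have := inst_map id U0 sz; rewrite map_rcons => Ebs.
rewrite -(@ren_id _ id P) // -(ren_inst id U0 E01 fr0).
have -> : last a bs = inst id (rcons bs0 p) bs p by rewrite -{1}Ebs last_rcons.
apply: (typ_subst T (process_open_body E0 W) (inst_sort _ E01)) => //.
by move=> x y; rewrite !inE => /eqP -> /eqP ->.
Qed.

Lemma typ_Out_inv s a bs : typ s (Out (Free a) (map (@Free S) bs)) ->
  map fst bs = obj a.1 -> out_step s [::] a bs [::].
Proof.
move E: (Out _ _) => R T; case: T E => // {s R}.
- by move=> p bs0 cp [-> _] _; apply: OS_cont.
- move=> x bs0 p ox cp [-> /(inj_map Free_inj) ->] _.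
  by apply: OS_free; rewrite ?last_rcons.
- by move=> u bs0 iu [-> _] _; apply: OS_inc.
Qed.

Lemma typ_Par_inv u P Q : typ u (Par P Q) ->
  exists s t, [/\ typ s P, typ t Q, shuffle u s t & stk u].
Proof.
move E: (Par _ _) => R T; case: T E => // {u R} s t u P0 Q0 TP TQ [H1 H2] [-> ->].
by exists s, t; rewrite -is_stackE.
Qed.

Lemma typ_Par s t u P Q : typ s P -> typ t Q -> shuffle u s t -> stk u ->
  typ u (Par P Q).
Proof. by move=> TP TQ H Hu; apply: TY_par TP TQ _; split; rewrite ?is_stackE. Qed.

Lemma typ_Sum_inv s P Q : typ s (Sum P Q) -> typ s P /\ typ s Q.
Proof. by move E: (Sum _ _) => R T; case: T E => // {s R} s P0 Q0 H1 H2 _ [-> ->]. Qed.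

Lemma typ_Tau_inv s P : typ s (Tau P) -> typ s P.
Proof. by move E: (Tau _) => R T; case: T E => // {s R} s P0 H1 _ [->]. Qed.

Lemma typ_Match_inv s a b P : typ s (Match (Free a) (Free b) P) ->
  [/\ s = [::], ~~ cont a, ~~ cont b & typ [::] P].
Proof.
by move E: (Match _ _ _) => R T; case: T E => // {s R} a0 b0 P0 ? ? ? [-> -> ->].
Qed.

(** An internal step may consume the pair on top. An input may receive a continuation that is
    already in use, so its residual is typed only when the new sequence is a stack. *)
Definition sr_post s mu P' : Prop :=
  match mu with
  | ATau => typ s P' \/
      exists p s1, s = (p, TO) :: (p, TI) :: s1 /\ typ s1 P'
  | AOut cs a bs => exists2 s1, out_step s cs a bs s1 & typ s1 P'
  | AIn a bs => (cont a -> (a, TI) \in s) /\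
      forall s1, in_step s a bs s1 -> stk s1 -> typ s1 P'
  end.

Lemma sr_par s t u P Q mu P' : typ s P -> typ t Q -> shuffle u s t -> stk u ->
  process (Par P Q) -> trans P mu P' -> disjoint_names (bn mu) (fn Q) ->
  sr_post s mu P' -> sr_post u mu (Par P' Q).
Proof.
move=> TP TQ H Hu W Htr D; have [WP WQ] := andP W.
have [_ srt] := trans_process Htr WP; have [_ spec] := trans_fn Htr WP.
have Hs := typ_stk TP; have Ht := typ_stk TQ; have TPQ := typ_Par TP TQ H Hu.
case: mu D Htr srt spec => [|a bs|cs a bs] /= D Htr srt spec.
- case=> [T'|[p [s1 [E T']]]]; first by left; apply: typ_Par H Hu.
  subst s; right; have [u' Eu H'] := shuffle_pop H Hu Hs Ht.
  exists p, u'; split=> //; apply: typ_Par T' TQ H' _.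
  by move: Hu; rewrite Eu => /stk_behead /stk_behead.
- case=> Ha T'; split=> [/Ha|u1 Hin Hu1].
    by rewrite (shuffle_mem H) mem_cat => ->.
  have [s1 Hs1 [H1 H2]] := in_step_par H Hu Hs Ht Ha Hin Hu1.
  exact: typ_Par (T' _ Hs1 H2) TQ H1 Hu1.
- case=> s1 Hout T'; have fr : {in cs, forall c, c \notin names_of u}.
    move=> c cc; apply: (typ_notin TPQ W); rewrite /= mem_cat negb_or.
    by case: spec => _ _ _ _ -> //; move/disjointP: D => ->.
  have [u1 Hu1 [H1 H2]] := out_step_par H Hu Hs Ht srt fr Hout.
  by exists u1 => //; apply: typ_Par H1 H2.
Qed.

Lemma sr_comm s t u P Q cs a bs P' Q' : typ s P -> typ t Q -> shuffle u s t ->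
  stk u -> process (Par P Q) ->
  trans P (AOut cs a bs) P' -> trans Q (AIn a bs) Q' -> disjoint_names cs (fn Q) ->
  sr_post s (AOut cs a bs) P' -> sr_post t (AIn a bs) Q' ->
  exists s1 t1 v v', [/\ typ s1 P', typ t1 Q', shuffle v s1 t1 /\ stk v,
    nus_stack cs v v' & v' = u \/ exists p, u = (p, TO) :: (p, TI) :: v'].
Proof.
move=> TP TQ H Hu W HP HQ D [s1 Hout TP'] [Ha TQ']; have [WP WQ] := andP W.
have [_ srt] := trans_process HP WP; have [_ [_ sub U cb fr]] := trans_fn HP WP.
have TPQ := typ_Par TP TQ H Hu.
have fr' : {in cs, forall c, c \notin names_of u}.
  move=> c cc; apply: (typ_notin TPQ W); rewrite /= mem_cat negb_or fr //.
  by move/disjointP: D => ->.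
have [t1 [v [v' [H1 [H2 H3] H4 H5 H6]]]] :=
  comm_stack H Hu (typ_stk TP) (typ_stk TQ) Hout Ha srt U cb fr'.
by exists s1, t1, v, v'; split=> //; apply: TQ'.
Qed.

Theorem subject_reduction P mu P' : trans P mu P' ->
  forall s, typ s P -> process P -> sr_post s mu P'.
Proof.
elim=> {P mu P'}.
- move=> a bs s T; rewrite process_Out => /eqP E.
  by exists [::]; [exact: typ_Out_inv | exact: TY_nil].
- move=> a ss P bs E s T W; have [H1 [s1 Hs1 T1]] := typ_In_inv T W E.
  by split=> // s2 Hs2 _; rewrite (in_step_fun Hs2 Hs1).
- move=> a ss P bs E s T W; have [Es oa T1] := typ_Rep_inv T W E; subst s.
  split; first by move=> ca; rewrite (cont_outc ca) in oa.
  move=> s2 [t ca|ia|_] Hs2.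
  + by rewrite (cont_outc ca) in oa.
  + by rewrite (inc_outc ia) in oa.
  + by apply: typ_Par T1 T _ Hs2; apply: SH_left; apply: SH_nil.
- by move=> P s T _; left; apply: typ_Tau_inv.
- move=> a P mu P' _ IH s /typ_Match_inv [-> _ _ T] /and4P [_ _ _ W].
  exact: IH.
- by move=> P Q mu P' _ IH s /typ_Sum_inv [T _] /and4P [_ _ W _]; apply: IH.
- by move=> P Q mu P' _ IH s /typ_Sum_inv [_ T] /and4P [_ _ _ W]; apply: IH.
- move=> P Q mu P' Htr IH D u /typ_Par_inv [s [t [TP TQ H Hu]]] W.
  by apply: (sr_par TP TQ H Hu W Htr D); apply: IH => //; case/andP: W.
- move=> P Q mu Q' Htr IH D u /typ_Par_inv [s [t [TP TQ H Hu]]] W.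
  have W' : process (Par Q P) by move: W; rewrite /process /= andbC.
  have := sr_par TQ TP (shuffle_sym H) Hu W' Htr D (IH _ TQ _).
  have swp (v : stack S) R1 R2 : typ v (Par R1 R2) -> typ v (Par R2 R1).
    by move=> /typ_Par_inv [x [y [T1 T2 H1 H2]]]; apply: typ_Par T2 T1 (shuffle_sym H1) H2.
  case/andP: W => _ WQ /(_ WQ); case: (mu) => [|a bs|cs a bs] /=.
  + by case=> [/swp|[p [s1 [E /swp T']]]]; [left|right; exists p, s1].
  + by case=> H1 H2; split=> // s1 Hs1 Hs2; apply/swp/H2.
  + by case=> s1 H1 /swp H2; exists s1.
- move=> P Q cs a bs P' Q' HP IHP HQ IHQ D u /typ_Par_inv [s [t [TP TQ H Hu]]] W.
  have [WP WQ] := andP W.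
  have [s1 [t1 [v [v' [T1 T2 [H1 H2] H3 H4]]]]] :=
    sr_comm TP TQ H Hu W HP HQ D (IHP _ TP WP) (IHQ _ TQ WQ).
  have WPQ : process (Par P' Q').
    by apply/andP; split; [case: (trans_process HP WP) | case: (trans_process HQ WQ)].
  have T := typ_nus (typ_Par T1 T2 H1 H2) WPQ H3.
  by case: H4 => [E|[p E]]; [left; rewrite -E | right; exists p, v'].
- move=> P Q cs a bs P' Q' HP IHP HQ IHQ D u /typ_Par_inv [s [t [TP TQ H Hu]]] W.
  have [WP WQ] := andP W.
  have W' : process (Par Q P) by apply/andP.
  have [s1 [t1 [v [v' [T1 T2 [H1 H2] H3 H4]]]]] :=
    sr_comm TQ TP (shuffle_sym H) Hu W' HQ HP D (IHQ _ TQ WQ) (IHP _ TP WP).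
  have WPQ : process (Par P' Q').
    by apply/andP; split; [case: (trans_process HP WP) | case: (trans_process HQ WQ)].
  have T := typ_nus (typ_Par T2 T1 (shuffle_sym H1) H2) WPQ H3.
  by case: H4 => [E|[p E]]; [left; rewrite -E | right; exists p, v'].
- move=> a P mu P' aP Htr IH amu s T W.
  have [s0 T0 Hnu] := typ_Nu_inv T W aP; rewrite process_Nu in W.
  have [W' _] := trans_process Htr W; have Hs0 := typ_stk T0.
  have := IH _ T0 W; case: mu amu {Htr IH} => [|b bs|cs b bs] amu /=.
  + case=> [T'|[p [s1 [E T']]]]; first by left; apply: typ_nu Hnu.
    subst s0; case: (nu_stack_pop Hnu Hs0) => [[Ea Es]|[v Es Hv]]; last first.
      by right; exists p, v; split=> //; apply: typ_nu Hv.
    (* The consumed pair was the one hidden by this restriction, which becomes vacuous: the visible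
       stack does not change. *)
    left; subst a s; apply: typ_nu T' W' _; apply: NU_unused.
      exact: (@stk_cont _ _ (p, TO) Hs0 (mem_head _ _)).
    by case: (@nu_used_stk _ p [::] s1 Hs0 erefl).
  + case=> H1 H2; split=> [cb|s1 Hin Hs1].
      apply: (nu_stack_mem Hnu (H1 cb)) => /=.
      by move: amu; rewrite /= inE negb_or eq_sym => /andP [].
    have [s2 K1 [K2 K3]] := in_step_res Hnu Hs0 amu Hin Hs1.
    exact: typ_nu (H2 _ K1 K3) W' K2.
  + case=> s1 Hout T'; have [v K1 K2] := out_step_res Hnu Hs0 amu Hout.
    by exists v => //; apply: typ_nu K2.
- move=> c P cs1 cs2 a bs P' cP Htr IH ca cb cc s T W.
  have [s0 T0 Hnu] := typ_Nu_inv T W cP; rewrite process_Nu in W.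
  have [_ srt] := trans_process Htr W; have Hs0 := typ_stk T0.
  have [s1 Hout T'] := IH _ T0 W; have cE x : x \in cs1 ++ c :: cs2 = (x == c) || (x \in cs1 ++ cs2).
    by rewrite !mem_cat inE orbCA.
  have [kc|kc] := boolP (cont c).
  (* Inside the restriction the extruded continuation is sent as a free name, with its output tag on
     top; outside it is a bound one and its input tag becomes visible. *)
  + have [oa El] := carried_cont srt cb kc.
    case: Hout T' => [s2 ka _|ia|_ lc|s2 _ lc E] T'.
    * by rewrite (cont_outc ka) in oa.
    * by rewrite (inc_outc ia) in oa.
    * by rewrite -El (negPf cc) in lc.
    * rewrite -El in E; subst s0; have [E1 sq] := nu_stack_open Hnu Hs0; subst s2.
      exists ((c, TI) :: s) => //; rewrite El; apply: OS_bound => //.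
      by rewrite -El cE eqxx.
  + have Es : s0 = s by case: Hnu kc => [p xi v -> | p v -> | ] //.
    subst s0; exists s1 => //; case: Hout {T'} => [s2 ka E|ia|oa lc sq|s2 oa lc E].
    * exact: OS_cont.
    * exact: OS_inc.
    * by apply: OS_bound; rewrite // cE lc orbT.
    * apply: OS_free => //; rewrite cE negb_or lc andbT.
      by apply: contraNneq kc => <-; apply: carried_last.
Qed.

(** The popping alternative of subject reduction needs both tags of one name on top, which a clean
    stack excludes. *)
Lemma red_typ s P P' : typ s P -> process P -> clean s -> red P P' -> typ s P'.
Proof.
move=> T W C /subject_reduction /(_ _ T W) [] // [p [s1 [E _]]]; move: C.
rewrite E => /allP /(_ p); rewrite /= inE eqxx /both_tags !inE !eqxx !orbT.
by move/(_ isT).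
Qed.

Lemma red_wtyped s P P' : wtyped s P -> clean s -> red P P' -> wtyped s P'.
Proof.
by move=> [W T] C H; split; [case: (trans_process H W) | apply: red_typ H].
Qed.

Lemma wtau_wtyped s P P' : wtyped s P -> clean s -> wtau P P' -> wtyped s P'.
Proof.
move=> H C R; elim: R H => // [x y H1 H2|x y z _ H1 _ H2 /H1 /H2] //.
exact: red_wtyped H2 C H1.
Qed.

End SubjectReduction.

(** * Flat normal forms *)

Section Threads.

Variable S : sorting.
Implicit Types (p q a b c : name S) (bs cs ds es L : seq (name S))
  (P Q G R : proc S) (ts us r : seq (proc S)) (mu : action S)
  (f g : name S -> name S).

Definition is_thread P :=
  match P with Par _ _ | Nu _ _ | Nil => false | _ => true end.

Definition apart cs L := all (fun c => c \notin L) cs.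

Lemma apartP cs L : reflect (forall c, c \in cs -> c \notin L) (apart cs L).
Proof. exact: allP. Qed.

Lemma apart_catl cs ds L : apart (cs ++ ds) L = apart cs L && apart ds L.
Proof. exact: all_cat. Qed.

Lemma apart_catr cs L1 L2 : apart cs (L1 ++ L2) = apart cs L1 && apart cs L2.
Proof.
rewrite /apart -all_predI; apply: eq_all => c /=.
by rewrite mem_cat negb_or.
Qed.

Lemma apart_sub cs ds L1 L2 : {subset cs <= ds} -> {subset L1 <= L2} ->
  apart ds L2 -> apart cs L1.
Proof.
move=> H1 H2 /apartP H; apply/apartP => c /H1 /H; apply: contra; exact: H2.
Qed.

Lemma apart_subl cs ds L : {subset cs <= ds} -> apart ds L -> apart cs L.
Proof. by move=> H; apply: apart_sub. Qed.

Lemma apart_subr cs L1 L2 : {subset L1 <= L2} -> apart cs L2 -> apart cs L1.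
Proof. by move=> H; apply: apart_sub. Qed.

Lemma apart_sym cs ds : apart cs ds = apart ds cs.
Proof.
by apply/apartP/apartP => H c cs'; apply/negP => /H; rewrite cs'.
Qed.

Lemma apart_disjoint cs L : apart cs L = disjoint_names cs L.
Proof. by rewrite /disjoint_names -all_predC. Qed.

Definition fns ts : seq (name S) := flatten (map (@fn S) ts).

Lemma fns_cons P ts : fns (P :: ts) = fn P ++ fns ts. Proof. by []. Qed.

Lemma fns_cat ts us : fns (ts ++ us) = fns ts ++ fns us.
Proof. by rewrite /fns map_cat flatten_cat. Qed.

Lemma fns_perm ts us : perm_eq ts us -> fns ts =i fns us.
Proof. by move=> H; apply/perm_mem/perm_flatten/perm_map. Qed.

(* [nf P cs ts]: P is structurally congruent to (nu cs) of the parallel composition of ts. *)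
Inductive nf : proc S -> seq (name S) -> seq (proc S) -> Prop :=
| NF_nil : nf (Nil S) [::] [::]
| NF_thread P : is_thread P -> nf P [::] [:: P]
| NF_par P Q cs ds ts us : nf P cs ts -> nf Q ds us ->
    apart cs (fn Q) -> apart ds (fn P) -> apart cs ds ->
    nf (Par P Q) (cs ++ ds) (ts ++ us)
| NF_nu c P cs ts : c \notin fn P -> nf (open [:: c] P) cs ts -> c \notin cs ->
    nf (Nu c.1 P) (c :: cs) ts.

(** [nf] follows the syntax tree, so its lists come in a fixed order; normal forms are used up to
    reordering. *)
Definition nfp P cs ts :=
  exists cs0 ts0, [/\ nf P cs0 ts0, perm_eq cs0 cs & perm_eq ts0 ts].

Lemma nf_nfp P cs ts : nf P cs ts -> nfp P cs ts.
Proof. by exists cs, ts. Qed.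

Lemma nfp_perm P cs ts cs' ts' :
  perm_eq cs cs' -> perm_eq ts ts' -> nfp P cs ts -> nfp P cs' ts'.
Proof.
move=> H1 H2 [c0 [t0 [H3 H4 H5]]].
by exists c0, t0; split=> //; [apply: perm_trans H4 H1 | apply: perm_trans H5 H2].
Qed.

Lemma nfp_nil : nfp (Nil S) [::] [::]. Proof. exact/nf_nfp/NF_nil. Qed.

Lemma nfp_thread P : is_thread P -> nfp P [::] [:: P].
Proof. by move=> H; apply/nf_nfp/NF_thread. Qed.

Lemma nfp_par P Q cs ds ts us : nfp P cs ts -> nfp Q ds us ->
  apart cs (fn Q) -> apart ds (fn P) -> apart cs ds ->
  nfp (Par P Q) (cs ++ ds) (ts ++ us).
Proof.
move=> [c0 [t0 [H1 C1 T1]]] [d0 [u0 [H2 C2 T2]]] A1 A2 A3.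
exists (c0 ++ d0), (t0 ++ u0); split; last exact: perm_cat.
  apply: NF_par => //.
  - by rewrite /apart (perm_all _ C1).
  - by rewrite /apart (perm_all _ C2).
  - apply: apart_sub A3 => x; by rewrite ?(perm_mem C1) ?(perm_mem C2).
exact: perm_cat.
Qed.

Lemma nfp_Nu c P cs ts : c \notin fn P -> nfp (open [:: c] P) cs ts -> c \notin cs ->
  nfp (Nu c.1 P) (c :: cs) ts.
Proof.
move=> cP [c0 [t0 [H C T]]] cc; exists (c :: c0), t0; split=> //.
  by apply: NF_nu; rewrite ?(perm_mem C).
by rewrite perm_cons.
Qed.

Lemma nfp_nu c P cs ts : process P -> nfp P cs ts -> c \notin cs ->
  nfp (nu c P) (c :: cs) ts.
Proof.
move=> W H cc; apply: nfp_Nu => //; last by rewrite open_nu.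
by rewrite fn_close mem_filter /= eqxx.
Qed.

Lemma nfp_nus ds P cs ts : process P -> nfp P cs ts -> uniq ds -> apart ds cs ->
  nfp (nus ds P) (ds ++ cs) ts.
Proof.
move=> W H; elim: ds => // d ds IH /andP [dd U] /andP [dc A].
by rewrite nus_cons; apply: nfp_nu; [apply: process_nus | apply: IH | rewrite mem_cat negb_or dd].
Qed.

Lemma nf_uniq P cs ts : nf P cs ts -> uniq cs /\ apart cs (fn P).
Proof.
elim=> {P cs ts} //.
- move=> P Q cs ds ts us _ [U1 A1] _ [U2 A2] H1 H2 H3; split.
    rewrite cat_uniq U1 U2 andbT /=; apply/hasPn => x xd.
    by apply/negP => xc; move/apartP: H3 => /(_ _ xc); rewrite xd.
  by rewrite /= apart_catl !apart_catr A1 H1 H2.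
- move=> c P cs ts cP _ [U A] cc; split; first by rewrite /= cc.
  rewrite /= cP; apply: apart_sub A => //; exact: sub_fn_open.
Qed.

Lemma nfp_uniq P cs ts : nfp P cs ts -> uniq cs /\ apart cs (fn P).
Proof.
move=> [c0 [t0 [/nf_uniq [U A] C _]]].
by rewrite -(perm_uniq C) /apart -(perm_all _ C).
Qed.

Lemma nf_fn P cs ts : nf P cs ts ->
  {subset fn P <= fns ts} /\ {subset fns ts <= fn P ++ cs}.
Proof.
elim=> {P cs ts} //.
- by move=> P _; rewrite /fns /= !cats0; split=> x.
- move=> P Q cs ds ts us _ [A1 B1] _ [A2 B2] _ _ _; rewrite fns_cat; split=> x /=.
    by rewrite !mem_cat => /orP [/A1|/A2] ->; rewrite ?orbT.
  rewrite !mem_cat => /orP [/B1|/B2]; rewrite mem_cat => /orP [] ->; rewrite ?orbT //.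
- move=> c P cs ts cP _ [A B] _; split=> x /=.
    by move=> xP; apply/A/sub_fn_open.
  move=> /B; rewrite !mem_cat inE => /orP [/mem_fn_open1|->]; last by rewrite !orbT.
  by case/orP => ->; rewrite ?orbT.
Qed.

Lemma nfp_fn P cs ts : nfp P cs ts ->
  {subset fn P <= fns ts} /\ {subset fns ts <= fn P ++ cs}.
Proof.
move=> [c0 [t0 [/nf_fn [A B] C T]]]; split=> x.
  by move=> /A; rewrite (fns_perm T).
by rewrite -(fns_perm T) => /B; rewrite !mem_cat (perm_mem C).
Qed.

Lemma nf_threads P cs ts : nf P cs ts -> process P ->
  all (fun t => is_thread t && process t) ts.
Proof.
elim=> {P cs ts} //.
- by move=> P HP W; rewrite /= HP W.
- by move=> P Q cs ds ts us _ H1 _ H2 _ _ _ /andP [/H1 A /H2 B]; rewrite all_cat A.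
- by move=> c P cs ts cP _ H _; rewrite process_Nu => /H.
Qed.

Lemma nfp_threads P cs ts t : nfp P cs ts -> process P -> t \in ts ->
  is_thread t /\ process t.
Proof.
move=> [c0 [t0 [H C T]]] /(nf_threads H) /allP X tt; apply/andP/X.
by rewrite (perm_mem T).
Qed.

Fixpoint psize P : nat :=
  match P with
  | Par P Q | Sum P Q => (psize P + psize Q).+1
  | Nu _ P | Tau P | Rep _ _ P | In _ _ P | Match _ _ P => (psize P).+1
  | _ => 1
  end.

Lemma psize_open k bs P : psize (open_rec k bs P) = psize P.
Proof. by elim: P k => //= *; congruence. Qed.

(** Induction on size, because the opened body of a restriction is not a subterm. *)
Lemma nf_exists P L : exists cs ts, nf P cs ts /\ apart cs L.
Proof.
have [n] := ubnP (psize P); elim: n P L => // n IH P L lt_n.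
have thr : is_thread P -> exists cs ts, nf P cs ts /\ apart cs L.
  by move=> H; exists [::], [:: P]; split=> //; apply: NF_thread.
case: P lt_n thr => /=; try by move=> *; auto.
- move=> P Q lt_n _.
  have [|cs [ts [H1]]] := IH P (L ++ fn Q); first by lia.
  rewrite apart_catr => /andP [A1 A2].
  have [|ds [us [H2]]] := IH Q (L ++ fn P ++ cs); first by lia.
  rewrite !apart_catr => /and3P [B1 B2 B3].
  exists (cs ++ ds), (ts ++ us); rewrite apart_catl A1 B1; split=> //.
  by apply: NF_par; rewrite // apart_sym.
- move=> s P lt_n _; have [c [<- ]] := fresh_name s (L ++ fn P).
  rewrite mem_cat negb_or => /andP [cL cP].
  have [|cs [ts [H1]]] := IH (open [:: c] P) (c :: L); first by rewrite psize_open.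
  rewrite -cat1s apart_catr => /andP [A1 A2].
  exists (c :: cs), ts; split; last by rewrite /= cL.
  apply: NF_nu => //; apply/negP => /(apartP _ _ A1); by rewrite inE eqxx.
- by move=> _ _; exists [::], [::]; split=> //; exact: NF_nil.
Qed.

Lemma apart_map f cs L : injective f -> apart (map f cs) (map f L) = apart cs L.
Proof.
by move=> fI; rewrite /apart all_map; apply: eq_all => c /=; rewrite mem_map.
Qed.

Lemma is_thread_ren f P : is_thread (ren f P) = is_thread P.
Proof. by case: P. Qed.

Lemma nf_ren f P cs ts : injective f -> sort_pres f -> nf P cs ts ->
  nf (ren f P) (map f cs) (map (ren f) ts).
Proof.
move=> fI fS; elim=> {P cs ts}.
- exact: NF_nil.
- by move=> P H; apply: NF_thread; rewrite is_thread_ren.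
- move=> P Q cs ds ts us _ H1 _ H2 A1 A2 A3; rewrite !map_cat /=.
  by apply: NF_par; rewrite // ?fn_ren apart_map.
- move=> c P cs ts cP _ H cc /=; rewrite -(fS c); apply: NF_nu.
  + by rewrite fn_ren mem_map.
  + by move: H; rewrite /open ren_open.
  + by rewrite mem_map.
Qed.

Lemma nfp_ren f P cs ts : injective f -> sort_pres f -> nfp P cs ts ->
  nfp (ren f P) (map f cs) (map (ren f) ts).
Proof.
move=> fI fS [c0 [t0 [H C T]]]; exists (map f c0), (map (ren f) t0).
by split; [apply: nf_ren | apply: perm_map | apply: perm_map].
Qed.

Lemma eq_map_ren f g ts : {in fns ts, f =1 g} -> map (ren f) ts = map (ren g) ts.
Proof.
move=> H; apply/eq_in_map => t tt; apply: eq_ren => x xt; apply: H.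
by apply/flattenP; exists (fn t) => //; apply: map_f.
Qed.

Lemma mapK_in (T : eqType) (h : T -> T) (l l' : seq T) : map h l = l' ->
  (forall x, x \in l -> h x \in l').
Proof. by move=> <- x xl; apply: map_f. Qed.

(** Alpha-equivalence for normal forms: a fact obtained for one of them is transported to any other
    by a bijection that fixes the free names. *)
Lemma nf_unique P cs ts : nf P cs ts -> forall cs' ts', nf P cs' ts' ->
  exists f f', [/\ renaming f f', {in fn P, f =1 id},
    cs' = map f cs & ts' = map (ren f) ts].
Proof.
elim=> {P cs ts}.
- move=> cs' ts'; move E: (Nil S) => P H;
  by case: H E; [exists id, id | move=> Q + E; rewrite -E | | ].
- move=> P HP cs' ts' H; case: H HP => // Q HQ _.
  by exists id, id; split=> //=; rewrite renE_id.
- move=> P Q cs ds ts us HP IHP HQ IHQ A1 A2 A3 cs' ts'.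
  move E: (Par P Q) => R H; case: H E; [by [] | by move=> R0 + E; rewrite -E | | by []].
  move=> P0 Q0 c' d' t' u' HP' HQ' B1 B2 B3 [EP EQ]; subst P0 Q0.
  have [f1 [f1' [R1 I1 C1 T1]]] := IHP _ _ HP'.
  have [f2 [f2' [R2 I2 C2 T2]]] := IHQ _ _ HQ'.
  have [_ /apartP F1] := nf_uniq HP; have [_ /apartP F2] := nf_uniq HQ.
  have [_ /apartP F1'] := nf_uniq HP'; have [_ /apartP F2'] := nf_uniq HQ'.
  have mc := mapK_in (esym C1); have md := mapK_in (esym C2).
  move/apartP in A1; move/apartP in A2; move/apartP in A3.
  move/apartP in B1; move/apartP in B2; move/apartP in B3.
  (* The renamings of the two components are glued: they move disjoint sets of restricted names to
     disjoint sets and fix the free names, so the union is injective. *)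
  pose g x := if x \in cs then f1 x else if x \in ds then f2 x else x.
  have gS : sort_pres g.
    move=> x; rewrite /g; case: ifP => _; first exact: (renaming_sort R1).
    by case: ifP => _ //; exact: (renaming_sort R2).
  have gc x : x \in cs -> g x = f1 x by rewrite /g => ->.
  have gd x : x \in ds -> g x = f2 x.
    rewrite /g => xd; rewrite xd; case: ifP => // xc; by have := A3 _ xc; rewrite xd.
  have gn x : x \in fn P ++ fn Q -> g x = x.
    rewrite mem_cat /g => xf; case: ifP => xc.
      by move: xf (F1 _ xc) (A1 _ xc) => /orP [] ->.
    by case: ifP => // xd; move: xf (F2 _ xd) (A2 _ xd) => /orP [] ->.
  have gI : {in cs ++ ds ++ (fn P ++ fn Q) &, injective g}.
    have cn x y : x \in cs -> y \in fn P ++ fn Q -> g x = g y -> x = y.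
      move=> xc yn; rewrite gc // (gn _ yn) => E; move: yn; rewrite -E mem_cat.
      by rewrite (negPf (F1' _ (mc _ xc))) (negPf (B1 _ (mc _ xc))).
    have dn x y : x \in ds -> y \in fn P ++ fn Q -> g x = g y -> x = y.
      move=> xc yn; rewrite gd // (gn _ yn) => E; move: yn; rewrite -E mem_cat.
      by rewrite (negPf (F2' _ (md _ xc))) (negPf (B2 _ (md _ xc))).
    have cd x y : x \in cs -> y \in ds -> g x = g y -> x = y.
      move=> xc yn; rewrite gc // gd // => E.
      by have := B3 _ (mc _ xc); rewrite E md.
    move=> x y; rewrite [in x \in _]mem_cat [in y \in _]mem_cat.
    rewrite [in x \in ds ++ _]mem_cat [in y \in ds ++ _]mem_cat.
    case/or3P => Hx /or3P [] Hy E.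
    + by move: E; rewrite !gc // => /(renaming_inj R1).
    + exact: cd.
    + exact: cn.
    + by apply/esym/cd.
    + by move: E; rewrite !gd // => /(renaming_inj R2).
    + exact: dn.
    + by apply/esym/cn.
    + by apply/esym/dn.
    + by move: E; rewrite !gn.
  have [f [f' [fR fg]]] := extend_renaming gS gI.
  have fc x : x \in cs -> f x = f1 x by move=> xc; rewrite fg ?mem_cat ?xc // gc.
  have fd x : x \in ds -> f x = f2 x by move=> xc; rewrite fg ?mem_cat ?xc ?orbT // gd.
  have fn' x : x \in fn P ++ fn Q -> f x = x.
    by move=> xn; rewrite fg ?gn // !mem_cat -mem_cat xn !orbT.
  exists f, f'; split=> //.
  + rewrite map_cat C1 C2; congr (_ ++ _); apply/eq_in_map => x xx.
      by rewrite fc.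
    by rewrite fd.
  + have [_ N1] := nf_fn HP; have [_ N2] := nf_fn HQ.
    rewrite map_cat T1 T2; congr (_ ++ _); apply: eq_map_ren => x.
      move=> /N1; rewrite mem_cat => /orP [xP|/fc //].
      by rewrite I1 // fn' // mem_cat xP.
    move=> /N2; rewrite mem_cat => /orP [xP|/fd //].
    by rewrite I2 // fn' // mem_cat xP orbT.
- move=> c P cs ts cP H IH cc cs' ts'.
  move E: (Nu _ P) => R H'; case: H' E; [by [] | by move=> R0 + E; rewrite -E | by [] | ].
  move=> c' P0 cs1 ts1 cP' H' cc' [Ec EP]; subst P0.
  have sS : renaming (swap c c') (swap c c') by apply: renaming_swap.
  have := nf_ren (renaming_inj sS) (renaming_sort sS) H'.
  have swP x : x \in fn P -> swap c c' x = x.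
    by move=> xP; apply: swap_out; apply: contraTneq xP => ->.
  rewrite /open ren_open /= swapR (@ren_id _ _ P) // => /IH.
  move=> [f [f' [fR fI Ec1 Et1]]].
  have Ecs : cs1 = map (swap c c' \o f) cs.
    by rewrite map_comp -Ec1 (mapK (swapK _ _)).
  have Ets : ts1 = map (ren (swap c c' \o f)) ts.
    rewrite -(eq_map (ren_comp (swap c c') f)) map_comp -Et1 -map_comp.
    rewrite -[LHS]map_id; apply: eq_map => t /=; rewrite ren_comp ren_id //.
    by move=> x _ /=; rewrite swapK.
  have [_ F] := nf_uniq H; have [_ F'] := nf_uniq H'.
  have mc := mapK_in (esym Ecs).
  (* The second normal form opens the restriction with [c']. It was brought to [c] by a swap to
     apply the induction hypothesis; [g] undoes the swap and sends [c] to [c']. *)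
  pose g x := if x == c then c' else swap c c' (f x).
  have gS : sort_pres g.
    move=> x; rewrite /g; case: eqP => [->|_] //.
    by rewrite (renaming_sort sS) (renaming_sort fR).
  have gc : g c = c' by rewrite /g eqxx.
  have gcs x : x \in cs -> g x \in cs1.
    move=> xc; rewrite /g; case: eqP => [E|_]; first by rewrite -E xc in cc.
    exact: mc.
  have gP x : x \in fn P -> g x = x.
    move=> xP; rewrite /g; case: eqP => [E|_]; first by rewrite -E xP in cP.
    by rewrite fI ?swP // sub_fn_open.
  have gI : {in c :: cs ++ fn P &, injective g}.
    have k1 x : x \in cs -> g x != c'.
      by move=> /gcs xc; apply: contraNneq cc' => <-.
    have k2 x : x \in fn P -> g x != c'.
      by move=> xP; rewrite gP //; apply: contraNneq cP' => <-.
    have k3 x y : x \in cs -> y \in fn P -> g x = g y -> x = y.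
      move=> /gcs xc yP; rewrite (gP y) // => E; rewrite E in xc.
      by move/apartP: F' => /(_ _ xc); rewrite sub_fn_open.
    move=> x y; rewrite !inE !mem_cat => /or3P [/eqP->|xc|xc] /or3P [/eqP->|yc|yc] //.
    + by rewrite gc => E; have := k1 _ yc; rewrite E eqxx.
    + by rewrite gc => E; have := k2 _ yc; rewrite E eqxx.
    + by rewrite gc => E; have := k1 _ xc; rewrite E eqxx.
    + rewrite /g; case: eqP => [E|_]; first by rewrite -E xc in cc.
      case: eqP => [E|_]; first by rewrite -E yc in cc.
      by move=> /(renaming_inj sS) /(renaming_inj fR).
    + exact: k3.
    + by rewrite gc => E; have := k2 _ xc; rewrite E eqxx.
    + by move=> E; apply/esym/k3.
    + by rewrite !gP.
  have [h [h' [hR hg]]] := extend_renaming gS gI.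
  exists h, h'; split=> //.
  + by move=> x xP; rewrite hg ?gP // inE mem_cat xP !orbT.
  + rewrite /= hg ?inE ?eqxx // gc Ecs; congr (_ :: _); apply/eq_in_map => x xc.
    rewrite hg ?inE ?mem_cat ?xc ?orbT // /g; case: eqP => // E.
    by rewrite -E xc in cc.
  + rewrite Ets; apply: eq_map_ren => x; have [_ N] := nf_fn H.
    move=> /N; rewrite mem_cat => /orP [xP|xc]; last first.
      rewrite hg ?inE ?mem_cat ?xc ?orbT // /g; case: eqP => // E.
      by rewrite -E xc in cc.
    have /orP [xP'|/eqP xc] := mem_fn_open1 xP.
      by rewrite hg ?inE ?mem_cat ?xP' ?orbT // gP //= fI // swP.
    by rewrite /= fI // xc swapL hg ?gc // inE eqxx.
Qed.

Lemma nfp_unique P cs ts cs' ts' : nfp P cs ts -> nfp P cs' ts' ->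
  exists f f', [/\ renaming f f', {in fn P, f =1 id},
    perm_eq (map f cs) cs' & perm_eq (map (ren f) ts) ts'].
Proof.
move=> [c0 [t0 [H C T]]] [c1 [t1 [H' C' T']]].
have [f [f' [R I Ec Et]]] := nf_unique H H'; exists f, f'; split=> //.
  by apply: perm_trans C'; rewrite Ec perm_map // perm_sym.
by apply: perm_trans T'; rewrite Et perm_map // perm_sym.
Qed.

End Threads.

(** Permutations of concatenations become linear equations between the counts of an arbitrary
    predicate. *)
Ltac perm_count :=
  let z := fresh "z" in
  apply/permP => z;
  repeat match goal with
  | H : is_true (perm_eq _ _) |- _ =>
      first [ generalize (elimT permP H z); clear H | clear H ]
  end;
  rewrite ?count_cat /= ?count_cat /=; clear; lia.

(** * Transitions read off normal forms *)

Section Transitions.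

Variable S : sorting.
Implicit Types (p q a b c : name S) (bs cs ds es L : seq (name S))
  (P Q G R : proc S) (ts us r : seq (proc S)) (mu : action S)
  (f g : name S -> name S).

Lemma perm_cat_cons (T : eqType) (ts us r : seq T) (G : T) : perm_eq (ts ++ us) (G :: r) ->
  (exists2 r1, perm_eq ts (G :: r1) & perm_eq r (r1 ++ us)) \/
  (exists2 r2, perm_eq us (G :: r2) & perm_eq r (ts ++ r2)).
Proof.
move=> H; have : G \in ts ++ us by rewrite (perm_mem H) inE eqxx.
rewrite mem_cat => /orP [Gt|Gu]; [left; exists (rem G ts)|right; exists (rem G us)].
- exact: perm_to_rem.
- by have := perm_to_rem Gt; move=> H1; perm_count.
- exact: perm_to_rem.
- by have := perm_to_rem Gu; move=> H1; perm_count.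
Qed.

Lemma perm_single (T : eqType) (x y : T) (r : seq T) :
  perm_eq [:: x] (y :: r) -> x = y /\ r = [::].
Proof.
move=> H; have /eqP := perm_size H; rewrite /= eqSS eq_sym => /nilP E; subst r.
by move/perm_mem: H => /(_ x); rewrite !inE eqxx => /esym /eqP.
Qed.

(** The derivative is described for every normal form of the residual thread with fresh restricted
    names, because these names are chosen only later. The following lemmas share this shape. *)
Lemma nf_act P cs ts : nf P cs ts -> process P -> forall G r mu G',
  perm_eq ts (G :: r) -> trans G mu G' -> ~~ is_out mu -> apart cs (act_names mu) ->
  exists P', trans P mu P' /\ forall ds us, nfp G' ds us -> apart ds (cs ++ fns ts) ->
    nfp P' (cs ++ ds) (us ++ r).
Proof.
elim=> {P cs ts}.
- by move=> _ G r mu G' /perm_size.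
- move=> P HP _ G r mu G' /perm_single [-> ->] H _ _; exists G'; split=> // ds us.
  by rewrite cats0.
- move=> P Q cs ds ts us HP IHP HQ IHQ A1 A2 A3 /andP [WP WQ] G r mu G' H Htr nout.
  rewrite apart_catl => /andP [B1 B2].
  have [N1 _] := nf_fn HP; have [N2 _] := nf_fn HQ.
  have bn0 X : disjoint_names (bn mu) X by case: (mu) nout.
  case: (perm_cat_cons H) => [[r1 H1 H2]|[r2 H1 H2]].
  + have [P' [K1 K2]] := IHP WP _ _ _ _ H1 Htr nout B1.
    exists (Par P' Q); split; first exact: T_parL.
    move=> es vs E; rewrite !apart_catr fns_cat apart_catr => /andP [/andP [E1 E2] /andP [E3 E4]].
    have X : nfp P' (cs ++ es) (vs ++ r1) by apply: K2; rewrite // apart_catr E1.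
    have := nfp_par X (nf_nfp HQ); rewrite apart_catl A1 apart_catl A3 E2 /=.
    have [F _] := trans_fn K1 WP; move=> Y; apply: nfp_perm (Y _ _ _).
    * by perm_count.
    * by perm_count.
    * exact: apart_subr E4.
    * by apply: apart_subr F _; rewrite apart_catr A2.
    * by [].
  + have [Q' [K1 K2]] := IHQ WQ _ _ _ _ H1 Htr nout B2.
    exists (Par P Q'); split; first exact: T_parR.
    move=> es vs E; rewrite !apart_catr fns_cat apart_catr => /andP [/andP [E1 E2] /andP [E3 E4]].
    have X : nfp Q' (ds ++ es) (vs ++ r2) by apply: K2; rewrite // apart_catr E2.
    have := nfp_par (nf_nfp HP) X.
    rewrite apart_catl A2 apart_catr A3 (apart_sym cs es) E1 /=.
    have [F _] := trans_fn K1 WQ; move=> Y; apply: nfp_perm (Y _ _ _).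
    * by perm_count.
    * by perm_count.
    * by apply: apart_subr F _; rewrite apart_catr A1.
    * exact: apart_subr E3.
    * by [].
- move=> c P cs ts cP HP IH cc; rewrite process_Nu => W G r mu G' H Htr nout.
  move=> /andP [cmu B]; have [P' [K1 K2]] := IH W _ _ _ _ H Htr nout B.
  exists (nu c P'); split; first exact: T_res.
  move=> es vs E; rewrite -cat1s -catA apart_catr => /andP [E1 E2].
  have [W' _] := trans_process K1 W.
  apply: nfp_nu => //; first exact: K2.
  rewrite mem_cat negb_or cc; move: E1; rewrite apart_sym /=.
  by rewrite andbT.
Qed.

Lemma nf_output P cs ts : nf P cs ts -> process P -> forall a bs r,
  perm_eq ts (Out (Free a) (map (@Free S) bs) :: r) -> a \notin cs ->
  exists ds cs' P', [/\ perm_eq cs (ds ++ cs'), trans P (AOut ds a bs) P',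
    nfp P' cs' r & apart cs' bs].
Proof.
elim=> {P cs ts}.
- by move=> _ a bs r /perm_size.
- move=> P HP _ a bs r /perm_single [-> ->] _; exists [::], [::], (Nil S).
  by split=> //; [exact: T_out | exact: nfp_nil].
- move=> P Q cs ds ts us HP IHP HQ IHQ A1 A2 A3 /andP [WP WQ] a bs r H.
  rewrite mem_cat negb_or => /andP [acs ads].
  have [N1 M1] := nf_fn HP; have [N2 M2] := nf_fn HQ.
  have inO (vs : seq (proc S)) : Out (Free a) (map (@Free S) bs) \in vs -> {subset a :: bs <= fns vs}.
    move=> Ov x xx; apply/flattenP; exists (fn (Out (Free a) (map (@Free S) bs))).
      exact: map_f.
    by rewrite fn_Out.
  case: (perm_cat_cons H) => [[r1 H1 H2]|[r2 H1 H2]].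
  + have [es [cs' [P' [K1 K2 K3 K4]]]] := IHP WP _ _ _ H1 acs.
    have sub : {subset a :: bs <= fn P ++ cs}.
      by move=> x /(inO ts) X; apply/M1/X; rewrite (perm_mem H1) inE eqxx.
    have Eapart : apart es (fn Q) && apart cs' (fn Q).
      by rewrite -apart_catl /apart -(perm_all _ K1).
    have [E1 E2] := andP Eapart.
    exists es, (cs' ++ ds), (Par P' Q); split.
    * by perm_count.
    * by apply: T_parL; rewrite //= -apart_disjoint.
    * apply: nfp_perm (nfp_par K3 (nf_nfp HQ) _ _ _) => //.
      - by rewrite perm_sym.
      - have [F _] := trans_fn K2 WP.
        apply: apart_subr F _; rewrite /= !apart_catr A2.
        have -> : apart ds es.
          by rewrite apart_sym; apply: apart_subl A3 => x; rewrite (perm_mem K1) mem_cat => ->.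
        apply: apart_subr sub _; rewrite apart_catr A2.
        by rewrite apart_sym.
      - by apply: apart_subl A3 => x; rewrite (perm_mem K1) mem_cat orbC => ->.
    * rewrite apart_catl K4; apply: (@apart_subr _ _ _ (fn P ++ cs)).
        by move=> x xb; apply: sub; rewrite inE xb orbT.
      by rewrite apart_catr A2 apart_sym.
  + have [es [ds' [Q' [K1 K2 K3 K4]]]] := IHQ WQ _ _ _ H1 ads.
    have sub : {subset a :: bs <= fn Q ++ ds}.
      by move=> x /(inO us) X; apply/M2/X; rewrite (perm_mem H1) inE eqxx.
    have Eapart : apart es (fn P) && apart ds' (fn P).
      by rewrite -apart_catl /apart -(perm_all _ K1).
    have [E1 E2] := andP Eapart.
    exists es, (cs ++ ds'), (Par P Q'); split.
    * by perm_count.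
    * by apply: T_parR; rewrite //= -apart_disjoint.
    * apply: nfp_perm (nfp_par (nf_nfp HP) K3 _ _ _) => //.
      - by rewrite perm_sym.
      - have [F _] := trans_fn K2 WQ.
        apply: apart_subr F _; rewrite /= !apart_catr A1.
        have -> : apart cs es.
          rewrite apart_sym in A3; rewrite apart_sym.
          by apply: apart_subl A3 => x; rewrite (perm_mem K1) mem_cat => ->.
        by apply: apart_subr sub _; rewrite apart_catr A1.
      - rewrite apart_sym in A3; rewrite apart_sym.
        by apply: apart_subl A3 => x; rewrite (perm_mem K1) mem_cat orbC => ->.
    * rewrite apart_catl K4 andbT; apply: (@apart_subr _ _ _ (fn Q ++ ds)).
        by move=> x xb; apply: sub; rewrite inE xb orbT.
      by rewrite apart_catr A1.
- move=> c P cs ts cP HP IH cc; rewrite process_Nu => W a bs r H.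
  rewrite inE negb_or => /andP [ac acs].
  have [ds [cs' [P' [K1 K2 K3 K4]]]] := IH W _ _ _ H acs.
  have [cds ccs'] : c \notin ds /\ c \notin cs'.
    by apply/andP; rewrite -negb_or -mem_cat -(perm_mem K1).
  have [cb|cb] := boolP (c \in bs).
  + exists (c :: ds), cs', P'; split=> //; first by rewrite /= perm_cons.
    by apply: (@T_open _ c P [::] ds) => //; rewrite eq_sym.
  + have [W' _] := trans_process K2 W.
    exists ds, (c :: cs'), (nu c P'); split.
    * by perm_count.
    * by apply: T_res => //; rewrite /= mem_cat inE !negb_or cds eq_sym ac cb.
    * exact: nfp_nu.
    * by rewrite /= cb.
Qed.

(** Sender and receiver lie on different sides of a parallel composition. Both orders of the
    residual are covered, so that either side may be the sender. *)
Lemma nf_comm_cross P Q cs ds ts us r1 r2 a bs G G' :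
  nf P cs ts -> nf Q ds us -> apart cs (fn Q) -> apart ds (fn P) -> apart cs ds ->
  process P -> process Q ->
  perm_eq ts (Out (Free a) (map (@Free S) bs) :: r1) -> perm_eq us (G :: r2) ->
  trans G (AIn a bs) G' ->
  exists es P' Q', [/\ trans P (AOut es a bs) P', trans Q (AIn a bs) Q',
    disjoint_names es (fn Q), process (Par P' Q') &
    forall ks vs, nfp G' ks vs -> apart ks (cs ++ ds ++ fns ts ++ fns us) ->
      nfp (nus es (Par P' Q')) (cs ++ ds ++ ks) (vs ++ r1 ++ r2) /\
      nfp (nus es (Par Q' P')) (cs ++ ds ++ ks) (vs ++ r1 ++ r2)].
Proof.
move=> HP HQ A1 A2 A3 WP WQ H1 H2 Htr.
have [N1 M1] := nf_fn HP; have [N2 M2] := nf_fn HQ.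
have [U1 F1] := nf_uniq HP; have [U2 F2] := nf_uniq HQ.
have WG : process G by case: (nfp_threads (nf_nfp HQ) WQ (_ : G \in us)); rewrite ?(perm_mem H2) ?inE ?eqxx.
have aG : a \in fn G by case: (trans_fn Htr WG).
have sub : {subset a :: bs <= fn P ++ cs}.
  move=> x xx; apply: M1; rewrite (fns_perm H1) fns_cons fn_Out mem_cat.
  by rewrite xx.
(* The receiver knows [a], so [a] is free in [Q] or restricted there; in both cases it is not
   restricted in [P]. *)
have acs : a \notin cs.
  have : a \in fn Q ++ ds.
    by apply: M2; rewrite (fns_perm H2) fns_cons mem_cat aG.
  rewrite mem_cat => /orP [aQ|ad]; apply/negP => ac.
    by move/apartP: A1 => /(_ _ ac); rewrite aQ.
  by move/apartP: A3 => /(_ _ ac); rewrite ad.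
have [es [cs' [P' [K1 K2 K3 K4]]]] := nf_output HP WP H1 acs.
have A4 : apart ds (a :: bs).
  by apply: (apart_subr sub); rewrite apart_catr A2 apart_sym A3.
have [Q' [L1 L2]] := nf_act HQ WQ H2 Htr isT A4.
have /andP [E1 E2] : apart es (fn Q) && apart cs' (fn Q).
  by rewrite -apart_catl /apart -(perm_all _ K1).
have /andP [E3 E4] : apart es ds && apart cs' ds.
  by rewrite -apart_catl /apart -(perm_all _ K1).
have [WP' _] := trans_process K2 WP; have [WQ' _] := trans_process L1 WQ.
have WPQ : process (Par P' Q') by apply/andP.
exists es, P', Q'; split=> //; first by rewrite -apart_disjoint.
move=> ks vs Hk; rewrite !apart_catr => /and4P [X1 X2 X3 X4].
have [G1 [Ga Gb Gc Gd _]] := trans_fn K2 WP; have [G2 _] := trans_fn L1 WQ.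
have csub : {subset cs' <= cs} by move=> x xc; rewrite (perm_mem K1) mem_cat xc orbT.
have esub : {subset es <= cs} by move=> x xc; rewrite (perm_mem K1) mem_cat xc.
have YQ : nfp Q' (ds ++ ks) (vs ++ r2) by apply: L2; rewrite // apart_catr X2.
have ksP : apart ks (fn P) by apply: apart_subr X3.
have B1 : apart cs' (fn Q').
  apply: apart_subr G2 _; rewrite apart_catr E2 /= -cat1s apart_catr K4 andbT.
  apply: (apart_subl csub); apply/apartP => x xc; rewrite inE.
  by apply: contraNneq acs => <-.
have B2 : apart (ds ++ ks) (fn P').
  have : {subset fn P' <= fn P ++ cs}.
    move=> x /G1; rewrite /= !mem_cat => /or3P [->|/esub ->|H]; rewrite ?orbT //.
    by have := sub x H; rewrite mem_cat.
  move=> sP; apply: apart_subr sP _; rewrite apart_catr !apart_catl A2 ksP X1.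
  by rewrite (apart_sym ds) A3.
have B3 : apart cs' (ds ++ ks).
  rewrite apart_catr E4 apart_sym.
  exact: apart_subr csub _.
have B4 : apart es (cs' ++ ds ++ ks).
  rewrite !apart_catr E3 (apart_sym es ks) (apart_subr esub X1) !andbT.
  move: U1; rewrite (perm_uniq K1) cat_uniq => /and3P [_ /hasPn D _].
  by rewrite apart_sym; apply/apartP.
have WQP : process (Par Q' P') by apply/andP.
have YP := nfp_par K3 YQ B1 B2 B3.
have YP' : nfp (Par Q' P') (cs' ++ ds ++ ks) (r1 ++ vs ++ r2).
  rewrite apart_sym in B3; apply: nfp_perm (nfp_par YQ K3 B2 B1 B3).
    by rewrite perm_catC.
  by rewrite perm_catC.
by split; [apply: nfp_perm (nfp_nus WPQ YP Gc B4) | apply: nfp_perm (nfp_nus WQP YP' Gc B4)];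
  perm_count.
Qed.

Lemma nf_comm P cs ts : nf P cs ts -> process P -> forall a bs G r G',
  perm_eq ts (Out (Free a) (map (@Free S) bs) :: G :: r) -> trans G (AIn a bs) G' ->
  exists P', red P P' /\ forall ds us, nfp G' ds us -> apart ds (cs ++ fns ts) ->
    nfp P' (cs ++ ds) (us ++ r).
Proof.
elim=> {P cs ts}.
- by move=> _ a bs G r G' /perm_size.
- by move=> P HP _ a bs G r G' /perm_size.
- move=> P Q cs ds ts us HP IHP HQ IHQ A1 A2 A3 /andP [WP WQ] a bs G r G' H Htr.
  have [N1 _] := nf_fn HP; have [N2 _] := nf_fn HQ.
  case: (perm_cat_cons H) => [[r1 H1 H2]|[r2 H1 H2]].
  + rewrite perm_sym in H2; case: (perm_cat_cons H2) => [[r3 H3 H4]|[r3 H3 H4]].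
    * have H5 : perm_eq ts (Out (Free a) (map (@Free S) bs) :: G :: r3) by perm_count.
      have [P' [K1 K2]] := IHP WP _ _ _ _ _ H5 Htr.
      exists (Par P' Q); split; first exact: T_parL.
      move=> es vs E; rewrite !apart_catr fns_cat apart_catr => /andP [/andP [E1 E2] /andP [E3 E4]].
      have X : nfp P' (cs ++ es) (vs ++ r3) by apply: K2; rewrite // apart_catr E1.
      have := nfp_par X (nf_nfp HQ); rewrite apart_catl A1 apart_catl A3 E2 /=.
      have [F _] := trans_fn K1 WP; move=> Y; apply: nfp_perm (Y _ _ _).
      - by perm_count.
      - by perm_count.
      - exact: apart_subr E4.
      - by apply: apart_subr F _; rewrite cats0.
      - by [].
    * have [es [P' [Q' [K1 K2 K3 K4 K5]]]] := nf_comm_cross HP HQ A1 A2 A3 WP WQ H1 H3 Htr.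
      exists (nus es (Par P' Q')); split; first exact: T_commL K1 K2 K3.
      move=> ks vs E; rewrite fns_cat -catA => E1.
      by apply: nfp_perm (K5 _ _ E E1).1; [rewrite -catA | perm_count].
  + rewrite perm_sym in H2; case: (perm_cat_cons H2) => [[r3 H3 H4]|[r3 H3 H4]].
    * rewrite apart_sym in A3.
      have [es [P' [Q' [K1 K2 K3 K4 K5]]]] := nf_comm_cross HQ HP A2 A1 A3 WQ WP H1 H3 Htr.
      exists (nus es (Par Q' P')); split; first exact: T_commR K2 K1 K3.
      move=> ks vs E E1; have E2 : apart ks (ds ++ cs ++ fns us ++ fns ts).
        apply: apart_subr E1 => x; rewrite fns_cat !mem_cat.
        by case/or4P => ->; rewrite ?orbT.
      by apply: nfp_perm (K5 _ _ E E2).2; perm_count.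
    * have H5 : perm_eq us (Out (Free a) (map (@Free S) bs) :: G :: r3) by perm_count.
      have [Q' [K1 K2]] := IHQ WQ _ _ _ _ _ H5 Htr.
      exists (Par P Q'); split; first exact: T_parR.
      move=> es vs E; rewrite !apart_catr fns_cat apart_catr => /andP [/andP [E1 E2] /andP [E3 E4]].
      have X : nfp Q' (ds ++ es) (vs ++ r3) by apply: K2; rewrite // apart_catr E2.
      have := nfp_par (nf_nfp HP) X.
      rewrite apart_catl A2 apart_catr A3 (apart_sym cs es) E1 /=.
      have [F _] := trans_fn K1 WQ; move=> Y; apply: nfp_perm (Y _ _ _).
      - by perm_count.
      - by perm_count.
      - by apply: apart_subr F _; rewrite cats0.
      - exact: apart_subr E3.
      - by [].
- move=> c P cs ts cP HP IH cc; rewrite process_Nu => W a bs G r G' H Htr.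
  have [P' [K1 K2]] := IH W _ _ _ _ _ H Htr.
  exists (nu c P'); split; first exact: T_res.
  move=> es vs E; rewrite -cat1s -catA apart_catr => /andP [E1 E2].
  have [W' _] := trans_process K1 W.
  apply: nfp_nu => //; first exact: K2.
  rewrite mem_cat negb_or cc; move: E1; rewrite apart_sym /=.
  by rewrite andbT.
Qed.

Lemma nfp_act P cs ts G r mu G' : nfp P cs ts -> process P ->
  perm_eq ts (G :: r) -> trans G mu G' -> ~~ is_out mu -> apart cs (act_names mu) ->
  exists P', trans P mu P' /\ forall ds us, nfp G' ds us -> apart ds (cs ++ fns ts) ->
    nfp P' (cs ++ ds) (us ++ r).
Proof.
move=> [c0 [t0 [H C T]]] W Hp Htr nout A.
have A0 : apart c0 (act_names mu) by rewrite /apart (perm_all _ C).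
have [P' [K1 K2]] := nf_act H W (perm_trans T Hp) Htr nout A0.
exists P'; split=> // ds us E Ad; apply: nfp_perm (K2 ds us E _) => //.
  by rewrite perm_cat2r.
by apply: apart_subr Ad => x; rewrite !mem_cat (perm_mem C) (fns_perm T).
Qed.

Lemma nfp_output P cs ts a bs r : nfp P cs ts -> process P ->
  perm_eq ts (Out (Free a) (map (@Free S) bs) :: r) -> a \notin cs ->
  exists ds cs' P', [/\ perm_eq cs (ds ++ cs'), trans P (AOut ds a bs) P',
    nfp P' cs' r & apart cs' bs].
Proof.
move=> [c0 [t0 [H C T]]] W Hp; rewrite -(perm_mem C) => ac.
have [ds [cs' [P' [K1 K2 K3 K4]]]] := nf_output H W (perm_trans T Hp) ac.
exists ds, cs', P'; split=> //; apply: perm_trans K1.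
by rewrite perm_sym.
Qed.

Lemma nfp_comm P cs ts a bs G r G' : nfp P cs ts -> process P ->
  perm_eq ts (Out (Free a) (map (@Free S) bs) :: G :: r) -> trans G (AIn a bs) G' ->
  exists P', red P P' /\ forall ds us, nfp G' ds us -> apart ds (cs ++ fns ts) ->
    nfp P' (cs ++ ds) (us ++ r).
Proof.
move=> [c0 [t0 [H C T]]] W Hp Htr.
have [P' [K1 K2]] := nf_comm H W (perm_trans T Hp) Htr.
exists P'; split=> // ds us E Ad; apply: nfp_perm (K2 ds us E _) => //.
  by rewrite perm_cat2r.
by apply: apart_subr Ad => x; rewrite !mem_cat (perm_mem C) (fns_perm T).
Qed.

(* The output consumed by a thread performing [mu]. *)
Definition feed mu : seq (proc S) :=
  if mu is AIn a bs then [:: Out (Free a) (map (@Free S) bs)] else [::].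

(** A uniform account of the two kinds of reductions: an empty feed is an internal step of a thread,
    a nonempty one is a communication. *)
Lemma nfp_red P cs ts mu G r G' : nfp P cs ts -> process P ->
  perm_eq ts (feed mu ++ G :: r) -> trans G mu G' -> ~~ is_out mu ->
  exists P', red P P' /\ forall ds us, nfp G' ds us -> apart ds (cs ++ fns ts) ->
    nfp P' (cs ++ ds) (us ++ r).
Proof.
case: mu => [|a bs|] //= H W Hp Htr _; last exact: nfp_comm Hp Htr.
by apply: (nfp_act H W Hp Htr) => //; apply/apartP.
Qed.

Lemma open_swap a a' P : a \notin fn P -> a' \notin fn P ->
  ren (swap a a') (open [:: a] P) = open [:: a'] P.
Proof.
move=> aP a'P; rewrite /open ren_open /= swapL ren_id // => x xP.
by apply: swap_out; apply: contraTneq xP => ->.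
Qed.

Lemma nu_swap a a' P : a.1 = a'.1 -> a' \notin fn (nu a P) ->
  nu a' (ren (swap a a') P) = nu a P.
Proof.
move=> E a'P; rewrite -[RHS](@ren_id _ (swap a a')).
  by rewrite ren_nu ?swapL //; [exact: swap_inj | exact: swap_sort].
move=> x xP; apply: swap_out.
  by apply: contraTneq xP => ->; rewrite fn_nu mem_filter /= eqxx.
by apply: contraTneq xP => ->.
Qed.

Lemma map_swap_id a a' cs : a \notin cs -> a' \notin cs -> map (swap a a') cs = cs.
Proof.
move=> H1 H2; apply: map_id_in => x xc; apply: swap_out.
  by apply: contraTneq xc => ->.
by apply: contraTneq xc => ->.
Qed.

Lemma nf_exists_p P L : exists cs ts, nfp P cs ts /\ apart cs L.
Proof. by have [cs [ts [/nf_nfp H A]]] := nf_exists P L; exists cs, ts. Qed.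

Lemma ren_Out f a bs : ren f (Out (Free a) (map (@Free S) bs)) =
  Out (Free (f a)) (map (@Free S) (map f bs)).
Proof. by rewrite /= map_Free_ren. Qed.

(** Converse of [nfp_output], for some normal form. It avoids a given [L] so that normal forms of
    parallel components can be joined. *)
Lemma trans_output_nf P ds a bs P' : trans P (AOut ds a bs) P' -> process P ->
  forall L, exists cs r, [/\
    nfp P (ds ++ cs) (Out (Free a) (map (@Free S) bs) :: r), nfp P' cs r & apart cs L].
Proof.
move E: (AOut ds a bs) => mu H; elim: H ds a bs E => {P mu P'} //.
- move=> a0 bs0 ds a bs [-> -> ->] W L; exists [::], [::]; split=> //.
    exact: nfp_thread.
  exact: nfp_nil.
- move=> a0 P mu P' H _ ds a bs E /and4P [_ _ G W]; rewrite -E in H.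
  by case: (guard_no_output H W G).
- move=> P Q mu P' H _ ds a bs E /and4P [G _ W _]; rewrite -E in H.
  by case: (guard_no_output H W G).
- move=> P Q mu P' H _ ds a bs E /and4P [_ G _ W]; rewrite -E in H.
  by case: (guard_no_output H W G).
- move=> P Q mu P' H IH D ds a bs E /andP [WP WQ] L; subst mu.
  have [cs [r [H1 H2 A]]] := IH _ _ _ erefl WP (L ++ fn Q).
  rewrite /= -apart_disjoint in D.
  have [es [us [H3 A3]]] := nf_exists_p Q (L ++ fn P ++ fn P' ++ ds ++ cs).
  move: A A3; rewrite !apart_catr => /andP [A1 A2] /and5P [B1 B2 B3 B4 B5].
  exists (cs ++ es), (r ++ us); split; last by rewrite apart_catl A1.
    have := nfp_par H1 H3; rewrite -catA; apply.
    + by rewrite apart_catl D.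
    + by [].
    + by rewrite apart_sym apart_catr B4.
  by apply: nfp_par => //; rewrite apart_sym.
- move=> P Q mu Q' H IH D ds a bs E /andP [WP WQ] L; subst mu.
  have [cs [r [H1 H2 A]]] := IH _ _ _ erefl WQ (L ++ fn P).
  rewrite /= -apart_disjoint in D.
  have [es [us [H3 A3]]] := nf_exists_p P (L ++ fn Q ++ fn Q' ++ ds ++ cs).
  move: A A3; rewrite !apart_catr => /andP [A1 A2] /and5P [B1 B2 B3 B4 B5].
  exists (cs ++ es), (r ++ us); split; last by rewrite apart_catl A1.
    apply: nfp_perm (nfp_par H3 H1 _ _ _); try by perm_count.
    + by [].
    + by rewrite apart_catl D.
    + by rewrite apart_catr B4.
  by apply: nfp_perm (nfp_par H3 H2 _ _ _) => //; perm_count.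
- move=> c P mu P' cP H IH cmu ds a bs E; rewrite process_Nu => W L; subst mu.
  have [W' _] := trans_process H W; have [F [Fa Fb Fc Fd Fe]] := trans_fn H W.
  have [cs [r [H1 H2 A]]] := IH _ _ _ erefl W (L ++ [:: c]).
  (* The name [c] picked by the derivation may lie in [L]; swapping it with a fresh [c'] changes
     only the representation of the restriction. *)
  have [c' [Ec]] := fresh_name c.1 (L ++ fn P ++ fn P' ++ [:: a] ++ ds ++ bs ++ cs).
  rewrite !mem_cat !negb_or => /and5P [C1 C2 C3 C5 /and3P [C6 C7 C8]].
  rewrite andbT in C5.
  move: cmu; rewrite /= mem_cat inE !negb_or => /and3P [D1 D2 D3].
  move: A; rewrite apart_catr => /andP [A1 A2].
  have ccs : c \notin cs by move: A2; rewrite apart_sym /= andbT.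
  have swS := swap_sort (esym Ec).
  exists (c' :: cs), (map (ren (swap c c')) r); split; last by rewrite /= C1.
    have := nfp_ren (swap_inj (a := c) (b := c')) swS H1.
    rewrite open_swap // map_swap_id ?mem_cat ?negb_or ?D1 ?C6 ?ccs //.
    rewrite map_cons ren_Out (swap_out (c := a)) 1?eq_sym // map_swap_id //.
    move=> X; rewrite -Ec; apply: nfp_perm (nfp_Nu C2 X _).
    - by perm_count.
    - by [].
    - by rewrite mem_cat negb_or C6.
  have := nfp_ren (swap_inj (a := c) (b := c')) swS H2.
  rewrite map_swap_id // => X.
  rewrite -(nu_swap (esym Ec)); last by rewrite fn_nu mem_filter negb_and C3 orbT.
  by apply: nfp_nu => //; rewrite process_ren.
- move=> c P cs1 cs2 a0 bs0 P' cP H IH ca cb cc ds a bs [-> -> ->]; rewrite process_Nu => W L.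
  have [cs [r [H1 H2 A]]] := IH _ _ _ erefl W (L ++ [:: c]).
  move: A; rewrite apart_catr => /andP [A1 A2].
  have ccs : c \notin cs by move: A2; rewrite apart_sym /= andbT.
  exists cs, r; split=> //; apply: nfp_perm (nfp_Nu cP H1 _).
  - by perm_count.
  - by [].
  - by rewrite mem_cat negb_or cc.
Qed.

Lemma fns_map f ts : fns (map (ren f) ts) = map f (fns ts).
Proof. by elim: ts => //= t ts IH; rewrite !fns_cons IH fn_ren map_cat. Qed.

Lemma ren_swapK a b P : ren (swap a b) (ren (swap a b) P) = P.
Proof. by rewrite ren_comp ren_id // => x _ /=; rewrite swapK. Qed.

Lemma map_ren_swapK a b ts : map (ren (swap a b)) (map (ren (swap a b)) ts) = ts.
Proof. by rewrite -map_comp -[RHS]map_id; apply: eq_map => t /=; apply: ren_swapK. Qed.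

(** The passage through a restriction, common to inputs and reductions: a swap with a fresh [c']
    moves the normal form away from [L] and transports the description of the derivative. *)
Lemma nf_res_step c P P1 mu cs fd G r G' L : c \notin fn P -> process (open [:: c] P) ->
  trans (open [:: c] P) mu P1 ->
  nfp (open [:: c] P) cs (fd ++ G :: r) -> apart cs (L ++ [:: c]) ->
  (forall ds us, nfp G' ds us -> apart ds (cs ++ fns (fd ++ G :: r)) ->
     nfp P1 (cs ++ ds) (us ++ r)) ->
  exists c', let h := map (ren (swap c c')) in
    [/\ c.1 = c'.1, c' \notin L, apart (c' :: cs) L,
      nfp (Nu c.1 P) (c' :: cs) (h fd ++ ren (swap c c') G :: h r) &
      forall ds us, nfp (ren (swap c c') G') ds us ->
        apart ds (c' :: cs ++ fns (h fd ++ ren (swap c c') G :: h r)) ->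
        nfp (nu c P1) (c' :: cs ++ ds) (us ++ h r)].
Proof.
move=> cP W Htr H; rewrite apart_catr => /andP [A1 A2] K.
have [W1 _] := trans_process Htr W.
have ccs : c \notin cs by move: A2; rewrite apart_sym /= andbT.
have [c' [Ec]] := fresh_name c.1 (L ++ fn P ++ fn P1 ++ cs).
rewrite !mem_cat !negb_or => /and4P [C1 C2 C3 C4].
have sS := swap_sort (esym Ec); have sI := @swap_inj _ c c'.
exists c'; rewrite /=; split=> //.
- by rewrite C1.
- have := nfp_ren sI sS H; rewrite open_swap // map_swap_id // map_cat /= => X.
  by rewrite -Ec; apply: nfp_Nu.
- move=> ds us Hd; rewrite -cat1s !apart_catr => /and3P [D1 D2 D3].
  have Hd' := nfp_ren sI sS Hd; rewrite ren_swapK in Hd'.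
  have X : nfp P1 (cs ++ map (swap c c') ds) (map (ren (swap c c')) us ++ r).
    apply: K Hd' _; rewrite -(apart_map _ _ sI) -map_comp.
    rewrite (eq_map (g := id)) ?map_id; last by move=> x /=; rewrite swapK.
    by rewrite map_cat map_swap_id // -fns_map map_cat apart_catr D2.
  have := nfp_ren sI sS X; rewrite !map_cat map_swap_id // map_ren_swapK -map_comp.
  rewrite (eq_map (g := id)) ?map_id => [Y|x /=]; last by rewrite swapK.
  rewrite -(nu_swap (esym Ec)); last by rewrite fn_nu mem_filter negb_and C3 orbT.
  apply: nfp_nu => //; first by rewrite process_ren.
  by rewrite mem_cat negb_or C4; move: D1; rewrite apart_sym /= andbT.
Qed.

Lemma trans_input_nf P a bs P' : trans P (AIn a bs) P' -> process P ->
  forall L, exists cs G r G', [/\ nfp P cs (G :: r), trans G (AIn a bs) G', apart cs L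
    & forall ds us, nfp G' ds us -> apart ds (cs ++ fns (G :: r)) ->
        nfp P' (cs ++ ds) (us ++ r)].
Proof.
move E: (AIn a bs) => mu H; elim: H E => {P mu P'} //.
- move=> a0 ss P bs0 Ess _ W L; exists [::], (In (Free a0) ss P), [::], (open bs0 P).
  split=> //; [exact: nfp_thread | exact: T_in | by move=> *; rewrite cats0].
- move=> a0 ss P bs0 Ess _ W L.
  exists [::], (Rep (Free a0) ss P), [::], (Par (open bs0 P) (Rep (Free a0) ss P)).
  split=> //; [exact: nfp_thread | exact: T_rep | by move=> *; rewrite cats0].
- move=> a0 P mu P' H _ E W L; exists [::], (Match (Free a0) (Free a0) P), [::], P'.
  split=> //; [exact: nfp_thread | exact: T_match | by move=> *; rewrite cats0].
- move=> P Q mu P' H _ E W L; exists [::], (Sum P Q), [::], P'.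
  split=> //; [exact: nfp_thread | exact: T_sumL | by move=> *; rewrite cats0].
- move=> P Q mu P' H _ E W L; exists [::], (Sum P Q), [::], P'.
  split=> //; [exact: nfp_thread | exact: T_sumR | by move=> *; rewrite cats0].
- move=> P Q mu P' H IH _ E /andP [WP WQ] L; subst mu.
  have [cs [G [r [G' [H1 H2 A K]]]]] := IH erefl WP (L ++ fn Q).
  have [es [us [H3 A3]]] := nf_exists_p Q (L ++ fn P ++ fn P' ++ cs).
  move: A A3; rewrite !apart_catr => /andP [A1 A2] /and4P [B1 B2 B3 B4].
  exists (cs ++ es), G, (r ++ us), G'; split=> //; last 1 first.
    move=> ds vs Hd; rewrite -cat_cons fns_cat 3!apart_catr => /andP [/andP [D1 D2] /andP [D3 D4]].
    have X : nfp P' (cs ++ ds) (vs ++ r) by apply: K; rewrite // apart_catr D1.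
    apply: nfp_perm (nfp_par X H3 _ _ _); [by perm_count | by perm_count | | by [] |].
      by rewrite apart_catl A2; apply: apart_subr D4; case: (nfp_fn H3).
    by rewrite apart_catl D2 apart_sym B4.
  + by rewrite -cat_cons; apply: nfp_par; rewrite // apart_sym.
  + by rewrite apart_catl A1.
- move=> P Q mu Q' H IH _ E /andP [WP WQ] L; subst mu.
  have [cs [G [r [G' [H1 H2 A K]]]]] := IH erefl WQ (L ++ fn P).
  have [es [us [H3 A3]]] := nf_exists_p P (L ++ fn Q ++ fn Q' ++ cs).
  move: A A3; rewrite !apart_catr => /andP [A1 A2] /and4P [B1 B2 B3 B4].
  exists (cs ++ es), G, (r ++ us), G'; split=> //; last 1 first.
    move=> ds vs Hd; rewrite -cat_cons fns_cat 3!apart_catr => /andP [/andP [D1 D2] /andP [D3 D4]].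
    have X : nfp Q' (cs ++ ds) (vs ++ r) by apply: K; rewrite // apart_catr D1.
    apply: nfp_perm (nfp_par H3 X _ _ _); [by perm_count | by perm_count | by [] | |].
      by rewrite apart_catl A2; apply: apart_subr D4; case: (nfp_fn H3).
    by rewrite apart_catr B4 apart_sym.
  + by apply: nfp_perm (nfp_par H3 H1 _ _ _) => //; perm_count.
  + by rewrite apart_catl A1.
- move=> c P mu P' cP H IH cmu E; rewrite process_Nu => W L; subst mu.
  have [cs [G [r [G' [H1 H2 A K]]]]] := IH erefl W ((L ++ a :: bs) ++ [:: c]).
  have [c' /= [Ec C1 C2 H3 K']] := nf_res_step (fd := [::]) cP W H H1 A K.
  exists (c' :: cs), (ren (swap c c') G), (map (ren (swap c c')) r), (ren (swap c c') G').
  split=> //.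
  + have := trans_ren (@swap_inj _ c c') (swap_sort Ec) H2; rewrite /=.
    move: C1 cmu; rewrite /= mem_cat !inE !negb_or => /and3P [_ C3 C4] /andP [C5 C6].
    by rewrite swap_out 1?eq_sym ?map_swap_id // eq_sym.
  + by move: C2; rewrite -[_ && _]/(apart (c' :: cs) _) apart_catr => /andP [].
Qed.

(** A communication binds the extruded names again, so renaming them yields the very same
    process. *)
Lemma comm_fresh P Q cs a bs P' Q' L : trans P (AOut cs a bs) P' ->
  trans Q (AIn a bs) Q' -> disjoint_names cs (fn Q) -> process P -> process Q ->
  exists ds bs' P1 Q1, [/\ trans P (AOut ds a bs') P1, trans Q (AIn a bs') Q1,
    apart ds (L ++ fn Q), nus cs (Par P' Q') = nus ds (Par P1 Q1)
    & nus cs (Par Q' P') = nus ds (Par Q1 P1)].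
Proof.
move=> HP HQ /disjointP D WP WQ.
have [F1 [Fa Fb Fc Fd Fe]] := trans_fn HP WP; have [F2 _] := trans_fn HQ WQ.
have fr : {in cs, forall c, c \notin fn P ++ fn Q}.
  by move=> c cc; rewrite mem_cat negb_or Fe // D.
have [f [f' [R I A]]] := fresh_renaming (L ++ fn Q) Fc fr.
have [fI fS] := (renaming_inj R, renaming_sort R).
have idP : ren f P = P by apply: ren_id => x xP; apply: I; rewrite mem_cat xP.
have idQ : ren f Q = Q by apply: ren_id => x xP; apply: I; rewrite mem_cat xP orbT.
have fa : f a = a by apply: I; rewrite mem_cat Fa.
have bsub x : x \in bs -> x \notin cs -> x \in fn P.
  by move=> /Fb; rewrite mem_cat => /orP [] // ->.
have sub x : (x \in fn P') || (x \in fn Q') -> x \notin cs -> x \in fn P ++ fn Q.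
  have bx := bsub x; have ax : (x == a) -> (x \in fn P) by move/eqP->.
  by case/orP => [/F1|/F2]; move: bx ax; memb.
exists (map f cs), (map f bs), (ren f P'), (ren f Q'); split.
- by have := trans_ren fI fS HP; rewrite /= idP fa.
- by have := trans_ren fI fS HQ; rewrite /= idQ fa.
- by apply/apartP => _ /mapP [c cc ->]; apply: A.
- rewrite -[RHS]/(nus (map f cs) (ren f (Par P' Q'))) nus_alpha // => x.
  by rewrite mem_fn_nus /= mem_cat => /andP [H xc]; apply/I/sub.
- rewrite -[RHS]/(nus (map f cs) (ren f (Par Q' P'))) nus_alpha // => x.
  by rewrite mem_fn_nus /= mem_cat orbC => /andP [H xc]; apply/I/sub.
Qed.

Lemma feed_ren f mu : map (ren f) (feed mu) = feed (ren_act f mu).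
Proof. by case: mu => // a bs; rewrite /= map_Free_ren. Qed.

Lemma nfp_parC P Q cs ts : nfp (Par P Q) cs ts -> nfp (Par Q P) cs ts.
Proof.
move=> [c0 [t0 [H C T]]]; move: H C T; move E: (Par P Q) => R H.
case: H E; [by [] | by move=> R0 + E; rewrite -E | | by []].
move=> P0 Q0 c d t u HP HQ A1 A2 A3 [-> ->] C T.
exists (d ++ c), (u ++ t); split; [|by perm_count|by perm_count].
by apply: NF_par; rewrite // apart_sym.
Qed.

Lemma trans_comm_nf P Q cs a bs P' Q' L : trans P (AOut cs a bs) P' ->
  trans Q (AIn a bs) Q' -> disjoint_names cs (fn Q) -> process P -> process Q ->
  exists ns bs' G r G', let nu := AIn a bs' in
  [/\ nfp (Par P Q) ns (feed nu ++ G :: r), trans G nu G', apart ns L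
    & forall ds us, nfp G' ds us -> apart ds (ns ++ fns (feed nu ++ G :: r)) ->
        nfp (nus cs (Par P' Q')) (ns ++ ds) (us ++ r) /\
        nfp (nus cs (Par Q' P')) (ns ++ ds) (us ++ r)].
Proof.
move=> HP HQ D WP WQ.
have [ds [bs' [P1 [Q1 [HP1 HQ1 A -> ->]]]]] := comm_fresh L HP HQ D WP WQ.
have [WP1 _] := trans_process HP1 WP; have [WQ1 _] := trans_process HQ1 WQ.
have [_ [_ _ Uds _ _]] := trans_fn HP1 WP.
have [cs1 [r1 [H1 H2 A1]]] := trans_output_nf HP1 WP (L ++ fn Q ++ fn Q1).
have [cs2 [G [r2 [G' [H3 H4 A2 K]]]]] :=
  trans_input_nf HQ1 WQ (L ++ fn P ++ fn P1 ++ ds ++ cs1).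
move: A A1 A2; rewrite !apart_catr.
move=> /andP [A1 A2] /and3P [B1 B2 B3] /and5P [C1 C2 C3 C4 C5].
exists (ds ++ cs1 ++ cs2), bs', G, (r1 ++ r2), G'; split=> //.
- apply: nfp_perm (nfp_par H1 H3 _ _ _).
  + by rewrite catA.
  + by perm_count.
  + by rewrite apart_catl A2.
  + by [].
  + by rewrite apart_sym apart_catr C4.
- by rewrite !apart_catl A1 B1.
- move=> es us Hes; rewrite -!catA 3!apart_catr => /and4P [E1 E2 E3 E4].
  have E5 : apart es (fns (G :: r2)).
    apply: apart_subr E4 => x; rewrite !(fns_cons, fns_cat, mem_cat).
    by case/orP => ->; rewrite !orbT.
  have E6 : apart es (fn P1).
    have [F _] := nfp_fn H2; apply: apart_subr E4 => x /F.
    by rewrite !(fns_cons, fns_cat, mem_cat) => ->; rewrite !orbT.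
  have X : nfp Q1 (cs2 ++ es) (us ++ r2) by apply: K; rewrite // apart_catr E3.
  have Y : nfp (Par P1 Q1) (cs1 ++ cs2 ++ es) (r1 ++ us ++ r2).
    apply: nfp_par H2 X B3 _ _; first by rewrite apart_catl C3.
    by rewrite apart_sym apart_catl C5.
  have dA : apart ds (cs1 ++ cs2 ++ es).
    rewrite !apart_catr !(apart_sym ds) C4 E1 !andbT.
    have [U _] := nfp_uniq H1; move: U; rewrite cat_uniq => /and3P [_ /hasPn H _].
    by apply/apartP.
  have WPQ : process (Par P1 Q1) by apply/andP.
  have WQP : process (Par Q1 P1) by apply/andP.
  by split; [apply: nfp_perm (nfp_nus WPQ Y Uds dA) |
    apply: nfp_perm (nfp_nus WQP (nfp_parC Y) Uds dA)]; perm_count.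
Qed.

Lemma trans_red_nf P P' : red P P' -> process P -> forall L, exists cs nu G r G',
  [/\ nfp P cs (feed nu ++ G :: r), trans G nu G', ~~ is_out nu, apart cs L
    & forall ds us, nfp G' ds us -> apart ds (cs ++ fns (feed nu ++ G :: r)) ->
        nfp P' (cs ++ ds) (us ++ r)].
Proof.
rewrite /red; move E: (ATau S) => mu H.
have thr P0 P0' L : trans P0 (ATau S) P0' -> is_thread P0 -> exists cs nu G r G',
    [/\ nfp P0 cs (feed nu ++ G :: r), trans G nu G', ~~ is_out nu, apart cs L
    & forall ds us, nfp G' ds us -> apart ds (cs ++ fns (feed nu ++ G :: r)) ->
        nfp P0' (cs ++ ds) (us ++ r)].
  move=> H1 H2; exists [::], (ATau S), P0, [::], P0'; split=> //.
    exact: nfp_thread.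
  by move=> *; rewrite cats0.
elim: H E => {P mu P'} //.
- by move=> P _ W L; apply: thr => //; apply: T_tau.
- by move=> a0 P mu P' H _ E W L; subst mu; apply: thr => //; apply: T_match.
- by move=> P Q mu P' H _ E W L; subst mu; apply: thr => //; apply: T_sumL.
- by move=> P Q mu P' H _ E W L; subst mu; apply: thr => //; apply: T_sumR.
- move=> P Q mu P' H IH _ E /andP [WP WQ] L; subst mu.
  have [cs [nu [G [r [G' [H1 H2 N A K]]]]]] := IH erefl WP (L ++ fn Q).
  have [es [us [H3 A3]]] := nf_exists_p Q (L ++ fn P ++ fn P' ++ cs).
  move: A A3; rewrite !apart_catr => /andP [A1 A2] /and4P [B1 B2 B3 B4].
  exists (cs ++ es), nu, G, (r ++ us), G'; split=> //; last 1 first.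
    move=> ds vs Hd; rewrite -cat_cons catA fns_cat 3!apart_catr => /andP [/andP [D1 D2] /andP [D3 D4]].
    have X : nfp P' (cs ++ ds) (vs ++ r) by apply: K; rewrite // apart_catr D1.
    apply: nfp_perm (nfp_par X H3 _ _ _); [by perm_count | by perm_count | | by [] |].
      by rewrite apart_catl A2; apply: apart_subr D4; case: (nfp_fn H3).
    by rewrite apart_catl D2 apart_sym B4.
  + by rewrite -cat_cons catA; apply: nfp_par; rewrite // apart_sym.
  + by rewrite apart_catl A1.
- move=> P Q mu Q' H IH _ E /andP [WP WQ] L; subst mu.
  have [cs [nu [G [r [G' [H1 H2 N A K]]]]]] := IH erefl WQ (L ++ fn P).
  have [es [us [H3 A3]]] := nf_exists_p P (L ++ fn Q ++ fn Q' ++ cs).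
  move: A A3; rewrite !apart_catr => /andP [A1 A2] /and4P [B1 B2 B3 B4].
  exists (cs ++ es), nu, G, (r ++ us), G'; split=> //; last 1 first.
    move=> ds vs Hd; rewrite -cat_cons catA fns_cat 3!apart_catr => /andP [/andP [D1 D2] /andP [D3 D4]].
    have X : nfp Q' (cs ++ ds) (vs ++ r) by apply: K; rewrite // apart_catr D1.
    apply: nfp_perm (nfp_par H3 X _ _ _); [by perm_count | by perm_count | by [] | |].
      by rewrite apart_catl A2; apply: apart_subr D4; case: (nfp_fn H3).
    by rewrite apart_catr B4 apart_sym.
  + by apply: nfp_perm (nfp_par H3 H1 _ _ _) => //; perm_count.
  + by rewrite apart_catl A1.
- move=> P Q cs a bs P' Q' HP _ HQ _ D _ /andP [WP WQ] L.
  have [ns [bs' [G [r [G' /= [H1 H2 H3 H4]]]]]] := trans_comm_nf L HP HQ D WP WQ.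
  exists ns, (AIn a bs'), G, r, G'; split=> // ds us E1 E2.
  by case: (H4 _ _ E1 E2).
- move=> P Q cs a bs P' Q' HP _ HQ _ D _ /andP [WP WQ] L.
  have [ns [bs' [G [r [G' /= [H1 H2 H3 H4]]]]]] := trans_comm_nf L HQ HP D WQ WP.
  exists ns, (AIn a bs'), G, r, G'; split=> //; first exact: nfp_parC.
  by move=> ds us E1 E2; case: (H4 _ _ E1 E2).
- move=> c P mu P' cP H IH cmu E; rewrite process_Nu => W L; subst mu.
  have [cs [nu [G [r [G' [H1 H2 N A K]]]]]] := IH erefl W (L ++ [:: c]).
  have [c' /= [Ec C1 C2 H3 K']] := nf_res_step cP W H H1 A K.
  exists (c' :: cs), (ren_act (swap c c') nu), (ren (swap c c') G),
    (map (ren (swap c c')) r), (ren (swap c c') G').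
  rewrite -feed_ren; split=> //.
  + exact: trans_ren (@swap_inj _ c c') (swap_sort Ec) H2.
  + by case: (nu) N.
Qed.

Lemma map_renamingK f g cs : renaming f g -> map f (map g cs) = cs.
Proof. by case=> _ gK _; rewrite -map_comp -[RHS]map_id; apply: eq_map => x /=; rewrite gK. Qed.

Lemma ren_renamingK f g P : renaming f g -> ren f (ren g P) = P.
Proof. by case=> _ gK _; rewrite ren_comp ren_id // => x _ /=; rewrite gK. Qed.

Lemma map_ren_renamingK f g ts : renaming f g -> map (ren f) (map (ren g) ts) = ts.
Proof.
by move=> R; rewrite -map_comp -[RHS]map_id; apply: eq_map => t; apply: ren_renamingK.
Qed.

Lemma is_out_ren f mu : is_out (ren_act f mu) = is_out mu.
Proof. by case: mu. Qed.

(** The normal form read off the derivation is carried to the given one by [nfp_unique]. The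
    bijection fixes the free names of [P], hence those of [P'], so it leaves [P'] unchanged. *)
Theorem red_nfp P cs ts P' : nfp P cs ts -> process P -> red P P' ->
  exists nu G r G', [/\ perm_eq ts (feed nu ++ G :: r), trans G nu G', ~~ is_out nu
    & forall ds us, nfp G' ds us -> apart ds (cs ++ fns ts) ->
        nfp P' (cs ++ ds) (us ++ r)].
Proof.
move=> H W Hred; have [c0 [nu [G [r [G' [H0 Htr N _ K]]]]]] := trans_red_nf Hred W [::].
have [f [f' [R I C T]]] := nfp_unique H0 H.
have [fI fS] := (renaming_inj R, renaming_sort R).
have [fI' fS'] := (renaming_inj (renaming_inv R), renaming_sort (renaming_inv R)).
have R' := renaming_inv R.
exists (ren_act f nu), (ren f G), (map (ren f) r), (ren f G'); split.
- by rewrite -feed_ren perm_sym; move: T; rewrite map_cat.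
- exact: trans_ren.
- by rewrite is_out_ren.
- move=> ds us Hd A; have Hd' := nfp_ren fI' fS' Hd.
  rewrite (ren_renamingK _ R') in Hd'.
  have A' : apart (map f' ds) (c0 ++ fns (feed nu ++ G :: r)).
    rewrite -(apart_map _ _ fI) (map_renamingK _ R) map_cat -fns_map.
    by apply: apart_subr A => x; rewrite !mem_cat (perm_mem C) (fns_perm T).
  have := nfp_ren fI fS (K _ _ Hd' A').
  rewrite !map_cat (map_renamingK _ R) (map_ren_renamingK _ R) (@ren_id _ f P') => [X|].
    by apply: nfp_perm X => //; rewrite perm_cat2r.
  move=> x /(proj1 (trans_fn Hred W)); rewrite cats0.
  exact: I.
Qed.

(** Only the subject is determined, which is all that a barb observes; the object depends on the
    choice of the restricted names. *)
Theorem output_nfp P cs ts ds a bs P' : nfp P cs ts -> process P ->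
  trans P (AOut ds a bs) P' ->
  a \notin cs /\ exists bs', Out (Free a) (map (@Free S) bs') \in ts.
Proof.
move=> H W Htr; have [c0 [r [H0 _ _]]] := trans_output_nf Htr W [::].
have [f [f' [R I C T]]] := nfp_unique H0 H.
have [_ [aP _ _ _ _]] := trans_fn Htr W; have [_ A] := nfp_uniq H.
split; first by apply/negP => ac; move/apartP: A => /(_ _ ac); rewrite aP.
exists (map f bs); rewrite -(perm_mem T) map_cons ren_Out inE I //.
by rewrite eqxx.
Qed.

End Transitions.

(** * Delaying the transmission of continuations *)

Section Expansion.

Variable S : sorting.
Implicit Types (s t u : stack S) (p q a b c : name S) (bs cs ds es L : seq (name S))
  (P Q R U : proc S) (ts us r : seq (proc S)) (mu : action S)
  (f g : name S -> name S) (G : seq (seq S)) (v : var S).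

(** Turns a reordering of threads into a reordering of the pairs from which they are projected. *)
Lemma perm_map_lift (T1 T2 : eqType) (h : T1 -> T2) (x : seq T1) (y : seq T2) :
  perm_eq (map h x) y -> exists2 x', perm_eq x x' & map h x' = y.
Proof.
elim: y x => [|b y IH] x H.
  exists [::] => //; move/perm_size: H; rewrite size_map.
  by case: x.
have : b \in map h x by rewrite (perm_mem H) inE eqxx.
case/mapP => a ax Eb; have Hx := perm_to_rem ax.
have H' : perm_eq (map h (rem a x)) y.
  rewrite -(perm_cons b) -(permPr H) {1}Eb -map_cons perm_map // perm_sym //.
have [x' H1 H2] := IH _ H'; exists (a :: x'); last by rewrite /= H2 Eb.
by apply: perm_trans Hx _; rewrite perm_cons.
Qed.

(** The last clause serves the induction: tags on the two sides of a parallel composition differ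
    because the visible ones are split by the interleaving, and the others have names restricted on
    one side only. *)
Lemma nf_linear P cs ts : nf P cs ts -> forall s, typ s P -> process P ->
  exists tts : seq (stack S * proc S), [/\ map snd tts = ts,
    forall x, x \in tts -> typ x.1 x.2, uniq (flatten (map fst tts))
    & forall e, e \in flatten (map fst tts) -> (e \in s) || (e.1 \in cs)].
Proof.
elim=> {P cs ts}.
- by move=> s _ _; exists [::].
- move=> P HP s T W; exists [:: (s, P)]; split=> //= [x||e].
  + by rewrite inE => /eqP ->.
  + by rewrite cats0; apply: stk_uniq (typ_stk T).
  + by rewrite cats0 => ->.
- move=> P Q cs ds ts us HP IHP HQ IHQ A1 A2 A3 u T /andP [WP WQ].
  have [s [t [TP TQ H Hu]]] := typ_Par_inv T.
  have [x [E1 X1 U1 S1]] := IHP _ TP WP; have [y [E2 X2 U2 S2]] := IHQ _ TQ WQ.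
  exists (x ++ y); rewrite map_cat E1 E2 map_cat flatten_cat; split=> //.
  + by move=> z; rewrite mem_cat => /orP [/X1|/X2].
  + rewrite cat_uniq U1 U2 andbT; apply/hasPn => e ey; apply/negP => ex.
    have fnQ z : z \in t -> z.1 \in fn Q.
      move=> zt; rewrite (typ_fn TQ WQ) ?(stk_cont (typ_stk TQ) zt) //.
      exact: map_f.
    have fnP z : z \in s -> z.1 \in fn P.
      move=> zt; rewrite (typ_fn TP WP) ?(stk_cont (typ_stk TP) zt) //.
      exact: map_f.
    case/orP: (S1 _ ex) => es; case/orP: (S2 _ ey) => et.
    * have := stk_uniq Hu; rewrite (perm_uniq (shuffle_perm H)) cat_uniq.
      by case/and3P => _ /hasPn /(_ _ et); rewrite /= es.
    * by move/apartP: A2 => /(_ _ et); rewrite fnP.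
    * by move/apartP: A1 => /(_ _ es); rewrite fnQ.
    * by move/apartP: A3 => /(_ _ es); rewrite et.
  + move=> e; rewrite !mem_cat (shuffle_mem H) mem_cat.
    by case/orP => [/S1|/S2] /orP [] ->; rewrite ?orbT.
- move=> c P cs ts cP HP IH cc s T W.
  have [s0 T0 Hnu] := typ_Nu_inv T W cP; rewrite process_Nu in W.
  have [x [E1 X1 U1 S1]] := IH _ T0 W; exists x; split=> // e /S1.
  rewrite inE => /orP [es|->]; last by rewrite !orbT.
  by have [->|ec] := eqVneq e.1 c; rewrite ?orbT // (nu_stack_mem Hnu es ec).
Qed.

Lemma nfp_linear P cs ts s : nfp P cs ts -> typ s P -> process P ->
  exists tts : seq (stack S * proc S), [/\ map snd tts = ts,
    forall x, x \in tts -> typ x.1 x.2 & uniq (flatten (map fst tts))].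
Proof.
move=> [c0 [t0 [H C T]]] Ts W; have [x [E1 X1 U1 S1]] := nf_linear H Ts W.
have [|y H1 H2] := @perm_map_lift _ _ snd x ts; first by rewrite E1.
exists y; split=> //; first by move=> z; rewrite -(perm_mem H1); apply: X1.
by rewrite -(perm_uniq (perm_flatten (perm_map fst H1))).
Qed.

Definition lbody p n : proc S := Out (Free p) [seq Bound S 0 j | j <- iota 0 n].

Lemma openv_iota bs : map (openv 0 bs) [seq Bound S 0 j | j <- iota 0 (size bs)] =
  map (@Free S) bs.
Proof.
rewrite -map_comp; case: bs => [|b0 bs] //.
apply: (@eq_from_nth _ (Free b0)); rewrite !size_map size_iota // => i lt_i.
rewrite (nth_map 0) ?size_iota // nth_iota // (nth_map b0) //= add0n.
by rewrite onthE (nth_map b0).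
Qed.

Lemma link_trans q p bs : q.1 = p.1 -> map fst bs = obj q.1 ->
  trans (link q p) (AIn q bs) (Out (Free p) (map (@Free S) bs)).
Proof.
move=> _ E; rewrite /link -E size_map.
have := @T_in S q _ (lbody p (size bs)) bs erefl.
by rewrite /open /= openv_iota.
Qed.

Lemma link_trans_inv q p nu R : trans (link q p) nu R -> exists bs,
  [/\ nu = AIn q bs, map fst bs = obj q.1 & R = Out (Free p) (map (@Free S) bs)].
Proof.
rewrite /link; move E: (In _ _ _) => X H; case: H E => // a ss P bs Ess [<- E1 E2].
exists bs; split=> //; first by rewrite Ess E1.
by rewrite -E2 /open /= E1 -Ess size_map openv_iota.
Qed.

Lemma fnv_Bounds n : flatten [seq fnv i | i <- [seq Bound S 0 j | j <- iota 0 n]] = [::].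
Proof. by rewrite -map_comp; elim: (iota 0 n). Qed.

Lemma fn_link q p : fn (link q p) = [:: q; p].
Proof. by rewrite /= fnv_Bounds. Qed.

Lemma map_vsort_Bounds (ss : seq S) G :
  map (vsort (ss :: G)) [seq Bound S 0 j | j <- iota 0 (size ss)] = map Some ss.
Proof.
rewrite -map_comp; case: ss => [|s0 ss] //.
apply: (@eq_from_nth _ (Some s0)); rewrite !size_map size_iota // => i lt_i.
by rewrite (nth_map 0) ?size_iota // nth_iota // add0n /= onthE;
  apply: set_nth_default; rewrite /= size_map.
Qed.

Lemma process_link q p : q.1 = p.1 -> process (link q p).
Proof.
move=> E; rewrite /link process_In eqxx /=.
by rewrite map_vsort_Bounds -E eqxx.
Qed.

Lemma typ_link q p : cont q -> q.1 = p.1 -> p != q -> typ [:: (q, TI); (p, TO)] (link q p).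
Proof.
move=> cq E pq; have cp : cont p by rewrite -(cont_sort E).
have [bs [E' U fr]] := fresh_tuple (obj q.1) [:: p].
apply: (@TY_inp _ q p (obj q.1) bs) => //.
- apply: fresh_namesI => // b /fr; rewrite /= fnv_Bounds.
  by [].
- rewrite /open /= -E' size_map openv_iota; exact: TY_outp.
Qed.

(** The stack lists exactly the free continuations, so the output tag chosen by the derivation must
    be that of [p]. *)
Lemma typ_link_inv s q p : cont q -> q.1 = p.1 -> typ s (link q p) ->
  s = [:: (q, TI); (p, TO)] /\ p != q.
Proof.
move=> cq E T; have W := process_link E.
have [bs [E' U fr]] := fresh_tuple (obj q.1) [::].
have [_ [s1 H T1]] := typ_In_inv T W E'.
have cp : cont p by rewrite -(cont_sort E).
move: T; rewrite /link; move EQ: (In _ _ _) => X T; case: T EQ => // {X}.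
- move=> q0 p0 ss bs0 P cq0 cp0 pq0 fr0 T0 [Eq Ess EP]; subst q0 ss P.
  suff <- : p0 = p by [].
  have [E0 U0 _] := fresh_namesP fr0.
  rewrite -E0 size_map /open /= openv_iota in T0.
  have W0 : process (Out (Free p) (map (@Free S) bs0)) by rewrite process_Out E0 E.
  have := typ_fn T0 W0 cp; rewrite fn_Out inE eqxx /= inE => /esym.
  by move/eqP.
- by move=> q0 ? ? ? ? oq _ _ _ [Eq]; subst q0; rewrite (cont_outc cq) in oq.
- by move=> q0 ? ? ? ? iq _ _ _ [Eq]; subst q0; rewrite (cont_inc cq) in iq.
Qed.

(** The process (nu q)(a<vs,q> | q(cs).v<cs>) under binders; [v] is shifted twice, for the
    restriction and for the input. *)
Definition delayed v (a : var S) (vs : seq (var S)) (k : S) : proc S :=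
  Nu k (Par (Out (shiftv a) (rcons (map (@shiftv S) vs) (Bound S 0 0)))
            (In (Bound S 0 0) (obj k)
               (Out (shiftv (shiftv v)) [seq Bound S 0 j | j <- iota 0 (size (obj k))]))).

(* [exp G P P']: some outputs x<bs,v> of P with a continuation v are replaced in P'
   by (nu q)(x<bs,q> | q(cs).v<cs>). *)
Inductive exp : seq (seq S) -> proc S -> proc S -> Prop :=
| E_out G (a : var S) vs : exp G (Out a vs) (Out a vs)
| E_link G (a : var S) vs v k : vsort G v = Some k -> is_cont (ctl k) ->
    exp G (Out a (rcons vs v)) (delayed v a vs k)
| E_rep G (a : var S) ss P P' : exp (ss :: G) P P' -> exp G (Rep a ss P) (Rep a ss P')
| E_par G P P' Q Q' : exp G P P' -> exp G Q Q' -> exp G (Par P Q) (Par P' Q')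
| E_nu G k P P' : exp ([:: k] :: G) P P' -> exp G (Nu k P) (Nu k P')
| E_nil G : exp G (Nil S) (Nil S)
| E_in G (a : var S) ss P P' : exp (ss :: G) P P' -> exp G (In a ss P) (In a ss P')
| E_tau G P P' : exp G P P' -> exp G (Tau P) (Tau P')
| E_match G (a b : var S) P P' : exp G P P' -> exp G (Match a b P) (Match a b P')
| E_sum G P P' Q Q' : exp G P P' -> exp G Q Q' -> exp G (Sum P Q) (Sum P' Q').

Lemma exp_refl G P : exp G P P.
Proof. by elim: P G => *; constructor. Qed.

Lemma openv_shift k bs v : openv k.+1 bs (shiftv v) = shiftv (openv k bs v).
Proof. by case: v => //= i j; rewrite eqSS; case: eqP => // _; case: (onth bs j). Qed.

Lemma closev_shift k c v : closev k.+1 c (shiftv v) = shiftv (closev k c v).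
Proof. by case: v => //= b; case: eqP. Qed.

Lemma open_delayed k bs v (a : var S) vs x : open_rec k bs (delayed v a vs x) =
  delayed (openv k bs v) (openv k bs a) (map (openv k bs) vs) x.
Proof.
rewrite /delayed /= !openv_shift map_rcons /= -!map_comp; congr (Nu _ (Par (Out _ _) _)).
by congr rcons; apply: eq_map => w /=; rewrite openv_shift.
Qed.

Lemma close_delayed k c v (a : var S) vs x : close_rec k c (delayed v a vs x) =
  delayed (closev k c v) (closev k c a) (map (closev k c) vs) x.
Proof.
rewrite /delayed /= !closev_shift map_rcons /= -!map_comp; congr (Nu _ (Par (Out _ _) _)).
by congr rcons; apply: eq_map => w /=; rewrite closev_shift.
Qed.

Lemma exp_open G0 P P' : exp G0 P P' -> forall G bs, G0 = rcons G (map fst bs) ->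
  exp G (open_rec (size G) bs P) (open_rec (size G) bs P').
Proof.
elim=> {G0 P P'}; try by move=> *; subst; rewrite /=; constructor; auto.
- move=> G0 a vs v k Ek ck G bs E; subst G0; rewrite open_delayed /= map_rcons.
  by apply: E_link; rewrite ?vsort_open.
Qed.

Lemma vsort_close G c v k : vsort G v = Some k ->
  vsort (rcons G [:: c.1]) (closev (size G) c v) = Some k.
Proof.
move=> E; have := vsort_lcv (_ : vsort G v); rewrite E => /(_ isT).
rewrite -(vsort_open G [:: c]) => /openv_closev ->.
exact: E.
Qed.

Lemma exp_close G P P' c : exp G P P' ->
  exp (rcons G [:: c.1]) (close_rec (size G) c P) (close_rec (size G) c P').
Proof.
elim=> {G P P'}; try by move=> *; constructor.
by move=> G a vs v k Ek ck; rewrite close_delayed /= map_rcons; apply: E_link => //; apply: vsort_close.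
Qed.

Lemma exp_nu a P P' : exp [::] P P' -> exp [::] (nu a P) (nu a P').
Proof. by move=> H; apply: E_nu; apply: (exp_close a H). Qed.

Lemma exp_nus cs P P' : exp [::] P P' -> exp [::] (nus cs P) (nus cs P').
Proof. by move=> H; elim: cs => // c cs IH; apply: exp_nu. Qed.

Lemma is_guard_exp G P P' : exp G P P' -> is_guard P -> is_guard P'.
Proof. by case. Qed.

Lemma vsort_shift G ss v : vsort (ss :: G) (shiftv v) = vsort G v.
Proof. by case: v. Qed.

Lemma wf_exp G P P' : exp G P P' -> wf G P -> wf G P'.
Proof.
elim=> {G P P'} //=; try by move=> G a ss P P' _ IH /andP [-> /IH].
- move=> G a vs v k Ek ck; rewrite !vsort_shift /carries /= eqxx.
  case: (vsort G a) => // x; rewrite !map_rcons /= -map_comp.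
  rewrite (eq_map (g := vsort G)); last by move=> w /=; rewrite vsort_shift.
  by rewrite Ek => /eqP ->; rewrite eqxx map_vsort_Bounds eqxx.
- by move=> G P P' Q Q' _ H1 _ H2 /andP [/H1 -> /H2 ->].
- by move=> G a b P P' H IH /and4P [-> -> /(is_guard_exp H) -> /IH ->].
- move=> G P P' Q Q' H1 IH1 H2 IH2.
  by case/and4P => /(is_guard_exp H1) -> /(is_guard_exp H2) -> /IH1 -> /IH2 ->.
Qed.

Lemma process_exp P P' : exp [::] P P' -> process P -> process P'.
Proof. exact: wf_exp. Qed.

Lemma fnv_shift v : fnv (shiftv v) = fnv v. Proof. by case: v. Qed.

Lemma fn_exp G P P' : exp G P P' -> fn P' =i fn P.
Proof.
elim=> {G P P'} //=; try by move=> G a ss P P' _ IH x; rewrite !mem_cat IH.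
- move=> G a vs v k Ek ck x; rewrite !fnv_shift !map_rcons -map_comp.
  rewrite (eq_map (g := @fnv S)); last by move=> w /=; rewrite fnv_shift.
  rewrite -!cats1 !flatten_cat /= !cats0 fnv_Bounds cats0 !mem_cat /=.
  by rewrite orbA.
- by move=> G P P' Q Q' _ H1 _ H2 x; rewrite !mem_cat H1 H2.
- by move=> G P P' Q Q' _ H1 _ H2 x; rewrite !mem_cat H1 H2.
Qed.

Lemma shiftv_Free bs : map (@shiftv S) (map (@Free S) bs) = map (@Free S) bs.
Proof. by rewrite -map_comp. Qed.

Lemma openv_Free k cs bs : map (openv k cs) (map (@Free S) bs) = map (@Free S) bs.
Proof. by rewrite -map_comp. Qed.

Lemma open_delayed_body q a bs p : q.1 = p.1 ->
  open [:: q] (Par (Out (shiftv (Free a)) (rcons (map (@shiftv S) (map (@Free S) bs)) (Bound S 0 0)))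
            (In (Bound S 0 0) (obj p.1)
               (Out (shiftv (shiftv (Free p))) [seq Bound S 0 j | j <- iota 0 (size (obj p.1))]))) =
  Par (Out (Free a) (map (@Free S) (rcons bs q))) (link q p).
Proof.
move=> E; rewrite /open /= map_rcons shiftv_Free openv_Free /= /link E map_rcons.
congr (Par _ (In _ _ (Out _ _))); rewrite -map_comp; exact: eq_map.
Qed.

Lemma exp_Out_inv a bs R : exp [::] (Out (Free a) (map (@Free S) bs)) R ->
  R = Out (Free a) (map (@Free S) bs) \/
  exists bs0 p, [/\ bs = rcons bs0 p, cont p
    & R = delayed (Free p) (Free a) (map (@Free S) bs0) p.1].
Proof.
move E: [::] => G; move EP: (Out _ _) => P H.
case: H E EP => // [G0 b vs _ [<- <-]|G0 b vs v k Ek ck EG [Ea Evs]]; first by left.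
subst G0 b; right; case/lastP: bs Evs => [|bs p]; first by case: vs.
rewrite map_rcons => /rcons_inj [Evs Ev]; subst vs v; case: Ek => Ek.
by subst k; exists bs, p; split.
Qed.

Lemma exp_In_inv G (a : var S) ss P R : exp G (In a ss P) R ->
  exists2 P', R = In a ss P' & exp (ss :: G) P P'.
Proof.
by move EP: (In _ _ _) => X H; case: H EP => // G0 b ss0 P0 P0' H [-> -> ->]; exists P0'.
Qed.

Lemma exp_Rep_inv G (a : var S) ss P R : exp G (Rep a ss P) R ->
  exists2 P', R = Rep a ss P' & exp (ss :: G) P P'.
Proof.
by move EP: (Rep _ _ _) => X H; case: H EP => // G0 b ss0 P0 P0' H [-> -> ->]; exists P0'.
Qed.

Lemma exp_Nu_inv G k P R : exp G (Nu k P) R ->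
  exists2 P', R = Nu k P' & exp ([:: k] :: G) P P'.
Proof.
by move EP: (Nu _ _) => X H; case: H EP => // G0 b P0 P0' H [-> ->]; exists P0'.
Qed.

Lemma exp_Tau_inv G P R : exp G (Tau P) R -> exists2 P', R = Tau P' & exp G P P'.
Proof.
by move EP: (Tau _) => X H; case: H EP => // G0 P0 P0' H [->]; exists P0'.
Qed.

Lemma exp_Match_inv G v (w : var S) P R : exp G (Match v w P) R ->
  exists2 P', R = Match v w P' & exp G P P'.
Proof.
by move EP: (Match _ _ _) => X H; case: H EP => // G0 b c P0 P0' H [-> -> ->]; exists P0'.
Qed.

Lemma exp_Par_inv G P Q R : exp G (Par P Q) R ->
  exists P' Q', [/\ R = Par P' Q', exp G P P' & exp G Q Q'].
Proof.
by move EP: (Par _ _) => X H; case: H EP => // G0 P0 P0' Q0 Q0' H1 H2 [-> ->]; exists P0', Q0'.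
Qed.

Lemma exp_Sum_inv G P Q R : exp G (Sum P Q) R ->
  exists P' Q', [/\ R = Sum P' Q', exp G P P' & exp G Q Q'].
Proof.
by move EP: (Sum _ _) => X H; case: H EP => // G0 P0 P0' Q0 Q0' H1 H2 [-> ->]; exists P0', Q0'.
Qed.

Lemma exp_Nil_inv G R : exp G (Nil S) R -> R = Nil S.
Proof. by move EP: (Nil S) => X H; case: H EP. Qed.

Lemma exp_open_body ss bs P P' : exp [:: ss] P P' -> map fst bs = ss ->
  exp [::] (open bs P) (open bs P').
Proof. by move=> H E; apply: (exp_open H); rewrite E. Qed.

Lemma exp_fresh_names bs ss ss' P P' : exp [:: ss'] P P' ->
  fresh_names bs ss P -> fresh_names bs ss P'.
Proof.
move=> H /fresh_namesP [E U fr]; apply: fresh_namesI => // b /fr.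
by rewrite (fn_exp H).
Qed.

Lemma typ_exp s P : typ s P -> process P -> forall P', exp [::] P P' -> typ s P'.
Proof.
elim=> {s P}.
- move=> p bs cp; rewrite process_Out => /eqP E P' /exp_Out_inv [->|]; first exact: TY_outp.
  move=> [bs0 [r [Eb cr _]]]; have [|] := @carried_cont _ p bs r E _ cr.
    by rewrite Eb mem_rcons mem_head.
  by rewrite cont_outc.
- move=> x bs p ox cp; rewrite process_Out => /eqP E P' /exp_Out_inv [->|]; first exact: TY_outx.
  move=> [bs0 [r [/rcons_inj [E1 E2] _ ->]]]; subst bs0 r.
  have [q [Eq]] := fresh_name p.1 (x :: rcons bs p).
  rewrite inE mem_rcons inE !negb_or => /and3P [qx qp qbs].
  have cq : cont q by rewrite (cont_sort Eq).
  (* The output owns [(q, TO)] and the link owns [(q, TI)] and [(p, TO)]; restricting [q] removes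
     the pair and leaves the stack of the original output. *)
  rewrite /delayed -{1}Eq; apply: (@TY_nu _ q [:: (q, TO); (q, TI); (p, TO)]).
  + rewrite /= -map_comp !map_rcons -!cats1 !flatten_cat /= !cats0 fnv_Bounds.
    rewrite !inE (_ : flatten _ = bs) ?mem_cat ?inE ?negb_or ?qx ?qbs //.
    by rewrite -[RHS]fnv_free_map -map_comp.
  + rewrite open_delayed_body //; apply: TY_par.
    * exact: TY_outx.
    * by apply: typ_link; rewrite // eq_sym.
    * split; last by apply: SH_left; apply: SH_right; apply: SH_right; apply: SH_nil.
      rewrite is_stackE; apply: stk_push_pair => //=; first by rewrite cp.
      by rewrite inE.
  + by apply: (@NU_used _ q [::]).
- move=> u bs iu; rewrite process_Out => /eqP E P' /exp_Out_inv [->|]; first exact: TY_outu.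
  move=> [bs0 [r [Eb cr _]]]; have [|] := @carried_cont _ u bs r E _ cr.
    by rewrite Eb mem_rcons mem_head.
  by rewrite inc_outc.
- move=> q p ss bs P cq cp pq fr _ IH; rewrite process_In => /andP [_ W] R /exp_In_inv [P' -> H].
  have [E _ _] := fresh_namesP fr; apply: TY_inp (exp_fresh_names H fr) _ => //.
  by apply: IH; [apply: process_open_body W | apply: exp_open_body E].
- move=> x p ss bs P ox cp fr _ IH; rewrite process_In => /andP [_ W] R /exp_In_inv [P' -> H].
  have [E _ _] := fresh_namesP fr; apply: TY_inx (exp_fresh_names H fr) _ => //.
  by apply: IH; [apply: process_open_body W | apply: exp_open_body E].
- move=> x p ss bs P ox cp fr _ IH; rewrite process_Rep => /andP [_ W] R /exp_Rep_inv [P' -> H].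
  have [E _ _] := fresh_namesP fr; apply: TY_repx (exp_fresh_names H fr) _ => //.
  by apply: IH; [apply: process_open_body W | apply: exp_open_body E].
- move=> x p ss bs P ox cp fr _ IH; rewrite process_In => /andP [_ W] R /exp_In_inv [P' -> H].
  have [E _ _] := fresh_namesP fr; apply: TY_inu (exp_fresh_names H fr) _ => //.
  by apply: IH; [apply: process_open_body W | apply: exp_open_body E].
- by move=> _ R /exp_Nil_inv ->; exact: TY_nil.
- move=> a s s' P aP _ IH Hnu; rewrite process_Nu => W R /exp_Nu_inv [P' -> H].
  apply: TY_nu Hnu; first by rewrite (fn_exp H).
  by apply: IH; [exact: W | apply: exp_open_body H _].
- move=> a b P ca cb _ IH /and4P [_ _ _ W] R /exp_Match_inv [P' -> H].
  by apply: TY_match; [by []|by []|apply: IH].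
- move=> s s' s'' P Q _ IHP _ IHQ H /andP [WP WQ] R /exp_Par_inv [P' [Q' [-> HP HQ]]].
  by apply: TY_par H; [apply: IHP | apply: IHQ].
- by move=> s P _ IH sz W R /exp_Tau_inv [P' -> H]; apply: TY_tau => //; apply: IH.
- move=> s P Q _ IHP _ IHQ sz /and4P [_ _ WP WQ] R /exp_Sum_inv [P' [Q' [-> HP HQ]]].
  by apply: TY_sum => //; [apply: IHP | apply: IHQ].
Qed.

End Expansion.

(** * Normal forms of expanded processes *)

Section FlatExpansion.

Variable S : sorting.
Implicit Types (s t u : stack S) (p q a b c : name S) (bs cs ds es qs L K : seq (name S))
  (P Q R U : proc S) (ts us r : seq (proc S)) (mu nu : action S)
  (f g theta : name S -> name S) (l : seq (name S * name S))
  (tu : seq (proc S * proc S)).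

(** The derivation of an input or internal step of a thread contains no freshness condition, so the
    substitution need not be injective. *)
Lemma trans_subst f P mu P' : sort_pres f -> trans P mu P' -> process P ->
  is_thread P -> ~~ is_out mu -> trans (ren f P) (ren_act f mu) (ren f P').
Proof.
move=> fS; elim=> {P mu P'} //=.
- by move=> a ss P bs E _ _ _; rewrite /open ren_open; apply: T_in; rewrite map_sort.
- by move=> a ss P bs E _ _ _; rewrite /open ren_open; apply: T_rep; rewrite map_sort.
- by move=> P _ _ _; apply: T_tau.
- move=> a P mu P' H IH /and4P [_ _ G W] _ N; apply: T_match; apply: IH => //.
  by case: P G H {W} => // _ H; inversion H.
- move=> P Q mu P' H IH /and4P [G _ W _] _ N; apply: T_sumL; apply: IH => //.
  by case: P G H {W} => // _ H; inversion H.
- move=> P Q mu P' H IH /and4P [_ G _ W] _ N; apply: T_sumR; apply: IH => //.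
  by case: Q G H {W} => // _ H; inversion H.
Qed.

Lemma trans_In_inv (v : var S) ss P mu R : trans (In v ss P) mu R ->
  exists a bs, [/\ v = Free a, map fst bs = ss, mu = AIn a bs & R = open bs P].
Proof.
move E: (In _ _ _) => X H; case: H E => // a ss0 P0 bs Ebs [-> -> ->].
by exists a, bs.
Qed.

Lemma trans_Rep_inv (v : var S) ss P mu R : trans (Rep v ss P) mu R ->
  exists a bs, [/\ v = Free a, map fst bs = ss, mu = AIn a bs
    & R = Par (open bs P) (Rep v ss P)].
Proof.
move E: (Rep _ _ _) => X H; case: H E => // a ss0 P0 bs Ebs [-> -> ->].
by exists a, bs.
Qed.

Lemma trans_Tau_inv P mu R : trans (Tau P) mu R -> mu = ATau S /\ R = P.
Proof. by move E: (Tau _) => X H; case: H E => // P0 [->]. Qed.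

Lemma trans_Match_inv (v w : var S) P mu R : trans (Match v w P) mu R ->
  exists a, [/\ v = Free a, w = Free a & trans P mu R].
Proof.
move E: (Match _ _ _) => X H; case: H E => // a P0 mu0 P' H [-> -> ->].
by exists a.
Qed.

Lemma trans_Sum_inv P Q mu R : trans (Sum P Q) mu R -> trans P mu R \/ trans Q mu R.
Proof.
move E: (Sum _ _) => X H.
by case: H E => // P0 Q0 mu0 P' H [-> ->]; [left|right].
Qed.

Lemma trans_Nil_inv mu R : trans (Nil S) mu R -> False.
Proof. by move E: (Nil S) => X H; case: H E. Qed.

Lemma trans_Out_inv (v : var S) vs mu R : trans (Out v vs) mu R -> is_out mu.
Proof. by move E: (Out _ _) => X H; case: H E. Qed.

Lemma guard_thread P mu R : is_guard P -> trans P mu R -> is_thread P.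
Proof. by case: P => // _ /trans_Nil_inv. Qed.

(** A thread is not a delayed output, and an expansion leaves prefixes as they are, so the actions
    agree. *)
Lemma exp_trans_right P U mu U' : exp [::] P U -> process U -> is_thread U ->
  trans U mu U' -> ~~ is_out mu -> exists2 P', trans P mu P' & exp [::] P' U'.
Proof.
move E: [::] => G He; elim: He E mu U' => {G P U} //; last 1 first.
- move=> G P P' Q Q' H1 IH1 H2 IH2 E mu U' /and4P [G1 G2 W1 W2] _ /trans_Sum_inv [] H N;
    subst G.
  + have [R K1 K2] := IH1 erefl _ _ W1 (guard_thread G1 H) H N.
    by exists R => //; apply: T_sumL.
  + have [R K1 K2] := IH2 erefl _ _ W2 (guard_thread G2 H) H N.
    by exists R => //; apply: T_sumR.
- by move=> G a vs _ mu U' _ _ /trans_Out_inv ->.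
- move=> G v ss P P' H _ E mu U' _ _ /trans_Rep_inv [a [bs [-> Ebs -> ->]]] _; subst G.
  exists (Par (open bs P) (Rep (Free a) ss P)); first exact: T_rep.
  by apply: E_par; [apply: exp_open_body H Ebs | apply: E_rep].
- move=> G v ss P P' H _ E mu U' _ _ /trans_In_inv [a [bs [-> Ebs -> ->]]] _; subst G.
  by exists (open bs P); [exact: T_in | apply: exp_open_body H Ebs].
- move=> G P P' H _ E mu U' _ _ /trans_Tau_inv [-> ->] _; subst G.
  by exists P => //; apply: T_tau.
- move=> G v w P P' H IH E mu U' /and4P [_ _ GP W] _ /trans_Match_inv [a [-> -> Ht]] N; subst G.
  have [R K1 K2] := IH erefl _ _ W (guard_thread GP Ht) Ht N.
  by exists R => //; apply: T_match.
Qed.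

Lemma renv_Free_inv f v a : renv f v = Free a -> exists2 b, v = Free b & a = f b.
Proof. by case: v => //= b [<-]; exists b. Qed.

Lemma typ_Match_free s v w P : typ s (Match v w P) ->
  exists a b, [/\ v = Free a, w = Free b, ~~ cont a, ~~ cont b & typ [::] P].
Proof.
by move E: (Match _ _ _) => R T; case: T E => // {s R} a0 b0 P0 ? ? ? [-> -> ->]; exists a0, b0.
Qed.

Lemma exp_thread G P U : exp G P U -> is_thread U -> is_thread P.
Proof. by case. Qed.

Lemma exp_guard_thread G P U f mu R : exp G P U -> is_guard U ->
  trans (ren f P) mu R -> is_thread U.
Proof. by case=> // G0 _ /= /trans_Nil_inv. Qed.

(** A substitution could enable a match, but well-typed matches compare names that are not
    continuations, and [f] fixes those. The tuple received by [U] is [bs0], the one before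
    substitution, since its private names have not been forwarded yet. *)
Lemma exp_trans_left f P U mu R bs0 : sort_pres f -> (forall a, ~~ cont a -> f a = a) ->
  exp [::] P U -> forall s, typ s U -> process U -> is_thread U ->
  trans (ren f P) mu R -> ~~ is_out mu -> (forall a bs, mu = AIn a bs -> bs = map f bs0) ->
  exists nu U' P', [/\ trans U nu U', exp [::] P' U', R = ren f P', ~~ is_out nu
    & (mu = ATau S /\ nu = ATau S) \/
      exists a, mu = AIn (f a) (map f bs0) /\ nu = AIn a bs0].
Proof.
move=> fS fid; move E: [::] => G He; elim: He E mu R => {G P U} //; last 1 first.
- move=> G P P' Q Q' H1 IH1 H2 IH2 E mu R s /typ_Sum_inv [T1 T2].
  move=> /and4P [G1 G2 W1 W2] _ /= /trans_Sum_inv [] H N B; subst G.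
  + have [nu [U' [R' [K1 K2 K3 K4 K5]]]] :=
      IH1 erefl _ _ _ T1 W1 (exp_guard_thread H1 G1 H) H N B.
    by exists nu, U', R'; split=> //; apply: T_sumL.
  + have [nu [U' [R' [K1 K2 K3 K4 K5]]]] :=
      IH2 erefl _ _ _ T2 W2 (exp_guard_thread H2 G2 H) H N B.
    by exists nu, U', R'; split=> //; apply: T_sumR.
- by move=> G a vs _ mu R s _ _ _ /trans_Out_inv ->.
- move=> G v ss P P' H _ E mu R s _ _ _ /= /trans_Rep_inv [a [bs [Ev Ebs Emu ->]]] _ B.
  subst G; have [b Ev' Ea] := renv_Free_inv Ev; subst v a mu.
  have Eb := B _ _ erefl; subst bs; rewrite map_sort // in Ebs.
  exists (AIn b bs0), (Par (open bs0 P') (Rep (Free b) ss P')), (Par (open bs0 P) (Rep (Free b) ss P)).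
  split=> //; [exact: T_rep | | by rewrite /= /open ren_open | by right; exists b].
  by apply: E_par; [apply: exp_open_body H Ebs | apply: E_rep].
- move=> G v ss P P' H _ E mu R s _ _ _ /= /trans_In_inv [a [bs [Ev Ebs Emu ->]]] _ B.
  subst G; have [b Ev' Ea] := renv_Free_inv Ev; subst v a mu.
  have Eb := B _ _ erefl; subst bs; rewrite map_sort // in Ebs.
  exists (AIn b bs0), (open bs0 P'), (open bs0 P).
  split=> //; [exact: T_in | | by rewrite /open ren_open | by right; exists b].
  exact: exp_open_body H Ebs.
- move=> G P P' H _ E mu R s _ _ _ /= /trans_Tau_inv [-> ->] _ _; subst G.
  by exists (ATau S), P', P; split=> //; [exact: T_tau | left].
- move=> G v w P P' H IH E mu R s /typ_Match_free [a [b [-> -> ka kb T]]].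
  move=> /and4P [_ _ GP W] _ /= /trans_Match_inv [c [[Ea] [Eb] Ht]] N B; subst G.
  rewrite !fid // in Ea Eb; subst a b.
  have K := exp_guard_thread H GP Ht.
  have [nu [U' [R' [K1 K2 K3 K4 K5]]]] := IH erefl _ _ _ T W K Ht N B.
  by exists nu, U', R'; split=> //; apply: T_match.
Qed.

Definition lnks l : seq (proc S) := map (fun x => link x.1 x.2) l.

Lemma lnks_cat l1 l2 : lnks (l1 ++ l2) = lnks l1 ++ lnks l2.
Proof. exact: map_cat. Qed.

Lemma process_Out_inv (v : var S) vs : process (Out v vs) ->
  exists a bs, v = Free a /\ vs = map (@Free S) bs.
Proof.
rewrite /process /=; case: v => [a|i j] /=; last by rewrite nth_nil onth_nil.
move=> /eqP H; exists a; suff [bs ->] : exists bs, vs = map (@Free S) bs by exists bs.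
elim: vs (obj a.1) H => [|v vs IH] [|x xs] //=; first by exists [::].
case: v => [b|i j] /=; last by rewrite nth_nil onth_nil.
by case=> _ /IH [bs ->]; exists (b :: bs).
Qed.

(** Both processes are flattened together: [tu] pairs their threads, and [l] lists the links of the
    delayed outputs with their private names [qs]. [K] holds the names that are already forwarded,
    which have to stay out of the image of the substitution; [L] holds the names to avoid. *)
Lemma flat_expansion n P P' : psize P < n -> forall K theta L, exp [::] P P' ->
  process P -> sort_pres theta -> (forall a, a \notin K -> theta a = a) ->
  (forall a, theta a \notin K) ->
  {subset K ++ map theta K ++ fn P ++ fn (ren theta P) <= L} ->
  exists cs qs tu l theta', [/\
    nfp (ren theta P) cs (map (fun x => ren theta' x.1) tu),
    nfp P' (cs ++ qs) (map snd tu ++ lnks l),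
    apart (cs ++ qs) L,
    [/\ sort_pres theta', forall a, a \notin qs -> theta' a = theta a &
        forall a, theta' a \notin K ++ qs] &
    [/\ map fst l = qs,
        forall x, x \in l -> [/\ cont x.1, theta' x.1 = theta' x.2 & x.1.1 = x.2.1] &
        forall x, x \in tu -> exp [::] x.1 x.2 /\ is_thread x.2]].
Proof.
elim: n P P' => // n IH P P' lt_n K theta L He W tS tout timg sub.
have thread : is_thread P' -> exists cs qs tu l theta', [/\
    nfp (ren theta P) cs (map (fun x => ren theta' x.1) tu),
    nfp P' (cs ++ qs) (map snd tu ++ lnks l),
    apart (cs ++ qs) L,
    [/\ sort_pres theta', forall a, a \notin qs -> theta' a = theta a &
        forall a, theta' a \notin K ++ qs] &
    [/\ map fst l = qs,
        forall x, x \in l -> [/\ cont x.1, theta' x.1 = theta' x.2 & x.1.1 = x.2.1] &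
        forall x, x \in tu -> exp [::] x.1 x.2 /\ is_thread x.2]].
  move=> T; exists [::], [::], [:: (P, P')], [::], theta; split=> //=.
  - by apply: nfp_thread; rewrite is_thread_ren (exp_thread He).
  - exact: nfp_thread.
  - by split=> // a; rewrite cats0.
  - by split=> // x; rewrite inE => /eqP ->.
case: P lt_n He W sub thread.
- move=> v vs _ He W; have [a [bs [E1 E2]]] := process_Out_inv W; subst v vs.
  move: He => /exp_Out_inv [-> _|]; first by apply.
  move=> [bs0 [p [Eb cp EP]]] sub _; subst bs P'.
  rewrite ren_Out !fn_Out in sub.
  have subL x : x \in a :: rcons bs0 p -> x \in L /\ theta x \in L.
    move=> xx; split; apply: sub; rewrite !(mem_cat _ K) !(mem_cat _ (map theta K)).
      by rewrite (mem_cat _ (a :: _)) xx !orbT.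
    by rewrite (mem_cat _ (a :: _)) -map_cons (map_f theta xx) !orbT.
  have [q [Eq qL]] := fresh_name p.1 L.
  have nq x : x \in a :: rcons bs0 p -> x != q /\ theta x != q.
    by move=> /subL [H1 H2]; split; apply: contraNneq qL => <-.
  have pin : p \in a :: rcons bs0 p by rewrite inE mem_rcons mem_head orbT.
  (* The link takes [q] to [p], which may itself be forwarded: hence [theta p]. *)
  pose th x := if x == q then theta p else theta x.
  have thN x : x != q -> th x = theta x by rewrite /th => /negPf->.
  have thq : th q = theta p by rewrite /th eqxx.
  pose o := Out (Free a) (map (@Free S) (rcons bs0 q)).
  exists [::], [:: q], [:: (o, o)], [:: (q, p)], th; split.
  + have <- : ren th o = ren theta (Out (Free a) (map (@Free S) (rcons bs0 p))).
      rewrite /o !ren_Out thN; last by case: (nq a (mem_head _ _)).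
      congr (Out _ (map _ _)); rewrite !map_rcons thq; congr rcons.
      apply/eq_in_map => x xb; apply: thN; case: (nq x) => //.
      by rewrite inE mem_rcons inE xb !orbT.
    exact: (@nfp_thread _ (ren th o)).
  + rewrite /delayed -{1}Eq; apply: nfp_Nu => //.
      apply: contra qL => qf; suff /subL [] : q \in a :: rcons bs0 p by [].
      have := fn_exp (@E_link S [::] (Free a) (map (@Free S) bs0) (Free p) p.1 erefl cp) q.
      by rewrite -map_rcons fn_Out => <-.
    rewrite open_delayed_body //.
    by apply: (@nfp_par S _ _ [::] [::] [:: o]) => //; apply: nfp_thread.
  + by rewrite /= qL.
  + split.
    * by move=> x; rewrite /th; case: eqP => [->|_]; rewrite tS.
    * by move=> x; rewrite inE => /thN.
    * move=> x; rewrite mem_cat inE negb_or /th; case: eqP => [_|/eqP xq].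
        by rewrite timg; case: (nq p pin).
      rewrite timg /=; have [xK|xK] := boolP (x \in K); last by rewrite tout.
      apply: contraNneq qL => <-; apply: sub; rewrite mem_cat (mem_cat _ (map _ _)).
      by rewrite map_f // orbT.
  + split=> // x; rewrite inE => /eqP -> /=.
      by split=> //; [rewrite (cont_sort Eq) | rewrite thq thN //; case: (nq p pin)].
    by split=> //; apply: E_out.
- by move=> v ss P _ /exp_Rep_inv [P0 -> _] _ _; apply.
- move=> P Q lt_n /exp_Par_inv [P1 [Q1 [-> HP HQ]]] /andP [WP WQ] sub _.
  have subP : {subset K ++ map theta K ++ fn P ++ fn (ren theta P) <= L}.
    move=> x; rewrite !mem_cat => H; apply: sub; rewrite !mem_cat; move: H.
    by case/or4P => ->; rewrite ?orbT.
  have subQ : {subset K ++ map theta K ++ fn Q ++ fn (ren theta Q) <= L}.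
    move=> x; rewrite !mem_cat => H; apply: sub; rewrite !mem_cat; move: H.
    by case/or4P => ->; rewrite ?orbT.
  have [|cs1 [qs1 [tu1 [l1 [th1 [N1 M1 A1 [S1 O1 I1] [D1 E1 F1]]]]]]] :=
    IH P P1 _ K theta L HP WP tS tout timg subP; first by rewrite /= in lt_n; lia.
  have A1' : apart cs1 L && apart qs1 L by rewrite -apart_catl.
  have th1L x : x \in L -> th1 x = theta x.
    move=> xL; apply: O1; apply/negP => xq; case/andP: A1' => _ /apartP /(_ _ xq).
    by rewrite xL.
  have EQ : ren th1 Q = ren theta Q.
    by apply: eq_ren => x xQ; apply/th1L/subQ; rewrite !mem_cat xQ !orbT.
  (* The second component is flattened after the first, starting from its substitution and avoiding
     all its names; the description of the first component thereby remains valid for the final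
     substitution. *)
  pose L2 := L ++ cs1 ++ qs1 ++ fns (map fst tu1) ++ fns (map snd tu1 ++ lnks l1)
    ++ map th1 (K ++ qs1).
  have [|||cs2 [qs2 [tu2 [l2 [th2 [N2 M2 A2 [S2 O2 I2] [D2 E2 F2]]]]]]] :=
    IH Q Q1 _ (K ++ qs1) th1 L2 HQ WQ S1 _ I1; first by rewrite /= in lt_n; lia.
  + move=> x; rewrite mem_cat negb_or => /andP [xK xq].
    by rewrite O1 // tout.
  + move=> x; rewrite EQ !(mem_cat x (K ++ qs1)) !(mem_cat x (map th1 _)).
    case/or3P => [xK|xK|xQ].
    * rewrite /L2 !mem_cat; move: xK; rewrite mem_cat => /orP [xK|->]; rewrite ?orbT //.
      by rewrite subP // mem_cat xK.
    * by rewrite /L2 !mem_cat xK !orbT.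
    * rewrite /L2 mem_cat (_ : x \in L) //; apply: subQ.
      by rewrite mem_cat (mem_cat _ (map theta K)) xQ !orbT.
  rewrite EQ in N2.
  move: A2; rewrite !apart_catl !(apart_catr _ L) !(apart_catr _ cs1) !(apart_catr _ qs1).
  rewrite !(apart_catr _ (fns (map fst tu1))) !(apart_catr _ (fns (map snd tu1 ++ lnks l1))).
  move=> /andP [/and5P [A2 A3 A4 A5 A6] /and5P [B2 B3 B4 B5 /andP [B6 _]]].
  have th2N x : x \notin qs2 -> th2 x = th1 x by exact: O2.
  have inqs2 X x : apart qs2 X -> x \in X -> x \notin qs2.
    by rewrite apart_sym => /apartP H /H.
  exists (cs1 ++ cs2), (qs1 ++ qs2), (tu1 ++ tu2), (l1 ++ l2), th2; split.
  + have [C1 _] := andP A1'.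
    rewrite map_cat (_ : map _ tu1 = map (fun x => ren th1 x.1) tu1); last first.
      apply/eq_in_map => x xt; apply: eq_ren => y yx; apply: th2N; apply: inqs2 B5 _.
      by apply/flattenP; exists (fn x.1) => //; apply/map_f/map_f.
    apply: nfp_par N1 N2 _ _ _; last by rewrite apart_sym.
      by apply: apart_subr C1 => x xQ; apply: subQ; rewrite !mem_cat xQ !orbT.
    by apply: apart_subr A2 => x xP; apply: subP; rewrite !mem_cat xP !orbT.
  + have LP : {subset fn P1 <= L}.
      by move=> x; rewrite (fn_exp HP) => xP; apply: subP; rewrite !mem_cat xP !orbT.
    have LQ : {subset fn Q1 <= L}.
      by move=> x; rewrite (fn_exp HQ) => xP; apply: subQ; rewrite !mem_cat xP !orbT.
    rewrite map_cat lnks_cat; apply: nfp_perm (nfp_par M1 M2 _ _ _).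
    * by perm_count.
    * by perm_count.
    * exact: apart_subr A1.
    * by rewrite apart_catl !(apart_subr LP).
    * by rewrite apart_sym apart_catl !apart_catr A3 A4 B3 B4.
  + by case/andP: A1' => C1 C2; rewrite !apart_catl C1 C2 A2 B2.
  + split=> // x; last by rewrite catA.
    by rewrite mem_cat negb_or => /andP [x1 x2]; rewrite th2N // O1.
  + split; first by rewrite map_cat D1 D2.
    * move=> x; rewrite mem_cat => /orP [xl|/E2 //].
      have [cx Ex sx] := E1 _ xl.
      have X y : y \in fn (link x.1 x.2) -> th2 y = th1 y.
        move=> yx; apply: th2N; apply: inqs2 B6 _; rewrite fns_cat mem_cat.
        apply/orP; right; apply/flattenP; exists (fn (link x.1 x.2)) => //.
        by apply: map_f; apply: (map_f (fun x => link x.1 x.2)).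
      by split=> //; rewrite !X // fn_link !inE eqxx ?orbT.
    * by move=> x; rewrite mem_cat => /orP [/F1|/F2].
- move=> k P lt_n /exp_Nu_inv [P1 -> HP] W sub _.
  have [c [Ec cL]] := fresh_name k L; rewrite -Ec.
  have cK : c \notin K by apply: contra cL => cK; apply: sub; rewrite mem_cat cK.
  have cP : c \notin fn P by apply: contra cL => cP; apply: sub; rewrite !mem_cat /= cP !orbT.
  have cP' : c \notin fn (ren theta P).
    by apply: contra cL => cP'; apply: sub; rewrite !mem_cat /= cP' !orbT.
  have Eo : open [:: c] (ren theta P) = ren theta (open [:: c] P).
    by rewrite /open ren_open /= tout.
  have He : exp [::] (open [:: c] P) (open [:: c] P1).
    by apply: exp_open_body HP _; rewrite /= Ec.
  have W' : process (open [:: c] P) by rewrite -process_Nu Ec.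
  have [||cs1 [qs1 [tu1 [l1 [th1 [N1 M1 A1 D1 E1]]]]]] :=
    IH (open [:: c] P) _ _ K theta (c :: L) He W' tS tout timg.
  + by rewrite psize_open; move: lt_n; rewrite /=; lia.
  + move=> x; rewrite !mem_cat inE => /or4P [xK|xK|/mem_fn_open1|].
    * by rewrite sub ?orbT // mem_cat xK.
    * by rewrite sub ?orbT // !mem_cat xK orbT.
    * case/orP => [xP|->] //; by rewrite sub ?orbT // !mem_cat /= xP !orbT.
    * rewrite -Eo => /mem_fn_open1 /orP [xP|->] //; by rewrite sub ?orbT // !mem_cat /= xP !orbT.
  have [c1 c2] : c \notin cs1 /\ c \notin qs1.
    apply/andP; rewrite -negb_or -mem_cat; apply/negP => /(apartP _ _ A1).
    by rewrite inE eqxx.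
  have A2 : apart (cs1 ++ qs1) L by apply: apart_subr A1 => x xL; rewrite inE xL orbT.
  exists (c :: cs1), qs1, tu1, l1, th1; split=> //.
  + by apply: nfp_Nu; rewrite ?Eo.
  + apply: nfp_Nu => //; first by rewrite (fn_exp HP).
    by rewrite mem_cat negb_or c1.
  + by rewrite /= cL.
- move=> _ /exp_Nil_inv -> _ _ _; exists [::], [::], [::], [::], theta; split=> //.
  + exact: nfp_nil.
  + exact: nfp_nil.
  + by split=> // a; rewrite cats0.
- by move=> v ss P _ /exp_In_inv [P0 -> _] _ _; apply.
- by move=> P _ /exp_Tau_inv [P0 -> _] _ _; apply.
- by move=> v w P _ /exp_Match_inv [P0 -> _] _ _; apply.
- by move=> P Q _ /exp_Sum_inv [P0 [Q0 [-> _ _]]] _ _; apply.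
Qed.

End FlatExpansion.

(** * The delay law *)

Section DelayLaw.

Variable S : sorting.
Implicit Types (s t u : stack S) (p q a b c : name S) (bs cs ds es qs L K : seq (name S))
  (P Q R U X Z : proc S) (ts us r : seq (proc S)) (mu nu : action S)
  (f g theta : name S -> name S) (l : seq (name S * name S))
  (tu tr : seq (proc S * proc S)).

(* The threads of Z are those of X, up to expansions under prefixes and to the
   substitution theta that forwards each private name q of qs along the links. *)
Record dl X Z theta cs qs tu l : Prop := Dl {
  dl_left_nf : nfp X cs (map (fun x => ren theta x.1) tu);
  dl_right_nf : nfp Z (cs ++ qs) (map snd tu ++ lnks l);
  dl_sort : sort_pres theta;
  dl_out : forall a, a \notin qs -> theta a = a;
  dl_img : forall a, theta a \notin qs;
  dl_cont : forall q, q \in qs -> cont q;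
  dl_link : forall x, x \in l -> [/\ x.1 \in qs, theta x.1 = theta x.2 & x.1.1 = x.2.1];
  dl_alive : forall q, q \in qs -> q \in fns (map snd tu ++ lnks l) -> q \in map fst l;
  dl_exp : forall x, x \in tu -> exp [::] x.1 x.2 /\ is_thread x.2
}.

Lemma dl_perm X Z theta cs qs tu l tu' l' : perm_eq tu tu' -> perm_eq l l' ->
  dl X Z theta cs qs tu l -> dl X Z theta cs qs tu' l'.
Proof.
move=> H1 H2 [N M S1 O I C L A E]; split=> //.
- by apply: nfp_perm N => //; apply: perm_map.
- by apply: nfp_perm M => //; apply: perm_cat; apply: perm_map.
- by move=> x; rewrite -(perm_mem H2); apply: L.
- move=> q qq; rewrite -(perm_mem (perm_map fst H2)) => H; apply: A => //.
  rewrite (fns_perm (_ : perm_eq _ (map snd tu' ++ lnks l'))) //.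
  by apply: perm_cat; apply: perm_map.
- by move=> x; rewrite -(perm_mem H1); apply: E.
Qed.

Lemma mem_fns P ts x : P \in ts -> x \in fn P -> x \in fns ts.
Proof. by move=> Pt xP; apply/flattenP; exists (fn P) => //; apply: map_f. Qed.

Lemma fnsP x ts : x \in fns ts -> exists2 P, P \in ts & x \in fn P.
Proof. by case/flattenP => _ /mapP [P Pt ->] xP; exists P. Qed.

(** After matching steps the residual may show new delayed outputs. Flattening it extends [theta],
    the private names and the links. The bound on [fn U] ensures that no private name without a link
    reappears. *)
Lemma dl_sync X Z theta cs qs tu l tr P U X' Z' : dl X Z theta cs qs tu l ->
  {subset tr <= tu} -> exp [::] P U -> process P ->
  {subset fn U <= fns (map snd tu ++ lnks l)} ->
  (forall ds us, nfp (ren theta P) ds us ->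
     apart ds (cs ++ fns (map (fun x => ren theta x.1) tu)) ->
     nfp X' (cs ++ ds) (us ++ map (fun x => ren theta x.1) tr)) ->
  (forall ds us, nfp U ds us -> apart ds ((cs ++ qs) ++ fns (map snd tu ++ lnks l)) ->
     nfp Z' ((cs ++ qs) ++ ds) (us ++ (map snd tr ++ lnks l))) ->
  exists theta' cs' qs' tu' l', dl X' Z' theta' cs' qs' tu' l'.
Proof.
move=> [N M S1 O I C Lk A E] sub He W fU cX cZ.
pose L := (qs ++ map theta qs ++ fn P ++ fn (ren theta P)) ++ cs ++
  fns (map (fun x => ren theta x.1) tu) ++ fns (map snd tu ++ lnks l).
have sL : {subset qs ++ map theta qs ++ fn P ++ fn (ren theta P) <= L}.
  by move=> x H; rewrite /L mem_cat H.
have [cs2 [qs2 [tu2 [l2 [th [N2 M2 A2 [S2 O2 I2] [D2 E2 F2]]]]]]] :=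
  flat_expansion (ltnSn (psize P)) He W S1 O I sL.
move: A2; rewrite /L (apart_catr _ (_ ++ _) _) (apart_catr _ qs) (apart_catr _ cs).
rewrite (apart_catr _ (fns (map (fun x => ren theta x.1) tu))).
rewrite !apart_catl => /and4P [/andP [/andP [a1 a2] _] /andP [a3 a4] /andP [a5 a6] /andP [a7 a8]].
have thN y : y \in fns (map snd tu ++ lnks l) -> th y = theta y.
  move=> yf; apply: O2; apply/negP => yq; move/apartP: a8 => /(_ _ yq).
  by rewrite yf.
exists th, (cs ++ cs2), (qs ++ qs2), (tu2 ++ tr), (l2 ++ l); split.
- rewrite map_cat; have := cX _ _ N2; rewrite apart_catr a3 a5 => /(_ isT).
  rewrite (_ : map _ tr = map (fun x => ren th x.1) tr) //.
  apply/eq_in_map => x xt; apply: eq_ren => y yx; rewrite thN //.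
  rewrite fns_cat mem_cat (@mem_fns x.2) //; first by apply/map_f/sub.
  by have [Ex _] := E _ (sub _ xt); rewrite (fn_exp Ex).
- have := cZ _ _ M2; rewrite !apart_catr !apart_catl a1 a2 a3 a4 a7 a8 => /(_ isT) H.
  by apply: nfp_perm H; rewrite ?map_cat ?lnks_cat; perm_count.
- exact: S2.
- by move=> x; rewrite mem_cat negb_or => /andP [x1 x2]; rewrite O2 // O.
- exact: I2.
- move=> q; rewrite mem_cat => /orP [/C //|]; rewrite -D2 => /mapP [x xl ->].
  by case: (E2 _ xl).
- move=> x; rewrite mem_cat => /orP [xl|xl].
    have [cx Ex sx] := E2 _ xl; split=> //.
    by rewrite mem_cat -D2 map_f // orbT.
  have [qx Ex sx] := Lk _ xl.
  have X0 y : y \in fn (link x.1 x.2) -> th y = theta y.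
    move=> yx; apply: thN; rewrite fns_cat mem_cat orbC (@mem_fns (link x.1 x.2)) //.
    exact: (map_f (fun x => link x.1 x.2)).
  by split=> //; [rewrite mem_cat qx | rewrite !X0 // fn_link !inE eqxx ?orbT].
- move=> q; rewrite mem_cat (map_cat fst) (mem_cat q (map fst l2)) D2 => /orP [qq|->] // H.
  apply/orP; right; apply: A => //; move: H.
  rewrite map_cat lnks_cat !fns_cat !mem_cat.
  case/orP => /orP [H|H].
  + have [_ F] := nfp_fn M2; have := F q; rewrite fns_cat !mem_cat H => /(_ isT).
    case/orP => [/fU|/orP [H'|H']]; first by rewrite fns_cat mem_cat.
      by move/apartP: a1 => /(_ _ H'); rewrite qq.
    by move/apartP: a2 => /(_ _ H'); rewrite qq.
  + case/fnsP: H => _ /mapP [x /sub xt ->] qx; rewrite (mem_fns _ qx) //.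
    exact: map_f.
  + have [_ F] := nfp_fn M2; have := F q; rewrite fns_cat !mem_cat H orbT => /(_ isT).
    case/orP => [/fU|/orP [H'|H']]; first by rewrite fns_cat mem_cat.
      by move/apartP: a1 => /(_ _ H'); rewrite qq.
    by move/apartP: a2 => /(_ _ H'); rewrite qq.
  + by rewrite H orbT.
- by move=> x; rewrite mem_cat => /orP [/F2|/sub /E].
Qed.

Definition out a bs : proc S := Out (Free a) (map (@Free S) bs).

Lemma typ_out_cont s q bs : cont q -> process (out q bs) -> typ s (out q bs) ->
  (q, TO) \in s.
Proof.
move=> cq; rewrite /out process_Out => /eqP E T.
have := typ_Out_inv T E; move E0: [::] => x; case=> [s1 _ ->|iq|oq|s1 oq].
- by rewrite inE eqxx.
- by rewrite (cont_inc cq) in iq.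
- by rewrite (cont_outc cq) in oq.
- by rewrite (cont_outc cq) in oq.
Qed.

(** The output owns [(q, TO)] and the link owns [(q, TI)], so by linearity no other thread knows
    [q]. *)
Lemma fire_linear Z ns s q p bs ts : typ s Z -> process Z -> cont q -> q.1 = p.1 ->
  nfp Z ns (out q bs :: link q p :: ts) -> p != q /\ q \notin fns ts.
Proof.
move=> T W cq E H; have [tts [Et Tt U]] := nfp_linear H T W.
case: tts Et Tt U => [|x1 [|x2 tts]] //= [E1 E2 E3] Tt.
have T1 : typ x1.1 (out q bs) by rewrite -E1; apply: Tt; rewrite inE eqxx.
have T2 : typ x2.1 (link q p) by rewrite -E2; apply: Tt; rewrite !inE eqxx orbT.
have [_ Wo] := nfp_threads H W (mem_head _ _).
have q1 := typ_out_cont cq Wo T1.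
have [q2 pq] := typ_link_inv cq E T2; split=> //.
apply/negP => /fnsP [t tt qt].
have : t \in map snd tts by rewrite E3.
case/mapP => x xt Ex; have Tx : typ x.1 x.2 by apply: Tt; rewrite !inE xt !orbT.
have Wx : process x.2.
  rewrite -Ex; case: (nfp_threads H W (_ : t \in _)) => //; by rewrite !inE tt !orbT.
have qx : q \in names_of x.1 by rewrite -(typ_fn Tx Wx cq) -Ex.
move: U; rewrite q2 !cat_uniq => /and3P [_ /hasPn D1 /and3P [_ /hasPn D2 _]].
have inF e : e \in x.1 -> e \in flatten (map fst tts).
  by move=> ex; apply/flattenP; exists x.1 => //; apply: map_f.
case/names_tag: qx => /inF H1.
- by have := D1 (q, TO); rewrite mem_cat H1 orbT /= q1 => /(_ isT).
- by have := D2 _ H1; rewrite /= inE eqxx.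
Qed.

(** The undelayed process does not notice that a link fires, because [theta q = theta p]: the
    forwarded output has the same image. *)
Lemma dl_fire X Z theta cs qs q p bs tr l s Z' : typ s Z -> process Z ->
  dl X Z theta cs qs ((out q bs, out q bs) :: tr) ((q, p) :: l) ->
  nfp Z' (cs ++ qs) (out p bs :: map snd tr ++ lnks l) ->
  dl X Z' theta cs qs ((out p bs, out p bs) :: tr) l.
Proof.
move=> T W [N M S1 O I C Lk A E] H.
have [/= qq Eqp sqp] := Lk _ (mem_head _ _).
have M' : nfp Z (cs ++ qs) (out q bs :: link q p :: (map snd tr ++ lnks l)).
  by apply: nfp_perm M => //=; perm_count.
have [pq qf] := fire_linear T W (C _ qq) sqp M'.
have [_ Wo] := nfp_threads M' W (mem_head _ _).
split=> //.
- by move: N; rewrite /= /out /= Eqp.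
- by move=> x xl; apply: Lk; rewrite inE xl orbT.
(* Only [q] has lost its link, and [q] no longer occurs: not in the other threads by linearity, and
   not in [bs], because a continuation carries no continuation. *)
- move=> r rq; rewrite /= fns_cons /out fn_Out mem_cat => Hr.
  have : r \in map fst ((q, p) :: l).
    apply: A => //; rewrite (fns_perm (_ : perm_eq _ (out q bs :: link q p :: (map snd tr ++ lnks l)))).
      rewrite !fns_cons /out fn_Out fn_link !(mem_cat, inE).
      by case/orP: Hr => [|->]; rewrite ?orbT // inE => /orP [] ->; rewrite ?orbT.
    by perm_count.
  rewrite /= inE => /predU1P [Er|//]; subst r; case/orP: Hr; last by rewrite (negPf qf).
  rewrite inE eq_sym (negPf pq) => /= qb; move: Wo; rewrite /out process_Out => /eqP Eb.
  have [] := carried_cont Eb qb (C _ qq).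
  by rewrite (cont_outc (C _ qq)).
- move=> x; rewrite inE => /predU1P [->|xt]; first by split=> //; apply: E_out.
  by apply: E; rewrite inE xt orbT.
Qed.

(** Each forwarding uses up a link, so the chain ends. It ends at a name that is not private and
    whose image is still [theta a], hence at [theta a] itself. *)
Lemma dl_chain n X Z theta cs qs a bs tr l s : size l < n -> wtyped s Z -> clean s ->
  dl X Z theta cs qs ((out a bs, out a bs) :: tr) l ->
  exists Z' l', wtau Z Z' /\
    dl X Z' theta cs qs ((out (theta a) bs, out (theta a) bs) :: tr) l'.
Proof.
elim: n Z a l => // n IH Z a l lt_n TZ Cs D; have [N M S1 O I C Lk A E] := D.
have [aq|aq] := boolP (a \in qs); last first.
  by exists Z, l; rewrite O //; split=> //; apply: rt_refl.
have /mapP [[q p] ql /= Eq] : a \in map fst l.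
  by apply: A => //; rewrite /= fns_cons /out fn_Out mem_cat inE eqxx.
subst q; have Hl := perm_to_rem ql; set l1 := rem _ l in Hl.
have {}D := dl_perm (perm_refl _) Hl D; have [_ M' _ _ _ _ Lk' _ _] := D.
have [/= _ Eap sap] := Lk' _ (mem_head _ _).
have [W T] := TZ.
have [_ Wo] := nfp_threads M' W (mem_head _ _).
have Eb : map fst bs = obj a.1 by move: Wo; rewrite /out process_Out => /eqP.
have Hp : perm_eq (map snd ((out a bs, out a bs) :: tr) ++ lnks ((a, p) :: l1))
   (feed (AIn a bs) ++ link a p :: (map snd tr ++ lnks l1)).
  by rewrite -[feed _]/([:: out a bs]) -[lnks (_ :: _)]/(link a p :: lnks l1) map_cons; perm_count.
have [Z1 [K1 K2]] := nfp_red M' W Hp (link_trans sap Eb) isT.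
have H1 : nfp Z1 (cs ++ qs) (out p bs :: map snd tr ++ lnks l1).
  have Ht : nfp (out p bs) [::] [:: out p bs] by apply: nfp_thread.
  by have := K2 _ _ Ht isT; rewrite cats0.
have D1 := dl_fire T W D H1.
have TZ1 := red_wtyped TZ Cs K1.
have [|Z2 [l2 [R2 D2]]] := IH Z1 p l1 _ TZ1 Cs D1.
  by move: (perm_size Hl) lt_n => /= ->; rewrite ltnS.
exists Z2, l2; rewrite Eap; split=> //.
by apply: rt_trans R2; apply: rt_step.
Qed.

Lemma ren_out_inv f P a bs : ren f P = out a bs ->
  exists a0 bs0, [/\ P = out a0 bs0, f a0 = a & map f bs0 = bs].
Proof.
case: P => //= v vs [Ev Evs]; have [a0 -> ->] := renv_Free_inv Ev.
suff [bs0 [-> Eb]] : exists bs0, vs = map (@Free S) bs0 /\ map f bs0 = bs by exists a0, bs0.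
elim: vs bs Evs {Ev} => [|w vs IH] [|b bs] //=; first by exists [::].
case=> Ew /IH [bs0 [-> <-]]; have [b0 -> ->] := renv_Free_inv Ew.
by exists (b0 :: bs0).
Qed.

Lemma exp_out a bs U : exp [::] (out a bs) U -> is_thread U -> U = out a bs.
Proof. by case/exp_Out_inv => [->|[bs0 [p [_ _ ->]]]]. Qed.

Lemma exp_to_out P a bs : exp [::] P (out a bs) -> P = out a bs.
Proof. by rewrite /out; move EU: (Out _ _) => U H; case: H EU. Qed.

(** A private name that still occurs has its link, which owns the input tag; by linearity no other
    thread can input there. *)
Lemma dl_input_private X Z theta cs qs tu l s U a bs U' r :
  wtyped s Z -> dl X Z theta cs qs tu l ->
  perm_eq (map snd tu) (U :: r) -> trans U (AIn a bs) U' -> a \notin qs.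
Proof.
move=> [W T] [N M S1 O I C Lk A E] Hp Htr; apply/negP => aq.
have WU : process U.
  by case: (nfp_threads M W (_ : U \in _)); rewrite // mem_cat (perm_mem Hp) mem_head.
have aU : a \in fn U by case: (trans_fn Htr WU).
have /mapP [[q p] ql /= Eq] : a \in map fst l.
  by apply: A => //; rewrite fns_cat mem_cat (fns_perm Hp) fns_cons mem_cat aU.
subst q; have [/= _ _ sap] := Lk _ ql; have Hl := perm_to_rem ql; set l1 := rem _ l in Hl.
have M' : nfp Z (cs ++ qs) (U :: link a p :: (r ++ lnks l1)).
  apply: nfp_perm M => //; have Hl' := perm_map (fun x : name S * name S => link x.1 x.2) Hl.
  rewrite -/(lnks l) -/(lnks (_ :: _)) -[lnks (_ :: _)]/(link a p :: lnks l1) in Hl'.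
  by perm_count.
have [tts [Et Tt Un]] := nfp_linear M' T W.
case: tts Et Tt Un => [|x1 [|x2 tts]] //= [E1 E2 E3] Tt.
have T1 : typ x1.1 U by rewrite -E1; apply: Tt; rewrite inE eqxx.
have T2 : typ x2.1 (link a p) by rewrite -E2; apply: Tt; rewrite !inE eqxx orbT.
have ca := C _ aq; have [q2 _] := typ_link_inv ca sap T2.
have [/(_ ca) a1 _] := subject_reduction Htr T1 WU.
rewrite q2 cat_uniq => /and3P [_ /hasPn D _].
by have := D (a, TI); rewrite /= inE eqxx a1 => /(_ isT).
Qed.

Lemma dl_exp_in X Z theta cs qs tu l P U tr : dl X Z theta cs qs tu l ->
  perm_eq tu ((P, U) :: tr) -> exp [::] P U /\ is_thread U.
Proof. by case=> _ _ _ _ _ _ _ _ E Hp; apply: (E (P, U)); rewrite (perm_mem Hp) mem_head. Qed.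

Lemma dl_typed_right X Z theta cs qs tu l s P U tr : wtyped s Z -> dl X Z theta cs qs tu l ->
  perm_eq tu ((P, U) :: tr) -> process U /\ exists s', typ s' U.
Proof.
move=> [W T] [_ M _ _ _ _ _ _ _] Hp.
have Uin : U \in map snd tu ++ lnks l.
  by rewrite mem_cat (perm_mem (perm_map snd Hp)) mem_head.
split; first by case: (nfp_threads M W Uin).
have [tts [Et Tt _]] := nfp_linear M T W.
move: Uin; rewrite -Et => /mapP [x xt ->]; exists x.1; exact: Tt.
Qed.

Lemma dl_process_left X Z theta cs qs tu l P U tr : process X -> dl X Z theta cs qs tu l ->
  perm_eq tu ((P, U) :: tr) -> process P.
Proof.
move=> W [N _ S1 _ _ _ _ _ _] Hp; rewrite -(process_ren P S1).
case: (nfp_threads N W (_ : ren theta P \in _)) => //.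
by rewrite (perm_mem (perm_map (fun x => ren theta x.1) Hp)) mem_head.
Qed.

(** In a communication the delayed process first sends the message along its links, and only then
    can the receiver take it. *)
Lemma dl_step_left X Z theta cs qs tu l s nu G r G' X' tr0 P U tr :
  wtyped s X -> wtyped s Z -> clean s ->
  dl X Z theta cs qs tu l -> perm_eq tu (tr0 ++ (P, U) :: tr) ->
  map (fun x => ren theta x.1) tr0 = feed nu -> ren theta P = G ->
  r = map (fun x => ren theta x.1) tr ->
  trans G nu G' -> ~~ is_out nu ->
  (forall ds us, nfp G' ds us -> apart ds (cs ++ fns (map (fun x => ren theta x.1) tu)) ->
        nfp X' (cs ++ ds) (us ++ r)) ->
  exists Z' theta' cs' qs' tu' l', wtau Z Z' /\ dl X' Z' theta' cs' qs' tu' l'.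
Proof.
move=> TX TZ Cs D Hp Hfd EG Er Htr Nout cX; subst G r.
have WP : process P.
  apply: (dl_process_left TX.1 D (U := U) (tr := tr0 ++ tr)).
  by apply: perm_trans Hp _; rewrite -cat_rcons -cats1 -catA perm_catCA.
have S1 := dl_sort D.
have fid a : ~~ cont a -> theta a = a.
  by move=> ca; apply: (dl_out D); apply/negP => /(dl_cont D); rewrite (negPf ca).
(* It suffices to reach, by forwarding alone, a state in which the thread [U] can make the
   corresponding step. *)
suff step : exists Z1 l1 tr1 mu U' P', [/\ wtau Z Z1,
    dl X Z1 theta cs qs (tr1 ++ (P, U) :: tr) l1,
    map (fun x => ren theta x.1) tr1 = map (fun x => ren theta x.1) tr0 /\ map snd tr1 = feed mu,
    trans U mu U' /\ ~~ is_out mu & exp [::] P' U' /\ G' = ren theta P'].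
  have [Z1 [l1 [tr1 [mu [U' [P' [R1 D1 [F0 F1] [Ht Nm] [He EG]]]]]]]] := step.
  have TZ1 := wtau_wtyped TZ Cs R1; have [W1 T1] := TZ1.
  have M1 := dl_right_nf D1.
  have Hq : perm_eq (map snd (tr1 ++ (P, U) :: tr) ++ lnks l1)
              (feed mu ++ U :: (map snd tr ++ lnks l1)).
    by rewrite map_cat F1 /= -catA.
  have [Z2 [K1 K2]] := nfp_red M1 W1 Hq Ht Nm.
  have [WU _] : process U /\ exists s', typ s' U.
    by apply: (dl_typed_right TZ1 D1 (P := P) (tr := tr1 ++ tr)); rewrite -cat1s perm_catCA.
  have WPX : process P' by rewrite -(process_ren P' S1) -EG; case: (trans_process Htr _) => //; rewrite process_ren.
  have fU : {subset fn U' <= fns (map snd (tr1 ++ (P, U) :: tr) ++ lnks l1)}.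
    move=> x xU; rewrite (fns_perm Hq) fns_cat fns_cons.
    have := (trans_fn Ht WU).1 x xU; rewrite !mem_cat => /orP [->|]; first by rewrite orbT.
    case: mu Nm {Hq F1 K1 K2} Ht => // a bs _ Ht /=; rewrite /fns /= cats0 fnv_free_map.
    by move=> ->.
  have sub : {subset tr <= tr1 ++ (P, U) :: tr}.
    by move=> x xt; rewrite mem_cat inE xt !orbT.
  have cX' ds us : nfp (ren theta P') ds us ->
     apart ds (cs ++ fns (map (fun x => ren theta x.1) (tr1 ++ (P, U) :: tr))) ->
     nfp X' (cs ++ ds) (us ++ map (fun x => ren theta x.1) tr).
    rewrite -EG => H1 H2; apply: cX H1 _; apply: apart_subr H2 => x.
    rewrite !mem_cat; case/orP => [->//|]; rewrite (fns_perm (perm_map _ Hp)).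
    by rewrite !map_cat F0 => ->; rewrite orbT.
  have [th' [cs' [qs' [tu' [l' D2]]]]] := dl_sync D1 sub He WPX fU cX' K2.
  exists Z2, th', cs', qs', tu', l'; split=> //.
  by apply: rt_trans R1 _; apply: rt_step.
case: nu Htr Hfd Nout cX => [|a bs|//] Htr Hfd _ cX.
- case: tr0 Hp Hfd => // Hp _; rewrite cat0s in Hp.
  have [He TU] := dl_exp_in D Hp; have [WU [s' Ts']] := dl_typed_right TZ D Hp.
  have [|nu [U' [P' [K1 K2 K3 K4 K5]]]] :=
    @exp_trans_left _ theta P U (ATau S) G' [::] S1 fid He s' Ts' WU TU Htr isT; first by [].
  exists Z, l, [::], nu, U', P'; split=> //; first exact: rt_refl.
    exact: dl_perm D.
  by case: K5 => [[_ ->]|[? []]].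
- case: tr0 Hp Hfd => [|[O V] [|]] //= Hp [Eo]; have [a0 [bs0 [EO Ea Eb]]] := ren_out_inv Eo.
  have [HO TV] := dl_exp_in D Hp; rewrite EO in HO; have EV := exp_out HO TV; subst O V.
  have D0 := dl_perm Hp (perm_refl l) D.
  have [Z1 [l1 [R1 D1]]] := dl_chain (ltnSn _) TZ Cs D0; rewrite Ea in D1.
  have TZ1 := wtau_wtyped TZ Cs R1.
  have Hp1 : perm_eq ((out a bs0, out a bs0) :: (P, U) :: tr) ((P, U) :: (out a bs0, out a bs0) :: tr).
    by perm_count.
  have [He TU] := dl_exp_in D1 Hp1; have [WU [s' Ts']] := dl_typed_right TZ1 D1 Hp1.
  have [|nu [U' [P' [K1 K2 K3 K4 K5]]]] :=
    @exp_trans_left _ theta P U (AIn a bs) G' bs0 S1 fid He s' Ts' WU TU Htr isT.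
    by move=> ? ? [_ <-].
  case: K5 => [[//]|[a1 [[E1 _] E2]]]; subst nu.
  (* The receiver listens at [a1] with [theta a1 = a]. As [a1] is not private, it equals [a], where
     the message has arrived. *)
  have a1q : a1 \notin qs.
    by apply: (dl_input_private TZ1 D1 _ K1); exact: (perm_map snd Hp1).
  rewrite (dl_out D1) // in E1; subst a1.
  exists Z1, l1, [:: (out a bs0, out a bs0)], (AIn a bs0), U', P'; split=> //.
  split=> //; have Eout : ren theta (out a bs0) = ren theta (out a0 bs0).
    by rewrite /out !ren_Out -Ea (dl_out D1 (dl_img D1 a0)).
  congr [:: _]; exact: Eout.
Qed.

Lemma map_eq_cat (T1 T2 : Type) (h : T1 -> T2) (x : seq T1) (y z : seq T2) :
  map h x = y ++ z -> exists x1 x2, [/\ x = x1 ++ x2, map h x1 = y & map h x2 = z].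
Proof.
elim: y x => [|b y IH] x; first by exists [::], x.
case: x => //= a x [Ea /IH [x1 [x2 [-> <- <-]]]].
by exists (a :: x1), x2; rewrite /= Ea.
Qed.

Definition dl_related X Z := exists theta cs qs tu l, dl X Z theta cs qs tu l.

Lemma dl_left s X Z X' : wtyped s X -> wtyped s Z -> clean s -> dl_related X Z ->
  red X X' -> exists2 Z', wtau Z Z' & dl_related X' Z'.
Proof.
move=> TX TZ Cs [theta [cs [qs [tu [l D]]]]] Hred.
have [nu [G [r [G' [H1 H2 H3 H4]]]]] := red_nfp (dl_left_nf D) TX.1 Hred.
have [tu' Hp Etu] := perm_map_lift H1.
have [tr0 [[|[P U] tr] [Et E0 E1]]] := map_eq_cat Etu => //.
move: E1 => /= [EP Er]; rewrite Et in Hp.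
have [Z' [th' [cs' [qs' [tu2 [l' [R D']]]]]]] :=
  dl_step_left TX TZ Cs D Hp E0 EP (esym Er) H2 H3 H4.
by exists Z' => //; exists th', cs', qs', tu2, l'.
Qed.

(** Before substitution the output threads are the same on both sides, so the left process consumes
    the image of the message under [theta] in a single step. *)
Lemma dl_step_right theta cs qs tu l X Z Z' s nu G r G' tr0 P tr :
  wtyped s X -> wtyped s Z -> clean s ->
  dl X Z theta cs qs tu l -> perm_eq tu (tr0 ++ (P, G) :: tr) ->
  map snd tr0 = feed nu -> map fst tr0 = feed nu ->
  perm_eq r (map snd tr ++ lnks l) -> trans G nu G' -> ~~ is_out nu ->
  (forall ds us, nfp G' ds us -> apart ds ((cs ++ qs) ++ fns (map snd tu ++ lnks l)) ->
        nfp Z' ((cs ++ qs) ++ ds) (us ++ r)) ->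
  exists2 X', wtau X X' & dl_related X' Z'.
Proof.
move=> TX TZ Cs D Hp E0 E1 Hr Htr Nout cZ.
have Hp' : perm_eq tu ((P, G) :: tr0 ++ tr).
  by apply: perm_trans Hp _; rewrite -cat1s perm_catCA.
have [He TG] := dl_exp_in D Hp'; have [WG _] := dl_typed_right TZ D Hp'.
have WP := dl_process_left TX.1 D Hp'; have S1 := dl_sort D.
have [P' Ht He'] := exp_trans_right He WG TG Htr Nout.
have Ht' := trans_subst S1 Ht WP (exp_thread He TG) Nout.
have Hq : perm_eq (map (fun x => ren theta x.1) tu)
    (feed (ren_act theta nu) ++ ren theta P :: map (fun x => ren theta x.1) tr).
  rewrite -feed_ren -E1 -map_comp; apply: perm_trans (perm_map _ Hp) _.
  by rewrite map_cat.
have Nout' : ~~ is_out (ren_act theta nu) by rewrite is_out_ren.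
have [X' [K1 K2]] := nfp_red (dl_left_nf D) TX.1 Hq Ht' Nout'.
exists X'; first exact: rt_step.
have sub : {subset tr <= tu} by move=> x xt; rewrite (perm_mem Hp) mem_cat inE xt !orbT.
have fU : {subset fn G' <= fns (map snd tu ++ lnks l)}.
  move=> x xU; rewrite fns_cat mem_cat (fns_perm (perm_map snd Hp)) map_cat E0 fns_cat.
  rewrite map_cons fns_cons !mem_cat.
  have := (trans_fn Htr WG).1 x xU; rewrite !mem_cat => /orP [->|]; first by rewrite !orbT.
  case: nu Nout {Hq K1 K2 E0 E1 Ht Ht' Nout' cZ} Htr => // a bs _ Ht /=.
  by rewrite /fns /= cats0 fnv_free_map => ->.
have WP' : process P' by case: (trans_process Ht WP).
have cZ' ds us : nfp G' ds us -> apart ds ((cs ++ qs) ++ fns (map snd tu ++ lnks l)) ->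
     nfp Z' ((cs ++ qs) ++ ds) (us ++ (map snd tr ++ lnks l)).
  move=> H1 H2; apply: nfp_perm (cZ _ _ H1 H2) => //.
  by rewrite perm_cat2l.
have [th' [cs' [qs' [tu' [l' D2]]]]] := dl_sync D sub He' WP' fU K2 cZ'.
by exists th', cs', qs', tu', l'.
Qed.

Lemma dl_right s X Z Z' : wtyped s X -> wtyped s Z -> clean s -> dl_related X Z ->
  red Z Z' -> exists2 X', wtau X X' & dl_related X' Z'.
Proof.
move=> TX TZ Cs [theta [cs [qs [tu [l D]]]]] Hred.
have [nu [G [r [G' [H1 H2 H3 H4]]]]] := red_nfp (dl_right_nf D) TZ.1 Hred.
case: nu H1 H2 H3 H4 => [|a bs|//] H1 H2 H3 H4.
- case: (perm_cat_cons H1) => [[r1 K1 K2]|[r2 K1 K2]].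
  + have [tu' Hp Etu] := perm_map_lift K1.
    case: tu' Hp Etu => [|[P U] tr] // Hp /= [EU Er1]; subst U r1.
    exact: (dl_step_right (nu := ATau S) (tr0 := [::]) TX TZ Cs D Hp erefl erefl K2 H2 H3 H4).
  + have : G \in lnks l by rewrite (perm_mem K1) mem_head.
    by case/mapP => [[q p] _ EG]; move: H2; rewrite EG => /link_trans_inv [bs []].
- case: (perm_cat_cons H1) => [[r1 K1 K2]|[r2 K1 _]]; last first.
    have : Out (Free a) (map (@Free S) bs) \in lnks l by rewrite (perm_mem K1) mem_head.
    by case/mapP => [[q p] _ EG].
  have [tu' Hp Etu] := perm_map_lift K1.
  case: tu' Hp Etu => [|[O V] tr1] // Hp /= [EV Er1]; subst V r1.
  have [He _] := dl_exp_in D Hp; have EO := exp_to_out He; subst O.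
  rewrite perm_sym in K2; case: (perm_cat_cons K2) => [[r1 L1 L2]|[r2 L1 L2]].
  + have [tu' Hp' Etu'] := perm_map_lift L1.
    case: tu' Hp' Etu' => [|[P U] tr] // Hp' /= [EU Er1]; subst U r1.
    have Hq : perm_eq tu ([:: (out a bs, out a bs)] ++ (P, G) :: tr).
      by apply: perm_trans Hp _; rewrite perm_cons.
    exact: (dl_step_right (nu := AIn a bs) TX TZ Cs D Hq erefl erefl L2 H2 H3 H4).
  (* The receiver is a link: its firing is matched by no step of [X]. *)
  + have [l' Hl El] := perm_map_lift L1.
    case: l' Hl El => [|[q p] l1] // Hl /= [EG Er2].
    move: H2; rewrite -EG => /link_trans_inv [bs' [[Ea Eb] Es EG']]; subst q bs'.
    exists X; first exact: rt_refl.
    have D' := dl_perm Hp Hl D; have [W T] := TZ.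
    exists theta, cs, qs, ((out p bs, out p bs) :: tr1), l1.
    apply: (dl_fire T W D'); have Ht : nfp (out p bs) [::] [:: out p bs] by apply: nfp_thread.
    rewrite EG' in H4; have := H4 _ _ Ht isT; rewrite cats0.
    by apply: nfp_perm => //=; rewrite /lnks Er2 perm_cons.
Qed.

Lemma dl_wtau_left s X Z X' : wtyped s X -> wtyped s Z -> clean s -> dl_related X Z ->
  wtau X X' -> exists2 Z', wtau Z Z' & dl_related X' Z'.
Proof.
move=> TX TZ Cs D R; elim: R Z TX TZ D => {X X'} [X X' H|X|X Y X' R1 IH1 R2 IH2] Z TX TZ D.
- exact: dl_left TX TZ Cs D H.
- by exists Z => //; apply: rt_refl.
- have [Z1 K1 D1] := IH1 Z TX TZ D.
  have TY := wtau_wtyped TX Cs R1; have TZ1 := wtau_wtyped TZ Cs K1.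
  have [Z2 K2 D2] := IH2 Z1 TY TZ1 D1.
  by exists Z2 => //; apply: rt_trans K1 K2.
Qed.

Lemma dl_wtau_right s X Z Z' : wtyped s X -> wtyped s Z -> clean s -> dl_related X Z ->
  wtau Z Z' -> exists2 X', wtau X X' & dl_related X' Z'.
Proof.
move=> TX TZ Cs D R; elim: R X TX TZ D => {Z Z'} [Z Z' H|Z|Z Y Z' R1 IH1 R2 IH2] X TX TZ D.
- exact: dl_right TX TZ Cs D H.
- by exists X => //; apply: rt_refl.
- have [X1 K1 D1] := IH1 X TX TZ D.
  have TY := wtau_wtyped TZ Cs R1; have TX1 := wtau_wtyped TX Cs K1.
  have [X2 K2 D2] := IH2 X1 TX1 TY D1.
  by exists X2 => //; apply: rt_trans K1 K2.
Qed.

(** For a typed process, [type_allowed] reduces to a condition on the subject and the top of the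
    stack. *)
Lemma barb_intro s P a cs bs P' : wtyped s P -> trans P (AOut cs a bs) P' ->
  seqn s = 0 \/ outc a || cont a -> weak_barb (seqn s) P a.
Proof.
move=> [W T] H K; exists P, cs, bs, P'; split; first exact: rt_refl.
split=> //; first exact: typ_seq.
case: K => K; first by constructor 1.
by case: (s) => [|[p []] s']; [constructor 1 | constructor 3 | constructor 1].
Qed.

Lemma barb_wtau e P P' a : wtau P P' -> weak_barb e P' a -> weak_barb e P a.
Proof.
move=> R [P0 [cs [bs [P1 [R' H]]]]]; exists P0, cs, bs, P1; split=> //.
exact: rt_trans R R'.
Qed.

Lemma barb_elim e P a : weak_barb e P a -> exists P0 cs bs P1,
  [/\ wtau P P0, trans P0 (AOut cs a bs) P1 & e = 0 \/ outc a || cont a].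
Proof.
move=> [P0 [cs [bs [P1 [R [_ H K]]]]]]; exists P0, cs, bs, P1; split=> //.
by case: K => [->|//|[_ K]]; [left|right].
Qed.

(** An output of [X] at [a] is in [Z] an output at some [a0] with [theta a0 = a]. Forwarding brings
    it to [a], which is visible since the image of [theta] contains no private name. *)
Lemma dl_barb_left s X Z a : wtyped s X -> wtyped s Z -> clean s -> dl_related X Z ->
  weak_barb (seqn s) X a -> weak_barb (seqn s) Z a.
Proof.
move=> TX TZ Cs D0 /barb_elim [X0 [ds [bs [X1 [R H K]]]]].
have [Z0 RZ [theta [cs [qs [tu [l D]]]]]] := dl_wtau_left TX TZ Cs D0 R.
have TX0 := wtau_wtyped TX Cs R; have TZ0 := wtau_wtyped TZ Cs RZ.
have [ac [bs' Hin]] := output_nfp (dl_left_nf D) TX0.1 H.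
case/mapP: Hin => [[O V] xt /= /esym Eo].
have [a0 [bs0 [EO Ea Eb]]] := ren_out_inv Eo; have Hp := perm_to_rem xt.
have [HO TV] := dl_exp_in D Hp; rewrite EO in HO; have EV := exp_out HO TV; subst O V.
have [Z1 [l1 [R1 D1]]] := dl_chain (ltnSn _) TZ0 Cs (dl_perm Hp (perm_refl l) D).
rewrite Ea in D1; have TZ1 := wtau_wtyped TZ0 Cs R1.
have aq : a \notin cs ++ qs by rewrite mem_cat negb_or ac -Ea (dl_img D).
have [es [cs' [Z2 [_ Ht _ _]]]] := nfp_output (dl_right_nf D1) TZ1.1 (perm_refl _) aq.
apply: (barb_wtau (rt_trans _ _ _ _ _ RZ R1)).
exact: barb_intro TZ1 Ht K.
Qed.

Lemma dl_barb_right s X Z a : wtyped s X -> wtyped s Z -> clean s -> dl_related X Z ->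
  weak_barb (seqn s) Z a -> weak_barb (seqn s) X a.
Proof.
move=> TX TZ Cs D0 /barb_elim [Z0 [ds [bs [Z1 [R H K]]]]].
have [X0 RX [theta [cs [qs [tu [l D]]]]]] := dl_wtau_right TX TZ Cs D0 R.
have TZ0 := wtau_wtyped TZ Cs R; have TX0 := wtau_wtyped TX Cs RX.
have [ac [bs' Hin]] := output_nfp (dl_right_nf D) TZ0.1 H.
move: ac; rewrite mem_cat negb_or => /andP [ac aq].
move: Hin; rewrite mem_cat => /orP [|/mapP [[q p] _]//].
case/mapP => [[O V] xt /= EV]; subst V; have Hp := perm_to_rem xt.
have [HO _] := dl_exp_in D Hp; have EO := exp_to_out HO; subst O.
have Hq := perm_map (fun x => ren theta x.1) Hp.
rewrite map_cons /= map_Free_ren (dl_out D aq) in Hq.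
have [es [cs' [X2 [_ Ht _ _]]]] := nfp_output (dl_left_nf D) TX0.1 Hq ac.
apply: (barb_wtau RX); exact: barb_intro TX0 Ht K.
Qed.

Theorem dl_barbed s X Z : wtyped s X -> wtyped s Z -> clean s -> dl_related X Z ->
  barbed_bisimilar s X Z.
Proof.
move=> TX TZ Cs D.
exists (fun A B => [/\ wtyped s A, wtyped s B & dl_related A B \/ dl_related B A]);
  last by split=> //; left.
split.
- by move=> P Q [].
- by move=> P Q [TP TQ [H|H]]; split=> //; [right|left].
- move=> P Q [TP TQ [H|H]] P' Hr; have TP' := red_wtyped TP Cs Hr.
  + have [Q' R D'] := dl_left TP TQ Cs H Hr; exists Q' => //; split=> //; last by left.
    exact: wtau_wtyped R.
  + have [Q' R D'] := dl_right TQ TP Cs H Hr; exists Q' => //; split=> //; last by right.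
    exact: wtau_wtyped R.
- move=> P Q [TP TQ [H|H]] a; split.
  + exact: dl_barb_left H.
  + exact: dl_barb_right H.
  + exact: dl_barb_right H.
  + exact: dl_barb_left H.
Qed.

(** Initially nothing has been forwarded: the flattening starts from the identity substitution with
    [K] empty. *)
Theorem exp_barbed s X Z : wtyped s X -> clean s -> exp [::] X Z ->
  barbed_bisimilar s X Z.
Proof.
move=> TX Cs He; have [WX Ts] := TX.
have TZ : wtyped s Z by split; [apply: process_exp He WX | apply: typ_exp He].
apply: dl_barbed => //.
have sub : {subset [::] ++ map id [::] ++ fn X ++ fn (ren id X) <= fn X ++ fn (ren id X)}.
  by move=> x.
have [//|//|//|cs [qs [tu [l [th [N M A [S1 O I] [D E F]]]]]]] :=
  @flat_expansion S _ X Z (ltnSn _) [::] id _ He WX _ _ _ sub.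
rewrite renE_id in N.
exists th, cs, qs, tu, l; split=> //.
- by move=> q; rewrite -D => /mapP [x xl ->]; case: (E _ xl).
- by move=> x xl; case: (E _ xl) => cx Ex sx; split=> //; rewrite -D map_f.
- by move=> q; rewrite D.
Qed.

(** Structural congruence is the instance of the delay relation without private names and links. *)
Theorem nfp_barbed s X Z cs ts : wtyped s X -> wtyped s Z -> clean s ->
  nfp X cs ts -> nfp Z cs ts -> barbed_bisimilar s X Z.
Proof.
move=> TX TZ Cs NX NZ; apply: dl_barbed => //.
exists id, cs, [::], (map (fun t : proc S => (t, t)) ts), [::]; split=> //.
- rewrite -map_comp (eq_map (g := id)) ?map_id //.
  by move=> t /=; rewrite renE_id.
- by rewrite !cats0 -map_comp (eq_map (g := id)) ?map_id.
- move=> x /mapP [t tt ->] /=; split; first exact: exp_refl.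
  by case: (nfp_threads NX TX.1 tt).
Qed.

End DelayLaw.

(** * Discreet contexts *)

Section Discreet.

Variable S : sorting.

Implicit Types (s t u : stack S) (p q a b c : name S) (bs cs ds : seq (name S))
  (P Q R : proc S) (mu : action S) (v w : var S) (G : seq (seq S)) (ss : seq S).

Lemma bodyP ss P : reflect
  (forall j k, onth ss j = Some k -> is_cont (ctl k) -> ~~ in_output_object (Bound S 0 j) P)
  (discreet_body ss P).
Proof.
apply: (iffP allP) => H.
- move=> j k Ej ck; have := H j; rewrite mem_iota /= add0n Ej ck; apply.
  by rewrite ltnNge; apply/negP => /onth_default E; rewrite E in Ej.
- move=> j _; case E: (onth ss j) => [k|] //; apply/implyP; exact: H E.
Qed.

Lemma mem_map_shift v vs : (shiftv v \in map (@shiftv S) vs) = (v \in vs).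
Proof. by apply: mem_map; move=> [a|i j] [b|i' j'] //= [] // -> ->. Qed.

Lemma shiftv_bound v j : (shiftv v == Bound S 0 j) = false.
Proof. by case: v => [a|i k]; apply/eqP. Qed.

(** Every output that carries a continuation is delayed, so the continuation actually sent is bound
    by the restriction of the delay, and is neither free nor bound by an input. *)
Lemma exp_discreet P : forall G, wf G P -> exists P', [/\ exp G P P', discreet_inputs P'
  & forall v k, vsort G v = Some k -> is_cont (ctl k) -> ~~ in_output_object v P'].
Proof.
elim: P => [a bs|a ss P IH|P IHP Q IHQ|k P IH||a ss P IH|P IH|v w P IH|P IHP Q IHQ] G /=.
- case Ea: (vsort G a) => [s|//] /eqP E.
  have := objP s; case: ifP => os.
  + case=> ss [t [Es ct nss]]; rewrite Es in E.
    case: (lastP bs) E => [|vs v]; first by case: (ss).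
    rewrite !map_rcons => /rcons_inj [Evs Ev].
    have nvs w k : vsort G w = Some k -> is_cont (ctl k) -> w \notin vs.
      move=> Ew ck; apply/negP => wv; have := map_f (vsort G) wv.
      rewrite Evs Ew => /mapP [k' kss [Ek]]; subst k'.
      by have /negP := allP nss _ kss.
    exists (delayed v a vs t); split; first exact: E_link.
    (* Forwarding is itself discreet: the tuple received at a continuation contains no
       continuation. *)
    * rewrite /= andbT; apply/bodyP => j k Ej ck.
      have := objP t; case: (ctl t) ct => //= _ /allP /(_ k).
      by rewrite ck (mem_onth Ej) => /(_ isT).
    * move=> w k Ew ck /=; rewrite mem_rcons inE shiftv_bound mem_map_shift /=.
      rewrite (negbTE (nvs _ _ Ew ck)) /=; apply/mapP => [[j _]].
      by move/eqP; rewrite shiftv_bound.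
  + move=> /allP nss; exists (Out a bs); split=> //; first exact: E_out.
    move=> w k Ew ck /=; apply/negP => wb; have := map_f (vsort G) wb.
    rewrite E Ew => /mapP [k' kss [Ek]]; subst k'.
    by have /negP := nss _ kss.
- move=> /andP [_ /IH [P' [H1 H2 H3]]]; exists (Rep a ss P'); split; first exact: E_rep.
  + by rewrite /= H2 andbT; apply/bodyP => j k Ej ck; apply: H3 ck; rewrite /= Ej.
  + by move=> v k Ev ck /=; apply: H3 ck; rewrite vsort_shift.
- move=> /andP [/IHP [P' [H1 H2 H3]] /IHQ [Q' [K1 K2 K3]]]; exists (Par P' Q').
  split=> [||v k Ev ck /=]; [exact: E_par|by rewrite /= H2 K2|].
  by rewrite negb_or (H3 _ _ Ev ck) (K3 _ _ Ev ck).
- move=> /IH [P' [H1 H2 H3]]; exists (Nu k P'); split=> //; first exact: E_nu.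
  by move=> v k' Ev ck /=; apply: H3 ck; rewrite vsort_shift.
- by move=> _; exists (Nil S); split=> //; apply: E_nil.
- move=> /andP [_ /IH [P' [H1 H2 H3]]]; exists (In a ss P'); split; first exact: E_in.
  + by rewrite /= H2 andbT; apply/bodyP => j k Ej ck; apply: H3 ck; rewrite /= Ej.
  + by move=> v k Ev ck /=; apply: H3 ck; rewrite vsort_shift.
- by move=> /IH [P' [H1 H2 H3]]; exists (Tau P'); split=> //; apply: E_tau.
- move=> /and4P [_ _ _ /IH [P' [H1 H2 H3]]]; exists (Match v w P'); split=> //.
  exact: E_match.
- move=> /and4P [_ _ /IHP [P' [H1 H2 H3]] /IHQ [Q' [K1 K2 K3]]]; exists (Sum P' Q').
  split=> [||v k Ev ck /=]; [exact: E_sum|by rewrite /= H2 K2|].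
  by rewrite negb_or (H3 _ _ Ev ck) (K3 _ _ Ev ck).
Qed.

Lemma discreet_exp R : process R -> exists2 R', exp [::] R R' & discreet R'.
Proof.
move=> /exp_discreet [R' [H1 H2 H3]]; exists R' => //; split=> // p cp.
exact: H3 cp.
Qed.

Lemma output_object_open_inv k bs P : forall v, in_output_object v (open_rec k bs P) ->
  in_output_object v P \/
  exists j p, [/\ onth bs j = Some p, v = Free p & in_output_object (Bound S k j) P].
Proof.
elim: P k => [a vs|a ss P IH|P IHP Q IHQ|x P IH||a ss P IH|P IH|a b P IH|P IHP Q IHQ] k v //=;
  try by move=> /IH.
- case/mapP => w wv Ev; case: w wv Ev => [c|i j] /= wv; first by move=> ->; left.
  case: eqP => [Ei|_] Ev; last by rewrite Ev; left.
  case E: (onth bs j) Ev => [c|] Ev; last by left; rewrite Ev.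
  by right; exists j, c; rewrite -Ei.
- by move=> /IH [H|[j [p [H1 H2 H3]]]]; [left|right; exists j, p; split=> //; case: v H2 => //= ? [->]].
- by case/orP => [/IHP|/IHQ] [H|[j [p [H1 H2 H3]]]];
    [left|right; exists j, p|left|right; exists j, p]; rewrite ?H ?H3 ?orbT.
- by move=> /IH [H|[j [p [H1 H2 H3]]]]; [left|right; exists j, p; split=> //; case: v H2 => //= ? [->]].
- by move=> /IH [H|[j [p [H1 H2 H3]]]]; [left|right; exists j, p; split=> //; case: v H2 => //= ? [->]].
- by case/orP => [/IHP|/IHQ] [H|[j [p [H1 H2 H3]]]];
    [left|right; exists j, p|left|right; exists j, p]; rewrite ?H ?H3 ?orbT.
Qed.

Lemma output_object_close_inv k c P : forall v, in_output_object v (close_rec k c P) ->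
  v = Bound S k 0 \/ v <> Free c /\ in_output_object v P.
Proof.
elim: P k => [a vs|a ss P IH|P IHP Q IHQ|x P IH||a ss P IH|P IH|a b P IH|P IHP Q IHQ] k v //=;
  try by move=> /IH.
- case/mapP => w wv Ev; case: w wv Ev => [b|i j] /= wv; last by move=> ->; right.
  by case: eqP => [_ ->|n ->]; [left|right; split=> // [[]]].
- by case/IH => [|[H1 H2]]; [case: v => //= i j [-> ->]; left|right; split=> // E; rewrite E in H1].
- by case/orP => [/IHP|/IHQ] [->|[H1 ->]]; rewrite ?orbT; [left|right|left|right].
- by case/IH => [|[H1 H2]]; [case: v => //= i j [-> ->]; left|right; split=> // E; rewrite E in H1].
- by case/IH => [|[H1 H2]]; [case: v => //= i j [-> ->]; left|right; split=> // E; rewrite E in H1].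
- by case/orP => [/IHP|/IHQ] [->|[H1 ->]]; rewrite ?orbT; [left|right|left|right].
Qed.

Lemma discreet_body_open k bs ss P :
  discreet_body ss P -> discreet_body ss (open_rec k bs P).
Proof.
move=> /bodyP H; apply/bodyP => j x Ej cx; apply/negP => /output_object_open_inv.
by case=> [K|[? [? []]]//]; have /negP := H _ _ Ej cx.
Qed.

Lemma discreet_inputs_open k bs P : discreet_inputs P -> discreet_inputs (open_rec k bs P).
Proof.
elim: P k => [a bs'|a ss P IH|P IHP Q IHQ|x P IH||a ss P IH|P IH|a b P IH|P IHP Q IHQ] k //=;
  try exact: IH; by case/andP => H1 H2; rewrite ?discreet_body_open ?IH ?IHP ?IHQ.
Qed.

Lemma discreet_inputs_close k c P : discreet_inputs P -> discreet_inputs (close_rec k c P).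
Proof.
have body ss k' R : discreet_body ss R -> discreet_body ss (close_rec k'.+1 c R).
  move=> /bodyP H; apply/bodyP => j x Ej cx.
  by apply/negP => /output_object_close_inv [//|[_ K]]; have /negP := H _ _ Ej cx.
elim: P k => [a bs'|a ss P IH|P IHP Q IHQ|x P IH||a ss P IH|P IH|a b P IH|P IHP Q IHQ] k //=;
  try exact: IH; by case/andP => H1 H2; rewrite ?body ?IH ?IHP ?IHQ.
Qed.

Lemma discreet_inputs_nus cs P : discreet_inputs P -> discreet_inputs (nus cs P).
Proof. by elim: cs => //= c cs IH /IH; apply: discreet_inputs_close. Qed.

Lemma trans_discreet_inputs P mu P' : trans P mu P' -> discreet_inputs P ->
  discreet_inputs P'.
Proof.
elim=> {P mu P'} //=.
- by move=> a ss P bs _ /andP [_]; apply: discreet_inputs_open.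
- by move=> a ss P bs _ /andP [H1 H2]; rewrite discreet_inputs_open // H1.
- by move=> P Q mu P' _ IH /andP [/IH].
- by move=> P Q mu P' _ IH /andP [_ /IH].
- by move=> P Q mu P' _ IH _ /andP [/IH -> ->].
- by move=> P Q mu P' _ IH _ /andP [-> /IH ->].
- move=> P Q cs a bs P' Q' _ IHP _ IHQ _ /andP [/IHP H1 /IHQ H2].
  by apply: discreet_inputs_nus; rewrite /= H1 H2.
- move=> P Q cs a bs P' Q' _ IHP _ IHQ _ /andP [/IHP H1 /IHQ H2].
  by apply: discreet_inputs_nus; rewrite /= H1 H2.
- by move=> a P mu P' _ _ IH _ H; apply/discreet_inputs_close/IH/discreet_inputs_open.
- by move=> c P cs1 cs2 a bs P' _ _ IH _ _ _ H; apply/IH/discreet_inputs_open.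
Qed.

Lemma output_names_nus cs P p : output_names (nus cs P) p -> p \notin cs /\ output_names P p.
Proof.
elim: cs => [//|c cs IH]; rewrite nus_cons => /output_object_close_inv [//|[E /IH [H1 H2]]].
by rewrite inE negb_or H1 andbT; split=> //; apply/eqP => Ep; rewrite Ep in E.
Qed.

Lemma output_names_open1 c P p : output_names (open [:: c] P) p ->
  p = c \/ output_names P p.
Proof.
case/output_object_open_inv => [H|[j [q [/mem_onth E [->] _]]]]; first by right.
by left; move: E; rewrite inE => /eqP.
Qed.

Lemma output_names_in bs P p : discreet_body (map fst bs) P -> cont p ->
  output_names (open bs P) p -> output_names P p.
Proof.
move=> /bodyP H cp /output_object_open_inv [//|[j [q [Ej [Eq] K]]]]; subst q.
by have := H j p.1; rewrite onth_map Ej K => /(_ erefl cp).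
Qed.

(* A received continuation never becomes the object of an output, so new ones are extruded. *)
Lemma trans_output_names P mu P' : trans P mu P' -> discreet_inputs P ->
  forall p, cont p -> output_names P' p -> output_names P p \/ p \in bn mu.
Proof.
rewrite /output_names; elim=> {P mu P'} //=.
- move=> a ss P bs <- /andP [H _] p cp; left.
  exact: output_names_in H cp _.
- move=> a ss P bs <- /andP [H _] p cp /orP [K|K]; left=> //.
  exact: output_names_in H cp K.
- by move=> P _ p _; left.
- by move=> P Q mu P' _ IH /andP [/IH H _] p cp /(H p cp) [->|]; [left|right].
- by move=> P Q mu P' _ IH /andP [_ /IH H] p cp /(H p cp) [->|]; [left; rewrite orbT|right].
- move=> P Q mu P' _ IH _ /andP [/IH H _] p cp /orP [/(H p cp) [->|]|->]; rewrite ?orbT; by [left|right].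
- move=> P Q mu P' _ IH _ /andP [_ /IH H] p cp /orP [->|/(H p cp) [->|]]; rewrite ?orbT; by [left|right].
- move=> P Q cs a bs P' Q' _ IHP _ IHQ _ /andP [/IHP H1 /IHQ H2] p cp.
  move=> /output_names_nus [/negbTE pc] /orP [/(H1 p cp) [->|]|/(H2 p cp) [->|]] //;
    by [left; rewrite ?orbT|rewrite pc].
- move=> P Q cs a bs P' Q' _ IHP _ IHQ _ /andP [/IHP H1 /IHQ H2] p cp.
  move=> /output_names_nus [/negbTE pc] /orP [/(H1 p cp) [->|]|/(H2 p cp) [->|]] //;
    by [left; rewrite ?orbT|rewrite pc].
- move=> a P mu P' _ _ IH _ H p cp /output_object_close_inv [//|[pa /IH]].
  case=> [|//|/output_names_open1 [E|]|]; try by [left|right].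
    exact: discreet_inputs_open.
  by rewrite E in pa.
- move=> c P cs1 cs2 a bs P' _ _ IH _ _ _ H p cp /IH [|//|/output_names_open1 [->|]|].
  + exact: discreet_inputs_open.
  + by right; rewrite mem_cat mem_head orbT.
  + by left.
  + by rewrite !mem_cat inE => /orP [] ->; right; rewrite ?orbT.
Qed.

Lemma trans_output_object P mu P' : trans P mu P' -> is_out mu -> process P ->
  forall b, b \in object mu -> b \in bn mu \/ output_names P b.
Proof.
rewrite /output_names; elim=> {P mu P'} //=.
- by move=> a bs _ _ b bb; right; rewrite mem_map_Free.
- by move=> a P mu P' _ IH o /and4P [_ _ _ W]; apply: IH.
- move=> P Q mu P' _ IH o /and4P [_ _ W _] b /(IH o W b) [->|->]; by [left|right].
- move=> P Q mu P' _ IH o /and4P [_ _ _ W] b /(IH o W b) [->|->]; by [left|right; rewrite orbT].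
- move=> P Q mu P' _ IH _ o /andP [W _] b /(IH o W b) [->|->]; by [left|right].
- move=> P Q mu P' _ IH _ o /andP [_ W] b /(IH o W b) [->|->]; by [left|right; rewrite orbT].
- move=> a P mu P' _ H IH aN o W b bm; rewrite process_Nu in W.
  case: (IH o W b bm) => [->|/output_names_open1 [E|]]; try by [left|right].
  by move: aN; rewrite -E; case: (mu) bm => [|x l|l x l2] /= bm; rewrite ?mem_cat ?inE ?bm ?orbT.
- move=> c P cs1 cs2 a bs P' _ _ IH _ _ _ _ W b bb; rewrite process_Nu in W.
  case: (IH isT W b bb) => [|/output_names_open1 [->|]]; last by right.
  + by rewrite !mem_cat inE => /orP [] ->; left; rewrite ?orbT.
  + by left; rewrite mem_cat mem_head orbT.
Qed.

Lemma discreet_output P cs a bs P' p : discreet P -> process P ->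
  trans P (AOut cs a bs) P' -> cont p -> p \in bs -> p \in cs.
Proof.
move=> [H _] W K cp pb; have [//|E] := trans_output_object K isT W pb.
by have /negP := H p cp.
Qed.

Lemma discreet_trans P mu P' : discreet P -> trans P mu P' -> ~~ is_out mu -> discreet P'.
Proof.
move=> [H1 H2] K o; split; last exact: trans_discreet_inputs K H2.
move=> p cp; apply/negP => /(trans_output_names K H2 cp) [E|].
- by have /negP := H1 p cp.
- by case: (mu) o.
Qed.

(** After extruding [p] the process has [(p, TI)] on top. To send [p] once more it would need
    [(p, TO)] further down, which no stack allows. *)
Lemma discreet_extrusion s P cs a bs P' s1 : discreet P -> process P -> typ s1 P' ->
  trans P (AOut cs a bs) P' -> out_step s cs a bs s1 -> discreet P'.
Proof.
move=> D W T K O; have [W' A] := trans_process K W.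
have [_ [_ _ _ sub _]] := trans_fn K W.
split; last by case: D => _; apply: trans_discreet_inputs K.
move=> p cp; apply/negP => Op; have := typ_stk T.
have := (typ_names T W' cp).2 Op; have [H1 H2] := D.
case: (trans_output_names K H2 cp Op) => [E|/sub pb]; first by have /negP := H1 p cp.
have [oa Ep] := carried_cont A pb cp.
case: O => [s2 ca|ia|_ lc _|s2 _ /negP [] ]; last by rewrite -Ep (discreet_output D W K cp pb).
- by rewrite (cont_outc ca) in oa.
- by rewrite (inc_outc ia) in oa.
- by rewrite -Ep inE /= => /orP [/eqP//|H] /and5P [_ _ _ /negP].
Qed.

(** Such an input is typed under the output tag of the continuation of its body, so its thread has
    [seqn] 1, and [seqn] is additive. *)
Lemma input_seqn P mu P' : trans P mu P' -> forall s a bs, mu = AIn a bs -> inc a ->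
  typ s P -> process P -> seqn s = 1.
Proof.
elim=> {P mu P'} //.
- move=> a ss P bs _ s _ _ [<- _] ia T _; inversion T; subst=> //;
  match goal with
  | H : is_true (outc ?x), K : is_true (inc ?x) |- _ => by rewrite (outc_inc H) in K
  | H : is_true (cont ?x), K : is_true (inc ?x) |- _ => by rewrite (cont_inc H) in K
  end.
- move=> a ss P bs E s _ _ [<- _] ia T W; have [_ oa _] := typ_Rep_inv T W E.
  by rewrite (outc_inc oa) in ia.
- move=> a P mu P' _ IH s b bs E ib /typ_Match_inv [-> _ _ T] /and4P [_ _ _ W].
  exact: IH E ib T W.
- by move=> P Q mu P' _ IH s b bs E ib /typ_Sum_inv [T _] /and4P [_ _ W _]; apply: IH E ib T W.
- by move=> P Q mu P' _ IH s b bs E ib /typ_Sum_inv [_ T] /and4P [_ _ _ W]; apply: IH E ib T W.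
- move=> P Q mu P' _ IH _ u b bs E ib /typ_Par_inv [s [t [T1 T2 Sh St]]] /andP [W _].
  have := IH _ _ _ E ib T1 W; have := seqn_shuffle Sh St (typ_stk T1) (typ_stk T2).
  by have := seqn_le1 u; lia.
- move=> P Q mu P' _ IH _ u b bs E ib /typ_Par_inv [s [t [T1 T2 Sh St]]] /andP [_ W].
  have := IH _ _ _ E ib T2 W; have := seqn_shuffle Sh St (typ_stk T1) (typ_stk T2).
  by have := seqn_le1 u; lia.
- move=> a P mu P' aP _ IH _ s b bs E ib T W; have [s0 T0 N] := typ_Nu_inv T W aP.
  have [_ _ <-] := nu_stack_stk N (typ_stk T0); apply: IH E ib T0 _.
  by rewrite -process_Nu.
Qed.

End Discreet.

(** * Barbed bisimilarity in static contexts *)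

Section Restrictions.

Variable S : sorting.

Implicit Types (s t u : stack S) (p q a b c : name S) (bs cs ds L : seq (name S))
  (P Q R X Y Z W : proc S) (mu : action S).

Lemma open_close_swap a c X : process X -> a \notin fn (close_rec 0 c X) ->
  ren (swap a c) (open [:: a] (close_rec 0 c X)) = X.
Proof.
move=> WX aX; rewrite open_swap ?open_nu //.
by rewrite fn_close mem_filter /= eqxx.
Qed.

Lemma fn_open_close a c X x : x \in fn (open [:: a] (close_rec 0 c X)) -> x = c -> x = a.
Proof.
by move=> /mem_fn_open1 /orP [|/eqP //]; rewrite fn_close mem_filter => /andP [/eqP].
Qed.

(** The rule opens the restriction with any fresh [a]; swapping [a] with [c] turns its premise into
    a step of [X] itself. *)
Lemma nu_red_inv c X Y : process X -> red (nu c X) Y -> exists2 X', red X X' & Y = nu c X'.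
Proof.
move=> WX; rewrite /red; move EN: (nu c X) => N; move Em: (ATau S) => mu H.
case: H EN Em => // a P mu' P' aP K _ [Es EP] Em; subst P mu'.
have Hs := swap_sort (esym Es); have := trans_ren (@swap_inj _ a c) Hs K.
rewrite open_close_swap // => K'; exists (ren (swap a c) P') => //.
rewrite nu_swap // fn_nu mem_filter; apply/negP => /andP [/= ca cP'].
have WO : process (open [:: a] (close_rec 0 c X)).
  by rewrite -(process_ren _ Hs) open_close_swap.
have [sub _] := trans_fn K WO; have := sub c cP'; rewrite cats0 => cO.
by rewrite -(fn_open_close cO erefl) eqxx in ca.
Qed.

Lemma red_nu c X X' : process X -> red X X' -> red (nu c X) (nu c X').
Proof.
move=> WX H; apply: T_res => //; first by rewrite fn_close mem_filter /= eqxx.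
by rewrite open_nu.
Qed.

Lemma red_process X X' : process X -> red X X' -> process X'.
Proof. by move=> W H; case: (trans_process H W). Qed.

Lemma wtau_process X X' : process X -> wtau X X' -> process X'.
Proof. by move=> W H; elim: H W => // [x y H W|x y z _ IH1 _ IH2 W]; [exact: red_process H|auto]. Qed.

Lemma nus_red_inv cs X Y : process X -> red (nus cs X) Y ->
  exists2 X', red X X' & Y = nus cs X'.
Proof.
move=> WX; elim: cs Y => [|c cs IH] Y; first by exists Y.
rewrite nus_cons => /nu_red_inv [|Y' /IH [X' H ->] ->]; first exact: process_nus.
by exists X'.
Qed.

Lemma red_nus cs X X' : process X -> red X X' -> red (nus cs X) (nus cs X').
Proof.
by move=> WX H; elim: cs => // c cs IH; rewrite !nus_cons; apply: red_nu IH; apply: process_nus.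
Qed.

Lemma wtau_map (f : proc S -> proc S) X X' :
  (forall Y Y', process Y -> red Y Y' -> red (f Y) (f Y')) -> process X -> wtau X X' ->
  wtau (f X) (f X').
Proof.
move=> Hf W H; elim: H W => [x y H W|x|x y z R1 IH1 R2 IH2 W].
- exact/rt_step/Hf.
- by move=> _; apply: rt_refl.
- by apply: rt_trans (IH1 W) (IH2 _); apply: wtau_process R1.
Qed.

Lemma wtau_fill cs R Q Q' : process R -> process Q -> wtau Q Q' ->
  wtau (nus cs (Par R Q)) (nus cs (Par R Q')).
Proof.
move=> WR; apply: (@wtau_map (fun Q => nus cs (Par R Q))) => Y Y' WY H.
by apply: red_nus; [rewrite /process /= (_ : wf _ R) // |apply: T_parR].
Qed.

Lemma wtau_fn Q Q' : process Q -> wtau Q Q' -> {subset fn Q' <= fn Q}.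
Proof.
move=> W H; elim: H W => [x y H W z zy|x _ z|x y z R1 IH1 _ IH2 W k kz].
- by have [sub _] := trans_fn H W; have := sub z zy; rewrite cats0.
- by [].
- by apply: IH1 => //; apply: IH2 kz; apply: wtau_process R1.
Qed.

(** Barbs without the typing condition, which [barb_intro] restores. *)
Definition barb X a := exists cs bs X', trans X (AOut cs a bs) X'.

Lemma output_fresh P cs a bs P' L : trans P (AOut cs a bs) P' -> process P ->
  exists ds es P1, trans P (AOut ds a es) P1 /\ apart ds L.
Proof.
move=> H W; have [_ [aP _ U _ fr]] := trans_fn H W.
have [f [f' [F fid fL]]] := @fresh_renaming S cs (fn P) L U fr.
have := trans_ren (renaming_inj F) (renaming_sort F) H.
rewrite ren_id //= fid // => K; do 3!eexists; split; first exact: K.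
by apply/apartP => _ /mapP [x xc ->]; apply: fL.
Qed.

(** The bound names of the output are first moved away from [c]; then [c] is extruded or kept,
    according to whether it is sent. *)
Lemma barb_nu c X a : process X -> a != c -> barb X a -> barb (nu c X) a.
Proof.
move=> W ac [cs [bs [X' H]]]; have [ds [es [X1 [K A]]]] := output_fresh [:: c] H W.
have cd : c \notin ds by move: A; rewrite apart_sym => /andP [].
have cX : c \notin fn (close_rec 0 c X) by rewrite fn_close mem_filter /= eqxx.
rewrite -(open_nu c W) in K; case: (boolP (c \in es)) => ce.
- exists (c :: ds), es, X1; apply: (@T_open _ c _ [::] ds) => //.
  by rewrite eq_sym.
- exists ds, es, (nu c X1); apply: T_res => //=.
  by rewrite mem_cat inE !negb_or cd eq_sym ac.
Qed.

Lemma barb_nu_inv c X a : process X -> barb (nu c X) a -> a != c /\ barb X a.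
Proof.
move=> W [cs [bs [X' H]]].
have key x P' ds : x.1 = c.1 -> x \notin fn (close_rec 0 c X) -> a != x ->
    trans (open [:: x] (close_rec 0 c X)) (AOut ds a bs) P' -> a != c /\ barb X a.
  move=> Es xX ax K; have Hs := swap_sort Es.
  have WO : process (open [:: x] (close_rec 0 c X)).
    by rewrite -(process_ren _ Hs) open_close_swap.
  have [_ [aO _ _ _ _]] := trans_fn K WO.
  have ac : a != c by apply/eqP => /(fn_open_close aO) E; rewrite E eqxx in ax.
  split=> //; have := trans_ren (@swap_inj _ x c) Hs K.
  by rewrite open_close_swap //= swap_out // => K'; do 3!eexists; exact: K'.
move: H; move EN: (nu c X) => N; move Em: (AOut cs a bs) => mu H.
case: H EN Em => //.
- move=> x P mu' P' xP K xN [Es EP] Em; subst P mu'.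
  apply: key K => //; apply/eqP => E; move: xN.
  by rewrite /= mem_cat inE E eqxx orbT.
- move=> x P c1 c2 a' bs' P' xP K xa _ _ [Es EP] [_ Ea Eb]; subst P a' bs'.
  by apply: key K => //; rewrite eq_sym.
Qed.

Lemma barb_nus cs X a : process X -> barb X a -> a \notin cs -> barb (nus cs X) a.
Proof.
move=> W H; elim: cs => // c cs IH; rewrite nus_cons inE negb_or => /andP [ac /IH].
by apply: barb_nu => //; apply: process_nus.
Qed.

Lemma barb_nus_inv cs X a : process X -> barb (nus cs X) a -> a \notin cs /\ barb X a.
Proof.
move=> W; elim: cs => // c cs IH; rewrite nus_cons.
move=> /barb_nu_inv [|ac /IH [H1 H2]]; first exact: process_nus.
by rewrite inE negb_or ac H1.
Qed.

Lemma barb_parL P Q a : process P -> barb P a -> barb (Par P Q) a.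
Proof.
move=> W [cs [bs [P' H]]]; have [ds [es [P1 [K A]]]] := output_fresh (fn Q) H W.
by exists ds, es, (Par P1 Q); apply: T_parL => //; rewrite /= -apart_disjoint.
Qed.

Lemma barb_parR P Q a : process Q -> barb Q a -> barb (Par P Q) a.
Proof.
move=> W [cs [bs [Q' H]]]; have [ds [es [Q1 [K A]]]] := output_fresh (fn P) H W.
by exists ds, es, (Par P Q1); apply: T_parR => //; rewrite /= -apart_disjoint.
Qed.

Lemma barb_par_inv P Q a : barb (Par P Q) a -> barb P a \/ barb Q a.
Proof.
move=> [cs [bs [X' H]]]; move: H; move EN: (Par P Q) => N; move Em: (AOut cs a bs) => mu H.
by case: H EN Em => // P1 Q1 mu' P' K _ [-> ->] Em; subst mu'; [left|right]; do 3!eexists; exact: K.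
Qed.

Lemma close_fresh k c P : c \notin fn P -> close_rec k c P = P.
Proof.
have vc v k' : c \notin fnv v -> closev k' c v = v.
  by case: v => //= a; rewrite inE eq_sym; case: eqP.
have vsc vs k' : c \notin flatten (map (@fnv S) vs) -> map (closev k' c) vs = vs.
  elim: vs => //= v vs IH; rewrite mem_cat negb_or => /andP [H1 /IH ->].
  by rewrite vc.
elim: P k => [a bs|a ss P IH|P IHP Q IHQ|x P IH||a ss P IH|P IH|a b P IH|P IHP Q IHQ] k //=;
  rewrite ?mem_cat ?negb_or; try (case/andP => H1 H2);
  try (case/andP: H2 => H2 H3); try (move=> H0); by rewrite ?vc ?vsc ?IH ?IHP ?IHQ.
Qed.

Lemma nus_stack_gone cs u s c : nus_stack cs u s -> stk u -> c \in cs -> c \notin names_of s.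
Proof.
elim: cs s => //= d cs IH s [t H N] St; have [St' _] := nus_stack_stk H St.
have [_ ds _] := nu_stack_stk N St'; rewrite inE => /orP [/eqP -> //|cc].
apply/negP => /names_tag cs'; have /negP [] := IH _ H St cc.
by case: cs' => /(nu_stack_sub N) /mem_names.
Qed.

(* Repeated names of a static context are vacuous restrictions, hence can be renamed apart. *)
Lemma nus_stack_uniq cs u s L : nus_stack cs u s -> stk u -> exists ds,
  [/\ uniq ds, nus_stack ds u s & forall X, {subset fn X <= L} -> nus cs X = nus ds X].
Proof.
elim: cs s => [|c cs IH] s /=; first by move=> -> _; exists [::].
move=> [t H N] St; have [ds [U H' E]] := IH _ H St.
case: (boolP (c \in ds)) => cd; last first.
  exists (c :: ds); split=> [||X /E EX]; [by rewrite /= cd|by exists t|].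
  by rewrite -/(nus cs X) EX.
have [St' _] := nus_stack_stk H' St; have ct := nus_stack_gone H' St cd.
have [c' [Es]] := fresh_name c.1 (L ++ ds ++ names_of t).
rewrite !mem_cat !negb_or => /and3P [c'L c'd c't].
have Est : t = s.
  case: N ct => // p xi s' cp _; rewrite /names_of map_cat mem_cat /= mem_head orbT //.
exists (c' :: ds); split=> [||X sub]; first by rewrite /= c'd.
  exists t => //; rewrite -Est; case: (boolP (cont c')) => cc; last exact: NU_plain.
  exact: NU_unused.
rewrite -/(nus cs X) E //.
change (nu c (nus ds X) = nu c' (nus ds X)).
rewrite /nu -Es !close_fresh // mem_fn_nus negb_and ?cd ?orbT //.
by apply/orP; left; apply/negP => /sub; apply/negP.
Qed.

End Restrictions.

(** * Basic properties of barbed bisimilarity *)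

Section BarbedBisimilarity.

Variable S : sorting.

Implicit Types (s : stack S) (X Y Z W : proc S).

Lemma bb_bisim s : barbed_bisimulation s (barbed_bisimilar s).
Proof.
split.
- by move=> X Y [R HR H]; case: HR => T _ _ _; apply: T.
- by move=> X Y [R HR H]; exists R => //; case: HR => _ Sy _ _; apply: Sy.
- move=> X Y [R HR H] X' K; case: (HR) => _ _ St _; have [Y' K1 K2] := St _ _ H _ K.
  by exists Y' => //; exists R.
- by move=> X Y [R HR H]; case: HR => _ _ _ Ba; apply: Ba.
Qed.

Lemma bb_refl s X : clean s -> wtyped s X -> barbed_bisimilar s X X.
Proof.
move=> C T; exists (fun X Y => X = Y /\ wtyped s X) => //; split.
- by move=> P Q [<-].
- by move=> P Q [<-].
- move=> P _ [<- TP] P' K; exists P'; first exact: rt_step.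
  by split=> //; apply: red_wtyped K.
- by move=> P _ [<- _].
Qed.

Lemma bb_sym s X Y : barbed_bisimilar s X Y -> barbed_bisimilar s Y X.
Proof. by case: (bb_bisim s) => _ H _ _; apply: H. Qed.

Lemma bb_wtyped s X Y : barbed_bisimilar s X Y -> wtyped s X /\ wtyped s Y.
Proof. by case: (bb_bisim s) => H _ _ _; apply: H. Qed.

Lemma bb_wtau s X Y X' : barbed_bisimilar s X Y -> wtau X X' ->
  exists2 Y', wtau Y Y' & barbed_bisimilar s X' Y'.
Proof.
move=> H R; elim: R Y H => [x y K|x|x y z _ IH1 _ IH2] Y H.
- by case: (bb_bisim s) => _ _ St _; apply: St K.
- by exists Y => //; apply: rt_refl.
- have [Y1 K1 /IH2 [Y2 K2 H2]] := IH1 _ H; exists Y2 => //; exact: rt_trans K1 K2.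
Qed.

Lemma bb_barb s X Y a : barbed_bisimilar s X Y ->
  weak_barb (seqn s) X a <-> weak_barb (seqn s) Y a.
Proof. by move=> H; case: (bb_bisim s) => _ _ _ Ba; apply: Ba. Qed.

Lemma bb_trans s X Y Z : barbed_bisimilar s X Y -> barbed_bisimilar s Y Z ->
  barbed_bisimilar s X Z.
Proof.
move=> H1 H2; exists (fun X Z => exists2 Y, barbed_bisimilar s X Y & barbed_bisimilar s Y Z);
  last by exists Y.
split.
- by move=> P Q [R /bb_wtyped [? _] /bb_wtyped [_ ?]].
- by move=> P Q [R /bb_sym K1 /bb_sym K2]; exists R.
- move=> P Q [R K1 K2] P' K; have [R' L1 M1] := bb_wtau K1 (rt_step _ _ _ _ K).
  by have [Q' L2 M2] := bb_wtau K2 L1; exists Q' => //; exists R'.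
- by move=> P Q [R K1 K2] a; rewrite (bb_barb _ K1); apply: bb_barb.
Qed.

End BarbedBisimilarity.

(** * Soundness of wb-bisimilarity *)

Section Soundness.

Variable S : sorting.

Implicit Types (s t u : stack S) (p q a b c : name S) (bs cs ds L : seq (name S))
  (P Q R X Y Z W : proc S) (mu : action S) (sigma : stack S).

Lemma wb_facts sigma P Q : wb_bisimilar sigma P Q ->
  [/\ discreet P, discreet Q, wtyped sigma P & wtyped sigma Q].
Proof. by move=> [R [H _ _]]; apply: H. Qed.

Lemma wb_sym sigma P Q : wb_bisimilar sigma P Q -> wb_bisimilar sigma Q P.
Proof.
move=> [R [H1 H2 H3] H]; exists (fun s Q P => R s P Q) => //; split=> //.
by move=> s Q0 P0 /H1 [].
Qed.

Lemma wb_step sigma P Q mu sigma' P' : wb_bisimilar sigma P Q ->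
  config_trans sigma P mu sigma' P' -> discreet_action sigma mu ->
  disjoint_names (bn mu) (fn Q) -> wb_answer (wb_bisimilar sigma' P') mu Q.
Proof.
move=> [R HR H] K1 K2 K3; case: (HR) => _ St _.
case: (St _ _ _ H _ _ _ K1 K2 K3).
- by move=> [Q' K K']; apply: Or31; exists Q' => //; exists R.
- move=> [x [bs [p [q [Q' [L1 L2 L3 L4 L5]]]]]]; apply: Or32.
  by exists x, bs, p, q, Q'; split=> //; exists R.
- move=> [a [bs [Q' [L1 L2 L3 L4]]]]; apply: Or33.
  by exists a, bs, Q'; split=> //; exists R.
Qed.

Lemma clean_pop s p t : clean s -> s <> (p, TO) :: (p, TI) :: t.
Proof.
move=> /allP C E; have := C p; rewrite E /= mem_head /both_tags.
by rewrite !inE !eqxx /= ?orbT => /(_ isT).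
Qed.

(** A pair consumed at the top of [u] cannot be visible in the clean stack [s]. It is thus bound by
    [cs], and popping it does not affect [s]. *)
Lemma nus_stack_close s cs ds u v v' : clean s -> nus_stack cs u s -> stk u ->
  nus_stack ds v v' -> v' = u \/ (exists p, u = (p, TO) :: (p, TI) :: v') ->
  nus_stack (cs ++ ds) v s.
Proof.
move=> C N St D H; apply: nus_stack_cat D _; case: H => [->//|[p E]].
rewrite E in N St; case: (nus_stack_pop N St) => // [[t Es _]].
by have := clean_pop C Es.
Qed.

(* As R is discreet, every continuation it sends to P is extruded, so that the inputs of P
   are discreet transitions. *)
Inductive filled s Z W : Prop :=
| Filled cs R P Q t sigma u of Z = nus cs (Par R P) & W = nus cs (Par R Q) & uniq cs
  & wtyped t R & discreet R & wb_bisimilar sigma P Q & shuffle u t sigma & stk u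
  & nus_stack cs u s.

Lemma filled_sym s Z W : filled s Z W -> filled s W Z.
Proof.
move=> [cs R P Q t sigma u -> -> U T D H Sh St N].
exact: Filled erefl erefl U T D (wb_sym H) Sh St N.
Qed.

Lemma wtyped_fill s cs R P t sigma u : wtyped t R -> wtyped sigma P ->
  shuffle u t sigma -> stk u -> nus_stack cs u s -> wtyped s (nus cs (Par R P)).
Proof.
move=> [W1 T1] [W2 T2] Sh St N; have WP : process (Par R P) by apply/andP.
by split; [exact: process_nus|apply: typ_nus N => //; apply: typ_Par Sh St].
Qed.

Lemma filled_wtyped s Z W : filled s Z W -> wtyped s Z /\ wtyped s W.
Proof.
move=> [cs R P Q t sigma u -> -> U T D /wb_facts [_ _ TP TQ] Sh St N].
by split; [apply: wtyped_fill TP Sh St N|apply: wtyped_fill TQ Sh St N].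
Qed.

(* Being up to barbed bisimilarity on the answering side only, this is sound for weak steps. *)
Definition answered s Z1 W := exists W0 W1,
  [/\ barbed_bisimilar s W W0, wtau W0 W1 & filled s Z1 W1].

Lemma answer_wtau s Z1 W W1 : clean s -> wtyped s W -> wtau W W1 -> filled s Z1 W1 ->
  answered s Z1 W.
Proof. by move=> C T R F; exists W, W1; split=> //; apply: bb_refl. Qed.

Lemma extrude_nf R Q ds a bs R' cs : trans R (AOut ds a bs) R' -> process R -> process Q ->
  apart ds (cs ++ fn Q) -> uniq cs -> exists ks ts,
    nfp (nus cs (Par R Q)) ks ts /\ nfp (nus (cs ++ ds) (Par R' (Par Q (out a bs)))) ks ts.
Proof.
move=> H WR WQ A U; have [_ [_ _ Ud _ _]] := trans_fn H WR.
have [WR' Eb] := trans_process H WR.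
have [ks [r [N1 N2 A1]]] := trans_output_nf H WR (cs ++ ds ++ fn Q ++ a :: bs).
have [ks' [ts [N3 A3]]] := nf_exists_p Q (cs ++ ds ++ ks ++ fn R ++ fn R' ++ a :: bs).
move: A1 A3 A; rewrite !apart_catr.
move=> /and4P [A11 A12 A13 A14] /and5P [A31 A32 A33 A34 /andP [A35 A36]] /andP [A21 A22].
exists (cs ++ ((ds ++ ks) ++ ks')), ((out a bs :: r) ++ ts); split.
- apply: nfp_nus => //; first by apply/andP.
  + apply: nfp_par => //; first by rewrite apart_catl A22 A13.
    by rewrite apart_catl apart_sym A32 apart_sym A33.
  + by rewrite !apart_catr apart_sym A21 apart_sym A11 apart_sym A31.
- have NO : nfp (out a bs) [::] [:: out a bs] by apply: nfp_thread.
  have WO : process (out a bs) by rewrite process_Out; apply/eqP.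
  have K : nfp (Par R' (Par Q (out a bs))) (ks ++ (ks' ++ [::])) (r ++ (ts ++ [:: out a bs])).
    apply: nfp_par => //; last 1 first.
    + by rewrite cats0 apart_sym A33.
    + by apply: nfp_par NO _ _ _ => //; [rewrite fn_Out|rewrite apart_sym].
    + change (apart ks (fn Q ++ fn (out a bs))).
      by rewrite fn_Out apart_catr A13.
    + by rewrite cats0.
  have WP : process (Par R' (Par Q (out a bs))) by apply/and3P.
  have Ucd : uniq (cs ++ ds) by rewrite cat_uniq U Ud andbT -all_predC.
  have Ac : apart (cs ++ ds) (ks ++ (ks' ++ [::])).
    by rewrite cats0 apart_catl !apart_catr !(apart_sym _ ks) !(apart_sym _ ks') A11 A12 A31 A32.
  apply: nfp_perm (nfp_nus WP K Ucd Ac); first by rewrite cats0 -!catA.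
  by rewrite perm_sym; perm_count.
Qed.

Lemma in_step_next sigma a bs s1 P' : map fst bs = obj a.1 -> in_step sigma a bs s1 ->
  next_stack sigma (AIn a bs) P' s1.
Proof.
move=> E [s2 ca ->|ia|oa]; [exact: NS_inp|exact: NS_inu|].
have [bs' [p [-> _ _]]] := carried_outc E oa; rewrite last_rcons; exact: NS_inx.
Qed.

Lemma out_step_next sigma ds a bs s1 P' : map fst bs = obj a.1 -> out_step sigma ds a bs s1 ->
  next_stack sigma (AOut ds a bs) P' s1.
Proof.
move=> E; case: (controlP a) => [ca|ia|oa].
- case=> [s2 _ ->|ia|oa|s2 oa]; [exact: NS_outp|exact: NS_outu|..];
  by rewrite (outc_cont oa) in ca.
- case=> [s2 ca ->|_|oa|s2 oa]; [exact: NS_outp|exact: NS_outu|..];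
  by rewrite (outc_inc oa) in ia.
have [bs' [p [-> _ _]]] := carried_outc E oa.
case=> [s2 ca ->|ia|_|s2 _]; rewrite ?last_rcons.
- exact: NS_outp.
- exact: NS_outu.
- by move=> pd _; apply: NS_outx_bound.
- by move=> pd ->; apply: NS_outx_free.
Qed.

Lemma out_step_seqn sigma ds a bs s1 : out_step sigma ds a bs s1 -> ~~ inc a -> seqn sigma = 1.
Proof. by case=> [s2 _ ->|-> //||s2 _ _ ->]. Qed.

Lemma config_input u t sigma R P ds a bs R' P' : wtyped t R -> discreet R ->
  wtyped sigma P -> shuffle u t sigma -> stk u ->
  trans R (AOut ds a bs) R' -> trans P (AIn a bs) P' -> apart ds (names_of u) ->
  exists t1 s1 v v', [/\ config_trans sigma P (AIn a bs) s1 P',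
    discreet_action sigma (AIn a bs), wtyped t1 R' /\ discreet R', shuffle v t1 s1 /\ stk v
    & [/\ nus_stack ds v v', v' = u \/ (exists p, u = (p, TO) :: (p, TI) :: v')
        & in_step sigma a bs s1 /\ stk s1]].
Proof.
move=> [WR TR] DR [WP TP] Sh St H K A.
have [t1 O T1] := subject_reduction H TR WR.
have [I _] := subject_reduction K TP WP.
have [WR' E] := trans_process H WR.
have [_ [_ _ Ud sub _]] := trans_fn H WR.
have Ad : {in ds, forall c, c \notin names_of u} by apply/apartP.
have [s1 [v [v' [I1 [St1 Sv] Shv N Hv]]]] :=
  comm_stack Sh St (typ_stk TR) (typ_stk TP) O I E Ud sub Ad.
have inu p : p \in names_of sigma -> p \in names_of u.
  by move=> /names_tag [] H0; [apply: (@mem_names _ p TO)|apply: (@mem_names _ p TI)];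
    rewrite (shuffle_mem Sh) mem_cat H0 orbT.
have fr p : cont p -> p \in bs -> p \notin names_of sigma.
  by move=> cp pb; apply/negP => /inu; apply/negP/Ad/(discreet_output DR WR H cp pb).
exists t1, s1, v, v'; split=> //; first 1 last.
- by split; [split|apply: discreet_extrusion H O].
split; last exact: in_step_next.
split=> //.
- split=> //; first exact: typ_seq.
  case: (boolP (inc a)) => ia; first case E1: (seqn sigma) => [|[|n]].
  + exact: Or31.
  + exact: Or33.
  + by have := seqn_le1 sigma; rewrite E1.
  (* An output at a name that is not input-controlled requires control. [R] has it, so [P] has
     [seqn] 0 and the typing allows any action. *)
  + apply: Or31; have := out_step_seqn O ia.
    have := seqn_shuffle Sh St (typ_stk TR) (typ_stk TP); have := seqn_le1 u; lia.
- move=> p cp; rewrite mem_filter => /andP [_]; rewrite inE => /orP [/eqP Ep|/(fr p cp) /negbTE -> //].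
  subst p; case: I1 St1 cp => [s2 _ Es St1|ia _|oa _]; last 2 first.
  + by move=> ca; rewrite (cont_inc ca) in ia.
  + by move=> ca; rewrite (cont_outc ca) in oa.
  + move=> ca _; exists TI, s2; split=> // /names_tag as2.
    have := typ_stk TP; rewrite Es /= => /and5P [_ n1 _ n2 _].
    by case: as2 => H1; [rewrite H1 in n2|rewrite H1 in n1].
Qed.

Lemma config_output u t sigma R P ds a bs R' P' : wtyped t R -> discreet R ->
  wtyped sigma P -> discreet P -> shuffle u t sigma -> stk u ->
  trans P (AOut ds a bs) P' -> trans R (AIn a bs) R' -> apart ds (names_of u) ->
  exists t1 s1 v v', [/\ config_trans sigma P (AOut ds a bs) s1 P',
    discreet_action sigma (AOut ds a bs), wtyped t1 R' /\ discreet R', shuffle v t1 s1 /\ stk v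
    & nus_stack ds v v' /\ (v' = u \/ exists p, u = (p, TO) :: (p, TI) :: v')].
Proof.
move=> [WR TR] DR [WP TP] DP Sh St H K A.
have [s1 O T1] := subject_reduction H TP WP.
have [I IT] := subject_reduction K TR WR.
have [WP' E] := trans_process H WP; have [WR' _] := trans_process K WR.
have [_ [_ _ Ud sub _]] := trans_fn H WP.
have Ad : {in ds, forall c, c \notin names_of u} by apply/apartP.
have Sh' := shuffle_sym Sh.
have [t1 [v [v' [I1 [St1 Sv] Shv N Hv]]]] :=
  comm_stack Sh' St (typ_stk TP) (typ_stk TR) O I E Ud sub Ad.
have inu p : p \in names_of sigma -> p \in names_of u.
  by move=> /names_tag [] H0; [apply: (@mem_names _ p TO)|apply: (@mem_names _ p TI)];
    rewrite (shuffle_mem Sh) mem_cat H0 orbT.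
have pd p : cont p -> p \in bs -> p \in ds.
  by move=> cp pb; apply: discreet_output DP WP H cp pb.
exists t1, s1, v, v'; split=> //.
- split; last exact: out_step_next.
  split=> //.
  + split=> //; first exact: typ_seq.
    case: (boolP (inc a)) => ia; last case E1: (seqn sigma) => [|[|n]].
    (* To receive at an input-controlled name [R] must have control, which leaves [seqn] 0 to
       [P]. *)
    * apply: Or31; have := input_seqn K erefl ia TR WR.
      have := seqn_shuffle Sh St (typ_stk TR) (typ_stk TP); have := seqn_le1 u; lia.
    * exact: Or31.
    * apply: Or33; split=> //; case: (controlP a) => [->|ia'|->]; rewrite ?orbT //.
      by rewrite ia' in ia.
    * by have := seqn_le1 sigma; rewrite E1.
  + move=> p cp; rewrite mem_filter /= mem_cat inE => /andP [pNd /or3P [pd'|/eqP Ep|pb]].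
    * by rewrite pd' in pNd.
    * subst p; have aI := I cp; move=> _.
      case: O => [s2 _ Es|ia|oa|s2 oa]; last 3 first.
      -- by rewrite (cont_inc cp) in ia.
      -- by rewrite (cont_outc cp) in oa.
      -- by rewrite (cont_outc cp) in oa.
      exists TO, s2; split=> // /names_tag as2.
      have := typ_stk TP; rewrite Es /= => /and5P [_ n1 _ _ _].
      case: as2 => H1; first by rewrite H1 in n1.
      (* [R] inputs at [a] and so owns [(a, TI)]; the interleaving has no second copy for [P]. *)
      have := stk_uniq St; rewrite (perm_uniq (shuffle_perm Sh)) cat_uniq => /and3P [_ /hasP h _].
      by case: h; exists (a, TI) => //; rewrite Es inE H1 orbT.
    * by rewrite (pd _ cp pb) in pNd.
- by move=> p cp pb; apply/negP => /inu; apply/negP/Ad/pd.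
- split; first by split=> //; exact: IT.
  by apply: discreet_trans K _.
- by split=> //; apply: shuffle_sym.
Qed.

(** The delayed message in the second clause of the game is an expansion of the message, written
    with a chosen private name. *)
Lemma exp_link x bs p q : cont p -> q.1 = p.1 -> q \notin x :: rcons bs p ->
  exp [::] (out x (rcons bs p))
    (nu q (Par (Out (Free x) (map (@Free S) (rcons bs q))) (link q p))).
Proof.
move=> cp E qN; pose D := delayed (Free p) (Free x) (map (@Free S) bs) p.1.
have HE : exp [::] (out x (rcons bs p)) D by rewrite /out map_rcons; apply: E_link.
rewrite -(open_delayed_body x bs E) nu_open ?E //.
by rewrite -[fn _]/(fn D) (fn_exp HE) fn_Out.
Qed.

Lemma red_par_inv P Q X : red (Par P Q) X ->
  [\/ exists2 P', red P P' & X = Par P' Q, exists2 Q', red Q Q' & X = Par P Q',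
      exists cs a bs P' Q', [/\ trans P (AOut cs a bs) P', trans Q (AIn a bs) Q',
        disjoint_names cs (fn Q) & X = nus cs (Par P' Q')]
    | exists cs a bs P' Q', [/\ trans Q (AOut cs a bs) Q', trans P (AIn a bs) P',
        disjoint_names cs (fn P) & X = nus cs (Par P' Q')]].
Proof.
rewrite /red; move EN: (Par P Q) => N; move Em: (ATau S) => mu H.
case: H EN Em => //.
- by move=> P1 Q1 mu' P' K _ [-> ->] Em; subst mu'; apply: Or41; exists P'.
- by move=> P1 Q1 mu' Q' K _ [-> ->] Em; subst mu'; apply: Or42; exists Q'.
- by move=> P1 Q1 cs a bs P' Q' K1 K2 D [-> ->] _; apply: Or43; exists cs, a, bs, P', Q'.
- by move=> P1 Q1 cs a bs P' Q' K1 K2 D [-> ->] _; apply: Or44; exists cs, a, bs, P', Q'.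
Qed.

Lemma nus_cat cs ds X : nus (cs ++ ds) X = nus cs (nus ds X).
Proof. by rewrite /nus foldr_cat. Qed.

(** The residual determines the new stack: the pair on top is popped once its name has disappeared.
    The distinction is made classically. *)
Lemma config_tau sigma P P' : typ sigma P -> red P P' ->
  exists2 sigma', config_trans sigma P (ATau S) sigma' P' &
    sigma' = sigma \/ exists p, sigma = (p, TO) :: (p, TI) :: sigma'.
Proof.
move=> T H; have TT : typed_trans sigma P (ATau S) P'.
  by split=> //; split=> //; [exact: typ_seq|exact: Or32].
case: (classic (exists p s', sigma = (p, TO) :: (p, TI) :: s' /\ p \notin fn P')).
- move=> [p [s' [Es pP]]]; exists s'; last by right; exists p.
  by split=> //; rewrite Es; apply: NS_tau_pop.
- move=> Hn; exists sigma; last by left.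
  split=> //; apply: NS_tau => p s' Es; apply/negPn/negP => pP.
  by apply: Hn; exists p, s'.
Qed.

(** The pair is on top of the whole stack as well, and cleanness of [s] forces one of the [cs] to
    bind it. *)
Lemma shuffle_pop_fill cs s t sigma u p t1 : clean s -> nus_stack cs u s -> stk u ->
  shuffle u t sigma -> stk t -> stk sigma -> t = (p, TO) :: (p, TI) :: t1 ->
  exists2 u1, shuffle u1 t1 sigma /\ stk u1 & nus_stack cs u1 s.
Proof.
move=> C N St Sh Stt Sts Et; rewrite Et in Sh Stt.
have [u1 Eu Sh1] := shuffle_pop Sh St Stt Sts; rewrite Eu in N St.
exists u1; first by split=> //; do 2!move/stk_behead: St => St.
case: (nus_stack_pop N St) => // [[t' Es _]].
by have := clean_pop C Es.
Qed.

Lemma par_process P Q : process P -> process Q -> process (Par P Q).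
Proof. by move=> W1 W2; apply/andP. Qed.

Lemma filled_step s Z W Z1 : clean s -> filled s Z W -> red Z Z1 -> answered s Z1 W.
Proof.
move=> C F Hr; have [_ TW] := filled_wtyped F.
case: F TW Hr => cs R P Q t sigma u -> -> U [WR TR] DR H Sh St N TW Hr.
have [DP DQ [WP TP] [WQ TQ]] := wb_facts H.
have [X K ->] := nus_red_inv (par_process WR WP) Hr.
have bind ds R0 Q0 Q1 : disjoint_names ds (fn Q0) -> {subset fn Q1 <= fn Q0} ->
    disjoint_names ds (fn Q1).
  by move=> /disjointP H0 sub; apply/disjointP => x /H0; apply/contra/sub.
case: (red_par_inv K) => {K Hr}.
- move=> [R' K ->]; have WR' := red_process WR K.
  have DR' : discreet R' by apply: discreet_trans K _.
  have Rd : wtau (nus cs (Par R Q)) (nus cs (Par R' Q)).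
    by apply/rt_step/red_nus; [exact: par_process|exact: T_parL].
  have [T'|[p [t1 [Et T']]]] := subject_reduction K TR WR; apply: answer_wtau TW Rd _ => //.
  + exact: Filled erefl erefl U (conj WR' T') DR' H Sh St N.
  + have [u1 [Sh1 St1] N1] := shuffle_pop_fill C N St Sh (typ_stk TR) (typ_stk TP) Et.
    exact: Filled erefl erefl U (conj WR' T') DR' H Sh1 St1 N1.
- move=> [P' K ->]; have [sigma' Cf Hs] := config_tau TP K.
  (* Only the first clause of the game can answer an internal step. *)
  have [||[Q' R1 H']|[? [? [? [? [? []]]]]]//|[? [? [? []]]]//] := wb_step H Cf.
  + by [].
  + by [].
  apply: answer_wtau TW (wtau_fill cs WR WQ R1) _ => //.
  case: Hs => [Es|[p Es]].
  + by rewrite Es in H'; apply: Filled erefl erefl U (conj WR TR) DR H' Sh St N.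
  + have Sh' := shuffle_sym Sh.
    have [u1 [Sh1 St1] N1] := shuffle_pop_fill C N St Sh' (typ_stk TP) (typ_stk TR) Es.
    by apply: Filled erefl erefl U (conj WR TR) DR H' (shuffle_sym Sh1) St1 N1.
- move=> [ds0 [a [bs0 [R0 [P0 [K1 K2 dis ->]]]]]].
  (* The extruded names are moved away from [cs], [Q] and the stack: they will join the context, and
     the partner [Q] must accept them too. *)
  have [ds [bs [R' [P' [H1 H2 A -> _]]]]] :=
    comm_fresh (cs ++ fn Q ++ names_of u) K1 K2 dis WR WP.
  move: A; rewrite !apart_catr => /andP [/and3P [A1 A2 A3] A4].
  have [t1 [s1 [v [v' [Cf Da [[WR' TR'] DR'] [Shv Sv] [Nv Hv [I1 St1]]]]]]] :=
    config_input (conj WR TR) DR (conj WP TP) Sh St H1 H2 A3.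
  have Nv' := nus_stack_close C N St Nv Hv.
  have [_ [_ _ Ud _ _]] := trans_fn H1 WR.
  have Ucd : uniq (cs ++ ds) by rewrite cat_uniq U Ud andbT -all_predC.
  have [_ E] := trans_process H1 WR.
  rewrite -nus_cat; case: (wb_step H Cf Da isT).
  + move=> [Q' [Q1 [Q2 [R1 K3 R2]]] H'].
    have WQ1 := wtau_process WQ R1; have [WQ2 _] := trans_process K3 WQ1.
    apply: (@answer_wtau _ _ _ (nus (cs ++ ds) (Par R' Q'))) => //.
    * apply: rt_trans (wtau_fill cs WR WQ R1) _; rewrite !nus_cat.
      apply: (@rt_trans _ _ _ (nus cs (nus ds (Par R' Q2)))).
        apply: rt_step; apply: red_nus; first exact: par_process.
        apply: T_commL H1 K3 _; apply: bind (wtau_fn WQ R1) => //.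
        by rewrite -apart_disjoint.
      by rewrite -!nus_cat; apply: wtau_fill.
    * exact: Filled erefl erefl Ucd (conj WR' TR') DR' H' Shv Sv Nv'.
  + move=> [x [bs1 [p [q [Q' [ox [Ea Eb] [Eq qN] R1 H']]]]]]; subst a bs.
    have A5 : apart ds (cs ++ fn Q) by rewrite apart_catr A1.
    have [ks [ts [N1 N2]]] := extrude_nf H1 WR WQ A5 U.
    have [bs2 [p2 [Ep cp _]]] := carried_outc E ox.
    have [_ Ep2] := rcons_inj Ep; subst p2.
    set O := out x (rcons bs1 p) in N2.
    have WO : process O by rewrite process_Out; apply/eqP.
    (* The message contributes [(p, TO)], so next to [Q] it yields exactly the stack of [P']. *)
    have TO1 : typ s1 (Par Q O).
      have {}I1 : s1 = (p, TO) :: sigma.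
        case: I1 => [s2 cx|ix|_]; last by rewrite last_rcons.
        - by rewrite (cont_outc cx) in ox.
        - by rewrite (inc_outc ix) in ox.
      rewrite I1 in St1 *; apply: (@typ_Par _ sigma [:: (p, TO)]) => //.
      + by rewrite /O /out; apply: TY_outx.
      + by apply: SH_right; elim: (sigma) => [|e s' IH]; [exact: SH_nil|exact: SH_left].
    have TX : wtyped s (nus (cs ++ ds) (Par R' (Par Q O))).
      by apply: wtyped_fill Shv Sv Nv' => //; split=> //; apply: par_process.
    have B1 := nfp_barbed TW TX C N1 N2.
    (* The clause answers with the delayed message; the delay law exchanges it for the plain one
       within the context. *)
    have HE : exp [::] (nus (cs ++ ds) (Par R' (Par Q O)))
        (nus (cs ++ ds) (Par R' (Par Q (nu q (Par (Out (Free x) (map (@Free S) (rcons bs1 q))) (link q p)))))).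
      apply/exp_nus/E_par; first exact: exp_refl.
      apply/E_par; first exact: exp_refl.
      by apply: exp_link => //; apply: contra qN; rewrite mem_cat => ->.
    have B2 := exp_barbed TX C HE.
    do 2!eexists; split; first exact: bb_trans B1 B2.
    * apply: wtau_fill WR' _ R1; apply: par_process => //; apply: process_nu.
      apply: par_process; last exact: process_link.
      rewrite process_Out -E !map_rcons Eq; exact: eqxx.
    * exact: Filled erefl erefl Ucd (conj WR' TR') DR' H' Shv Sv Nv'.
  + move=> [a1 [bs1 [Q' [ia [Ea Eb] R1 H']]]]; subst a1 bs1.
    have A5 : apart ds (cs ++ fn Q) by rewrite apart_catr A1.
    have [ks [ts [N1 N2]]] := extrude_nf H1 WR WQ A5 U.
    set O := out a bs in N2.
    have WO : process O by rewrite process_Out; apply/eqP.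
    have TO1 : typ s1 (Par Q O).
      have {}I1 : s1 = sigma.
        by case: I1 => // [s2 ca|oa]; [rewrite (cont_inc ca) in ia|rewrite (outc_inc oa) in ia].
      rewrite I1 in St1 *; apply: (@typ_Par _ sigma [::]) => //.
      + exact: TY_outu.
      + by elim: (sigma) => [|e s' IH]; [exact: SH_nil|exact: SH_left].
    have TX : wtyped s (nus (cs ++ ds) (Par R' (Par Q O))).
      by apply: wtyped_fill Shv Sv Nv' => //; split=> //; apply: par_process.
    exists (nus (cs ++ ds) (Par R' (Par Q O))), (nus (cs ++ ds) (Par R' Q')).
    split; first exact: nfp_barbed TW TX C N1 N2.
    * by apply: wtau_fill WR' _ R1; apply: par_process.
    * exact: Filled erefl erefl Ucd (conj WR' TR') DR' H' Shv Sv Nv'.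
- move=> [ds0 [a [bs0 [R0 [P0 [K1 K2 dis ->]]]]]].
  have [ds [bs [P' [R' [H1 H2 A _ ->]]]]] :=
    comm_fresh (cs ++ fn Q ++ names_of u) K1 K2 dis WP WR.
  move: A; rewrite !apart_catr => /andP [/and3P [A1 A2 A3] A4].
  have [t1 [s1 [v [v' [Cf Da [[WR' TR'] DR'] [Shv Sv] [Nv Hv]]]]]] :=
    config_output (conj WR TR) DR (conj WP TP) DP Sh St H1 H2 A3.
  have Nv' := nus_stack_close C N St Nv Hv.
  have [_ [_ _ Ud _ _]] := trans_fn H1 WP.
  have Ucd : uniq (cs ++ ds) by rewrite cat_uniq U Ud andbT -all_predC.
  rewrite -nus_cat; case: (wb_step H Cf Da).
  + by rewrite /= -apart_disjoint.
  + move=> [Q' [Q1 [Q2 [R1 K3 R2]]] H'].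
    have WQ1 := wtau_process WQ R1; have [WQ2 _] := trans_process K3 WQ1.
    apply: (@answer_wtau _ _ _ (nus (cs ++ ds) (Par R' Q'))) => //.
    * apply: rt_trans (wtau_fill cs WR WQ R1) _; rewrite !nus_cat.
      apply: (@rt_trans _ _ _ (nus cs (nus ds (Par R' Q2)))).
        apply: rt_step; apply: red_nus; first exact: par_process.
        by apply: T_commR H2 K3 _; rewrite -apart_disjoint.
      by rewrite -!nus_cat; apply: wtau_fill.
    * exact: Filled erefl erefl Ucd (conj WR' TR') DR' H' Shv Sv Nv'.
  + by move=> [? [? [? [? [? []]]]]].
  + by move=> [? [? [? []]]].
Qed.

End Soundness.

(** * Barbs, weak steps and the conclusion *)

Section Barbs.

Variable S : sorting.

Implicit Types (s t u : stack S) (p q a b c : name S) (bs cs ds L : seq (name S))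
  (P Q R X Y Z W : proc S) (mu : action S) (sigma : stack S).

Lemma nus_stack_mem cs u s e : nus_stack cs u s -> e \in u -> e.1 \notin cs -> e \in s.
Proof.
elim: cs s => [|c cs IH] s /=; first by move=> ->.
move=> [t N1 N2] eu; rewrite inE negb_or => /andP [ec ecs].
exact: (nu_stack_mem N2 (IH _ N1 eu ecs) ec).
Qed.

(** A barb of [R] is shared. A barb of [P] is a typed discreet output, which the game answers by a
    weak output with the same subject. *)
Lemma filled_barb s Z W a : clean s -> filled s Z W -> barb Z a ->
  seqn s = 0 \/ outc a || cont a -> weak_barb (seqn s) W a.
Proof.
move=> C F HZ Ha; have [_ TW] := filled_wtyped F.
case: F TW HZ => cs R P Q t sigma u -> -> U [WR TR] DR H Sh St N TW HZ.
have [DP DQ [WP TP] [WQ TQ]] := wb_facts H.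
have fin Q1 : wtau Q Q1 -> barb (Par R Q1) a -> a \notin cs ->
    weak_barb (seqn s) (nus cs (Par R Q)) a.
  move=> R1 B1 ac; have WQ1 := wtau_process WQ R1.
  have [ds [bs [X K]]] := barb_nus (par_process WR WQ1) B1 ac.
  have R2 := wtau_fill cs WR WQ R1.
  by apply: (barb_wtau R2); apply: barb_intro K Ha; apply: wtau_wtyped R2.
have [ac B1] := barb_nus_inv (par_process WR WP) HZ.
case: (barb_par_inv B1) => [BR|[ds0 [bs0 [P0 K0]]]].
  by apply: (fin Q) => //; [exact: rt_refl|exact: barb_parL].
have [ds [bs [P' [K A]]]] := output_fresh (fn Q ++ names_of sigma) K0 WP.
move: A; rewrite apart_catr => /andP [A1 /apartP A2].
have [s1 O _] := subject_reduction K TP WP.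
have [_ E] := trans_process K WP.
have pd p : cont p -> p \in bs -> p \in ds.
  by move=> cp pb; apply: discreet_output DP WP K cp pb.
have Cf : config_trans sigma P (AOut ds a bs) s1 P'.
  split; last exact: out_step_next.
  split=> //.
  + split=> //; first exact: typ_seq.
    have Es := seqn_shuffle Sh St (typ_stk TR) (typ_stk TP).
    have [_ Eu] := nus_stack_stk N St.
    case: Ha => [E0|Ha]; first by apply: Or31; lia.
    case E1: (seqn sigma) => [|[|n]]; [exact: Or31|exact: Or33|].
    by have := seqn_le1 sigma; rewrite E1.
  + move=> p cp; rewrite mem_filter /= mem_cat inE => /andP [pNd /or3P [pd'|/eqP Ep|pb]].
    * by rewrite pd' in pNd.
    * subst p; move=> _.
      case: O => [s2 _ Es|ia|oa|s2 oa]; last 3 first.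
      -- by rewrite (cont_inc cp) in ia.
      -- by rewrite (cont_outc cp) in oa.
      -- by rewrite (cont_outc cp) in oa.
      exists TO, s2; split=> // /names_tag as2.
      have := typ_stk TP; rewrite Es /= => /and5P [_ n1 _ _ _].
      case: as2 => H1; first by rewrite H1 in n1.
      (* [a] is not restricted by the context, so its tags survive into the outer stack, where
         cleanness forbids having both. *)
      have ins x : x \in sigma -> x.1 = a -> x \in s.
        move=> xs Ex; apply: (nus_stack_mem N); last by rewrite Ex.
        by rewrite (shuffle_mem Sh) mem_cat xs orbT.
      have I1 : (a, TO) \in s by apply: ins => //; rewrite Es mem_head.
      have I2 : (a, TI) \in s by apply: ins => //; rewrite Es inE H1 orbT.
      have /allP /(_ a (mem_names I1)) := C.
      by rewrite /both_tags I1 I2.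
    * by rewrite (pd _ cp pb) in pNd.
have Da : discreet_action sigma (AOut ds a bs) by move=> p cp /(pd p cp) /A2.
case: (wb_step H Cf Da).
- by rewrite /= -apart_disjoint.
- move=> [Q' [Q1 [Q2 [R1 K3 _]]] _].
  apply: (fin Q1) => //; apply: barb_parR; first exact: wtau_process R1.
  by do 3!eexists; exact: K3.
- by move=> [? [? [? [? [? []]]]]].
- by move=> [? [? [? []]]].
Qed.

Definition filled_upto s X Y := exists Z W,
  [/\ barbed_bisimilar s X Z, filled s Z W & barbed_bisimilar s W Y].

(** Each answer starts from some [W0] barbed bisimilar to [W], hence to [Y], from which its weak
    step is replayed. The challenger stays exactly [Z1], so the steps compose. *)
Lemma filled_wtau s Z W Y Z1 : clean s -> filled s Z W -> barbed_bisimilar s W Y ->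
  wtau Z Z1 -> exists Y1 W1, [/\ wtau Y Y1, filled s Z1 W1 & barbed_bisimilar s W1 Y1].
Proof.
move=> C F B R; elim: R W Y F B => [x y K|x|x y z _ IH1 _ IH2] W Y F B.
- have [W0 [W1 [B0 R1 F1]]] := filled_step C F K.
  have [Y1 RY B1] := bb_wtau (bb_trans (bb_sym B0) B) R1.
  by exists Y1, W1.
- by exists Y, W; split=> //; apply: rt_refl.
- have [Y1 [W1 [R1 F1 B1]]] := IH1 _ _ F B.
  have [Y2 [W2 [R2 F2 B2]]] := IH2 _ _ F1 B1.
  by exists Y2, W2; split=> //; apply: rt_trans R1 R2.
Qed.

Lemma filled_upto_sym s X Y : filled_upto s X Y -> filled_upto s Y X.
Proof. by move=> [Z [W [/bb_sym B1 /filled_sym F /bb_sym B2]]]; exists W, Z. Qed.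

Lemma filled_upto_barb s X Y a : clean s -> filled_upto s X Y ->
  weak_barb (seqn s) X a -> weak_barb (seqn s) Y a.
Proof.
move=> C [Z [W [B1 F B2]]] /(bb_barb a B1) /barb_elim [Z0 [ds [bs [Z1 [R K Ha]]]]].
have [Y1 [W1 [R1 F1 B3]]] := filled_wtau C F B2 R.
apply: (barb_wtau R1); apply/(bb_barb a B3).
by apply: filled_barb F1 _ Ha => //; exists ds, bs, Z1.
Qed.

Lemma filled_barbed s X Y : clean s -> filled_upto s X Y -> barbed_bisimilar s X Y.
Proof.
move=> C F; exists (filled_upto s) => //; split.
- by move=> P Q [Z [W [/bb_wtyped [? _] _ /bb_wtyped [_ ?]]]].
- exact: filled_upto_sym.
- move=> P Q [Z [W [B1 F1 B2]]] P' K.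
  have [Z1 R1 B3] := bb_wtau B1 (rt_step _ _ _ _ K).
  have [Q' [W1 [R2 F2 B4]]] := filled_wtau C F1 B2 R1.
  by exists Q' => //; exists Z1, W1.
- move=> P Q F1 a; split; apply: filled_upto_barb => //; exact: filled_upto_sym.
Qed.

Lemma ctx_typ_inv s' sigma E : ctx_typ sigma s' E -> exists t u,
  [/\ wtyped t (ctx_proc E), interleaving u t sigma & nus_stack (ctx_names E) u s'].
Proof.
elim=> [t u R W T I|a cs R s s1 _ [t [u [T I N]]] Na].
- by exists t, u.
- by exists t, u; split=> //; exists s.
Qed.

End Barbs.

Theorem mainTheorem17 (S : sorting) (sigma : stack S) (P Q : proc S)
    (sigma_stack : is_stack sigma)
    (P_process : process P) (Q_process : process Q)
    (P_discreet : discreet P) (Q_discreet : discreet Q) :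
  wb_bisimilar sigma P Q -> barbed_equivalent sigma P Q.
Proof.
move=> H; have [_ _ TP TQ] := wb_facts H; split=> // s' E Ss' C.
case/ctx_typ_inv => t [u [TR [Su Sh] N]].
have Stu : stk u by rewrite -is_stackE.
set R := ctx_proc E in TR *; have [WR TyR] := TR.
(* The context may repeat names, whereas the closure, like the normal forms, binds distinct ones. *)
have [cs [U Ncs Ecs]] := nus_stack_uniq (fn (Par R P) ++ fn (Par R Q)) N Stu.
have EP : fill E P = nus cs (Par R P).
  by apply: Ecs => x xP; rewrite mem_cat xP.
have EQ : fill E Q = nus cs (Par R Q).
  by apply: Ecs => x xQ; rewrite mem_cat xQ orbT.
(* From here on the context process is replaced by its delayed, discreet version; [key] says that
   this is invisible whatever well-typed process fills the hole. *)
have [R' HR DR] := discreet_exp WR.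
have TR' : wtyped t R' by split; [exact: process_exp HR WR|exact: typ_exp TyR WR _ HR].
have key X : wtyped sigma X -> barbed_bisimilar s' (nus cs (Par R X)) (nus cs (Par R' X)).
  move=> TX; apply: exp_barbed => //; first exact: wtyped_fill TR TX Sh Stu Ncs.
  by apply/exp_nus/E_par => //; apply: exp_refl.
rewrite EP EQ; apply: filled_barbed => //.
exists (nus cs (Par R' P)), (nus cs (Par R' Q)).
split; [exact: key| |exact/bb_sym/key].
exact: Filled erefl erefl U TR' DR H Sh Stu Ncs.
Qed.
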